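(* Let $\lambda$ be an $\ell$-multipartition of $n$, let $\kappa\in\mathbb Z^\ell$ satisfy $\kappa_l-\kappa_{l+1}>n$ for $1\le l<\ell$, and let $\mathcal O=\mathbb Z[t,t^{-1}]$ with $t$ an indeterminate. Then the Gram determinant of the Specht module $S^\lambda$ of $\mathscr H_n(\mathcal O,t,\kappa)$ with respect to the Murphy basis is $$\det\mathcal G^\lambda=t^{\ell(\lambda)}\prod_{e\ge2}\Phi_e(t)^{\deg_e(\lambda)},$$ where $\ell(\lambda)=\sum_{\mathfrak t\in\mathrm{Std}(\lambda)}\ell(d(\mathfrak t))$ and $\Phi_e(t)$ is the $e$th cyclotomic polynomial.
   Context: Quantum integers: $[d]=1+t+\dots+t^{d-1}$ for $d\ge0$, $[d]=-(t^{-1}+\dots+t^{d})$ for $d<0$. The cyclotomic Hecke algebra $\mathscr H_n(\mathcal O,t,\kappa)$ is the unital $\mathcal O$-algebra with generators $L_1,\dots,L_n,T_1,\dots,T_{n-1}$ and relations $\prod_{l=1}^\ell(L_1-[\kappa_l])=0$, $(T_r+1)(T_r-t)=0$, $L_rL_s=L_sL_r$, $T_rT_s=T_sT_r$ ($|r-s|>1$), $T_sT_{s+1}T_s=T_{s+1}T_sT_{s+1}$, $T_rL_s=L_sT_r$ ($s\ne r,r+1$), $L_{r+1}(T_r-t+1)=T_rL_r+1$. For $w\in\mathfrak S_n$ with reduced expression $w=s_{r_1}\cdots s_{r_k}$ ($s_r=(r,r+1)$), $T_w=T_{r_1}\cdots T_{r_k}$ and $\ell(w)=k$. An $\ell$-multipartition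 $\lambda=(\lambda^{(1)},\dots,\lambda^{(\ell)})$ of $n$ has diagram the nodes $(l,r,c)$ with $1\le c\le\lambda^{(l)}_r$; a $\lambda$-tableau is a bijection from the diagram to $\{1,\dots,n\}$, standard if entries increase along rows and down columns in each component; $\mathrm{Std}(\lambda)$ is the set of these. Dominance: $\lambda\trianglerighteq\mu$ iff $\sum_{k<l}|\lambda^{(k)}|+\sum_{j\le i}\lambda^{(l)}_j\ge\sum_{k<l}|\mu^{(k)}|+\sum_{j\le i}\mu^{(l)}_j$ for all $l,i$. $\mathfrak t^\lambda$ is the tableau with $1,\dots,n$ entered in order along the rows of component 1, then component 2, etc.; $\mathfrak S_n$ acts on tableaux on the right by permuting entries, and $d(\mathfrak t)$ is defined by $\mathfrak t=\mathfrak t^\lambda d(\mathfrak t)$. $\mathfrak S_\lambda$ is the row stabiliser of $\mathfrak t^\lambda$. Set $u_\lambda=\prod_{1\le l<\ell}\prod_{r=1}^{|\lambda^{(1)}|+\dots+|\lambda^{(l)}|}t^{-\kappa_{l+1}}(L_r-[\kappa_{l+1}])$, $x_\lambda=\sum_{w\in\mathfrak S_\lambda}T_w$, $m_\lambda=u_\lambda x_\lambda$ and $m_{\mathfrak s\mathfrak t}=T_{d(\mathfrak s)^{-1}}m_\lambda T_{d(\mathfrak t)}$ for $\mathfrak s,\mathfrak t\in\mathrm{Std}(\lambda)$ (the Murphy basis, a cellular basis of $\mathscr H_n$). Let $\mathscr H^{\rhd\lambda}$ be the $\mathcal O$-span of $m_{\mathfrak u\mathfrak v}$ with $\mathfrak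 u,\mathfrak v\in\mathrm{Std}(\mu)$, $\mu\rhd\lambda$. The Gram matrix is $\mathcal G^\lambda=(\langle m_{\mathfrak s},m_{\mathfrak t}\rangle)_{\mathfrak s,\mathfrak t\in\mathrm{Std}(\lambda)}$ where $\langle m_{\mathfrak s},m_{\mathfrak t}\rangle\in\mathcal O$ is determined by $m_{\mathfrak t^\lambda\mathfrak s}m_{\mathfrak t\mathfrak t^\lambda}\equiv\langle m_{\mathfrak s},m_{\mathfrak t}\rangle m_{\mathfrak t^\lambda\mathfrak t^\lambda}\pmod{\mathscr H^{\rhd\lambda}}$. Degrees: for $e\ge2$ the residue of node $(l,r,c)$ is $\kappa_l+c-r\bmod e$. Node $\beta=(l',r',c')$ is below $\alpha=(l,r,c)$ if $(l,r,c)<(l',r',c')$ lexicographically. A node $A\notin\mu$ is addable if $\mu\cup\{A\}$ is a multipartition; $B\in\mu$ is removable if $\mu\setminus\{B\}$ is a multipartition. For an $i$-node $A$ (residue $i$), $d_A(\mu)$ = #(addable $i$-nodes of $\mu$ strictly below $A$) $-$ #(removable $i$-nodes of $\mu$ strictly below $A$). For a standard $\mu$-tableau $\mathfrak t$ with $m$ entries, $\deg_e(\mathfrak t)=0$ if $m=0$, else $\deg_e(\mathfrak t)=\deg_e(\mathfrak t_{\downarrow(m-1)})+d_A(\mu)$ with $A=\mathfrak t^{-1}(m)$ and $\mathfrak t_{\downarrow(m-1)}$ the subtableau containing $1,\dots,m-1$. $\deg_e(\lambda)=\sum_{\mathfrak t\in\mathrm{Std}(\lambda)}\deg_e(\mathfrak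 t)$. *)

(* Defs.v *)
From HB Require Import structures.
From mathcomp Require Import all_boot all_order all_algebra all_fingroup.
From mathcomp Require Import cyclotomic.
From mathcomp Require Import boolp.
From mathcomp Require Import ring.
Set Implicit Arguments. Unset Strict Implicit. Unset Printing Implicit Defensive.
Import Order.TTheory GRing.Theory Num.Theory.
Local Open Scope ring_scope.

Local Notation "x %:F" := (@FracField.tofrac _ x).
Definition F := {fraction {poly int}}.
Definition tF : F := ('X : {poly int})%:F.

Definition laurent_pred (x : F) : bool :=
  `[< exists (k : nat) (p : {poly int}), x * tF ^+ k = p%:F >].

Lemma laurent_subring : subring_closed laurent_pred.
Proof.
split.
- by apply/asboolP; exists 0%N, 1; rewrite expr0 mulr1 tofrac1.
- move=> x y /asboolP [a [p Hp]] /asboolP [b [q Hq]]; apply/asboolP.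
  exists (a + b)%N, (p * 'X ^+ b - q * 'X ^+ a).
  rewrite tofracB !tofracM !tofracXn -/tF -Hp -Hq exprD; ring.
- move=> x y /asboolP [a [p Hp]] /asboolP [b [q Hq]]; apply/asboolP.
  exists (a + b)%N, (p * q).
  rewrite tofracM -Hp -Hq exprD; ring.
Qed.

HB.instance Definition _ := GRing.isSubringClosed.Build F laurent_pred laurent_subring.

Record O := MkO { Oval : F; _ : Oval \in laurent_pred }.
HB.instance Definition _ := [isSub for Oval].
HB.instance Definition _ := [Choice of O by <:].
HB.instance Definition _ := [SubChoice_isSubComNzRing of O by <:].

Definition t : O := insubd 0 tF.
Definition tinv : O := insubd 0 tF^-1.    (* t^{-1}, which lies in O *)

Definition tz (k : int) : O :=
  match k with Posz m => t ^+ m | Negz m => tinv ^+ m.+1 end.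

Definition qint (d : int) : O :=
  match d with
  | Posz m => \sum_(i < m) t ^+ i
  | Negz m => - \sum_(i < m.+1) tinv ^+ i.+1
  end.

(* ---------- combinatorics (all indices 0-based) ---------- *)
Section Combinatorics.
Variables (ell n : nat).

(* an ell-multipartition: component l is the (weakly decreasing, positive) list of
   its row lengths *)
Definition mpart := 'I_ell -> seq nat.

Definition is_partition (s : seq nat) : bool := sorted geq s && all (fun x => 0 < x)%N s.

Definition is_mpart (lam : mpart) : bool :=
  [forall l, is_partition (lam l)] && (\sum_(l < ell) sumn (lam l) == n)%N.

Definition inmp (lam : mpart) (l : 'I_ell) (r c : nat) : bool := (c < nth 0 (lam l) r)%N.

(* the partial sums in the definition of dominance, with i 0-based *)
Definition domsum (lam : mpart) (l : 'I_ell) (i : nat) : nat :=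
  (\sum_(k < ell | (k < l)%N) sumn (lam k) + \sum_(j < i.+1) nth 0 (lam l) j)%N.

Definition dom (lam mu : mpart) : Prop :=
  forall (l : 'I_ell) (i : nat), (domsum mu l i <= domsum lam l i)%N.

Definition sdom (lam mu : mpart) : Prop := dom lam mu /\ exists l, lam l != mu l.

(* entry (0-based, i.e. entry k stands for k+1) of t^lam at node (l,r,c) *)
Definition tlam (lam : mpart) (l : 'I_ell) (r c : nat) : nat :=
  (\sum_(k < ell | (k < l)%N) sumn (lam k) + \sum_(j < r) nth 0 (lam l) j + c)%N.

Definition pnat (w : 'S_n) (i : nat) : nat :=
  if @insub _ (fun k => k < n)%N _ i is Some j then val (w j) else i.

(* the tableau t^lam w (permutations act on the right on entries) *)
Definition tabw (lam : mpart) (w : 'S_n) (l : 'I_ell) (r c : nat) : nat :=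
  pnat w (tlam lam l r c).

(* nodes in a box large enough to contain all diagrams of size <= n and
   their addable nodes *)
Definition node := ('I_ell * 'I_n.+1 * 'I_n.+1)%type.

Definition is_std (lam : mpart) (tab : 'I_ell -> nat -> nat -> nat) : bool :=
  [forall x : node, let: (l, r, c) := x in
     inmp lam l r c ==>
       ((inmp lam l r c.+1 ==> (tab l r c < tab l r c.+1)%N) &&
        (inmp lam l r.+1 c ==> (tab l r c < tab l r.+1 c)%N))].

(* Std(lam), each standard tableau t being represented by d(t), t = t^lam d(t) *)
Definition Std (lam : mpart) : {set 'S_n} := [set w | is_std lam (tabw lam w)].

Definition rowstab (lam : mpart) : {set 'S_n} :=
  [set w : 'S_n | [forall x : node, let: (l, r, c) := x in
     inmp lam l r c ==>
       [exists c' : 'I_n.+1, inmp lam l r c' && (tlam lam l r c' == pnat w (tlam lam l r c))]]].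

Definition sr (r : nat) : 'S_n :=
  match @insub _ (fun k => k < n)%N _ r, @insub _ (fun k => k < n)%N _ r.+1 with
  | Some a, Some b => tperm a b
  | _, _ => 1%g
  end.

(* a reduced expression w = s_{r_1} ... s_{r_k} (product in 'S_n, acting on the right),
   computed by repeatedly splitting off a left descent *)
Fixpoint redw_f (fuel : nat) (w : 'S_n) : seq nat :=
  match fuel with
  | 0 => [::]
  | k.+1 =>
    match [pick r : 'I_n | (r.+1 < n)%N && (pnat w r.+1 < pnat w r)%N] with
    | Some r => (r : nat) :: redw_f k (sr r * w)%g
    | None => [::]
    end
  end.
Definition redw (w : 'S_n) : seq nat := redw_f (n * n) w.

Definition len (w : 'S_n) : nat := size (redw w).

Definition len_mp (lam : mpart) : nat := (\sum_(w in Std lam) len w)%N.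

Variable kappa : 'I_ell -> int.

Definition kap (i : nat) : int :=
  if @insub _ (fun k => k < ell)%N _ i is Some j then kappa j else 0.

Definition nlt (a b : node) : bool :=
  let: (l, r, c) := a in let: (l', r', c') := b in
  (l < l')%N || ((l == l' :> nat) && ((r < r')%N || ((r == r' :> nat) && (c < c')%N))).

Definition diag := 'I_ell -> nat -> nat -> bool.

Definition is_diag (D : diag) : bool :=
  [forall x : node, let: (l, r, c) := x in
     D l r c ==> ((((r : nat) == 0)%N || D l r.-1 c) && (((c : nat) == 0)%N || D l r c.-1))].

Definition innode (D : diag) (x : node) : bool := let: (l, r, c) := x in D l r c.
Definition addD (D : diag) (x : node) : diag :=
  fun l r c => D l r c || (((l : nat), r, c) == (x.1.1 : nat, x.1.2 : nat, x.2 : nat)).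
Definition delD (D : diag) (x : node) : diag :=
  fun l r c => D l r c && (((l : nat), r, c) != (x.1.1 : nat, x.1.2 : nat, x.2 : nat)).

Definition addable (D : diag) (x : node) : bool := ~~ innode D x && is_diag (addD D x).
Definition removable (D : diag) (x : node) : bool := innode D x && is_diag (delD D x).

Definition content (x : node) : int := let: (l, r, c) := x in kappa l + c%:Z - r%:Z.

Definition same_res (e : nat) (x y : node) : bool := (e%:Z %| content x - content y)%Z.

Definition dA (e : nat) (D : diag) (A : node) : int :=
  #|[pred B : node | nlt A B && same_res e A B && addable D B]|%:Z
  - #|[pred B : node | nlt A B && same_res e A B && removable D B]|%:Z.

(* deg_e of the subtableau of tab (shape lam) containing the (0-based) entries < m *)
Fixpoint deg_tab (e : nat) (lam : mpart) (tab : 'I_ell -> nat -> nat -> nat) (m : nat) : int :=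
  match m with
  | 0 => 0
  | m'.+1 =>
    deg_tab e lam tab m' +
    match [pick x : node | innode (inmp lam) x && (let: (l, r, c) := x in tab l r c == m')] with
    | Some A => dA e (fun l r c => inmp lam l r c && (tab l r c <= m')%N) A
    | None => 0
    end
  end.

Definition deg_mp (e : nat) (lam : mpart) : int :=
  \sum_(w in Std lam) deg_tab e lam (tabw lam w) n.

Definition hecke_rel (A : algType O) (L T : nat -> A) : Prop :=
  ((0 < n)%N -> \prod_(l < ell) (L 0 - (qint (kappa l))%:A) = 0) /\
  (forall r, (r.+1 < n)%N -> (T r + 1) * (T r - t%:A) = 0) /\
  (forall r s, (r < n)%N -> (s < n)%N -> L r * L s = L s * L r) /\
  (forall r s, (r.+1 < n)%N -> (s.+1 < n)%N -> (r.+1 < s)%N \/ (s.+1 < r)%N ->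
     T r * T s = T s * T r) /\
  (forall s, (s.+2 < n)%N -> T s * T s.+1 * T s = T s.+1 * T s * T s.+1) /\
  (forall r s, (r.+1 < n)%N -> (s < n)%N -> s <> r -> s <> r.+1 -> T r * L s = L s * T r) /\
  (forall r, (r.+1 < n)%N -> L r.+1 * (T r - t%:A + 1) = T r * L r + 1).

Variables (H : algType O).

(* H with generators L 0..n-1, T 0..n-2 is the O-algebra presented by the above relations
   (universal property) *)
Definition is_hecke (L T : nat -> H) : Prop :=
  hecke_rel L T /\
  forall (B : algType O) (L' T' : nat -> B),
    hecke_rel L' T' ->
    (exists f : {lrmorphism H -> B},
        (forall r, (r < n)%N -> f (L r) = L' r) /\ (forall r, (r.+1 < n)%N -> f (T r) = T' r)) /\
    (forall f g : {lrmorphism H -> B},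
        (forall r, (r < n)%N -> f (L r) = g (L r)) ->
        (forall r, (r.+1 < n)%N -> f (T r) = g (T r)) -> f =1 g).

Variables (L T : nat -> H).

Definition Tw (w : 'S_n) : H := \prod_(r <- redw w) T r.

Definition u_mp (lam : mpart) : H :=
  \prod_(l < ell | (l.+1 < ell)%N)
    \prod_(r < \sum_(k < ell | (k <= l)%N) sumn (lam k))
      ((tz (- kap l.+1))%:A * (L r - (qint (kap l.+1))%:A)).

Definition x_mp (lam : mpart) : H := \sum_(w in rowstab lam) Tw w.

Definition m_mp (lam : mpart) : H := u_mp lam * x_mp lam.

(* m_{st} with s = t^lam u, t = t^lam v *)
Definition murphy (lam : mpart) (u v : 'S_n) : H := Tw (u^-1)%g * m_mp lam * Tw v.

Definition in_Habove (lam : mpart) (x : H) : Prop :=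
  exists (k : nat) (mu : 'I_k -> mpart) (u v : 'I_k -> 'S_n) (c : 'I_k -> O),
    (forall i, [/\ is_mpart (mu i), sdom (mu i) lam, u i \in Std (mu i) & v i \in Std (mu i)]) /\
    x = \sum_(i < k) c i *: murphy (mu i) (u i) (v i).

Definition is_gram (lam : mpart) (G : 'M[O]_#|Std lam|) : Prop :=
  forall i j : 'I_#|Std lam|,
    in_Habove lam (murphy lam 1%g (enum_val i) * murphy lam (enum_val j) 1%g
                   - G i j *: murphy lam 1%g 1%g).

End Combinatorics.

(* Main.v *)
(* Over the field F of fractions, every multipartition lam has a seminormal representation
   of H, whose basis is indexed by standard tableaux; the gap condition on kappa makes the
   contents of consecutive entries distinct.  A support argument shows that m_mu acts by
   zero on it unless lam dominates mu, and that m_lam maps everything to the line of e_1, the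
   vector of t^lam.  Since e_1 m_lam = gamma_1 e_1, the Gram matrix is A D A^T, where the rows
   of A are the coordinates of the vectors e_1 T_d(s), A is unitriangular for the length, and
   D is diagonal with entries the norms gamma_u of the invariant form.  The recursion
   gamma_{u s_r} = f gamma_u, f the off-diagonal seminormal coefficient, is solved by
   t^len(u) times a product of quantum integers [c - c_B]^{+-1} over addable (+) and removable
   (-) nodes B below the node of each entry.  As [k] is the product of the Phi_e with
   e | k and e > 1, the exponent of Phi_e in gamma_u is deg_e of the tableau.
   Existence of the Gram matrix: a product of Murphy elements is a combination of Murphy
   elements by the Garnir relations, and letting it act on the seminormal representations, minimal
   shapes first, shows that only m_lam and elements of shapes dominating lam occur. *)
From HB Require Import structures.
From mathcomp Require Import all_boot all_order all_algebra all_fingroup.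
From mathcomp Require Import cyclotomic boolp zify ring.
Require Import Defs.
Set Implicit Arguments. Unset Strict Implicit. Unset Printing Implicit Defensive.
Import Order.TTheory GRing.Theory Num.Theory.
Local Open Scope ring_scope.

(** [H] is known only through its universal property, so neither a basis of it nor the independence
    of the Murphy elements is available. Inside [H] only spanning is proved; coefficients are
    compared after mapping [H] to matrices over [F], where the maps x -> <x, a_u> a_v of one shape
    are independent. Hence existence of the Gram matrix uses the representations of all shapes, its
    uniqueness only that of [lam], which kills the elements above [lam]. Straightening is controlled
    by the crude measure [msr]; dominance is recovered afterwards from the representations. Spanning
    starts from T_x u_a T_y with arbitrary cut points a, because the span of this family is closed
    under multiplication by each L_k: at a cut the cut moves by one, elsewhere k can be lowered. The
    gap in [kappa] acts twice: entries at distance at most two have distinct contents, which keeps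
    the denominators in the seminormal relations nonzero, and all content differences to free nodes
    below are positive, so that every quantum integer in a norm is nonzero and factors into
    cyclotomic polynomials. *)

Definition swp (r i : nat) := if i == r then r.+1 else if i == r.+1 then r else i.

Variant swp_spec (r i : nat) : nat -> Type :=
  | SwpL of i = r : swp_spec r i r.+1
  | SwpR of i = r.+1 : swp_spec r i r
  | SwpN of i <> r & i <> r.+1 : swp_spec r i i.

Lemma swpP (r i : nat) : swp_spec r i (swp r i).
Proof. by rewrite /swp; do 2 (case: eqP => ?; first by constructor); constructor. Qed.

Ltac case_swp := repeat match goal with |- context [swp ?r ?i] =>
  lazymatch i with context [swp _ _] => fail | _ =>
    case: (swpP r i) => [?|?|? ?]; try (exfalso; lia); subst end end; try lia; try done.

Lemma swpK (r : nat) : involutive (swp r).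
Proof. by move=> i; case_swp. Qed.

Lemma swpl (r : nat) : swp r r = r.+1.
Proof. by rewrite /swp eqxx. Qed.

Lemma swpr (r : nat) : swp r r.+1 = r.
Proof. by case_swp. Qed.

(** * Permutations and the type A Hecke algebra *)

Section PermNat.
Variable n : nat.
Implicit Types (u v w : 'S_n) (i j r : nat).

Lemma pnat_ord w (i : 'I_n) : pnat w i = nat_of_ord (w i).
Proof. by rewrite /pnat valK. Qed.

Lemma pnat_out w i : (n <= i)%N -> pnat w i = i.
Proof. by move=> le_ni; rewrite /pnat insubF // ltnNge le_ni. Qed.

Lemma pnat_lt w i : (i < n)%N -> (pnat w i < n)%N.
Proof. by move=> lt_in; rewrite (pnat_ord w (Ordinal lt_in)). Qed.

Lemma pnatM u v i : pnat (u * v)%g i = pnat v (pnat u i).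
Proof.
case: (ltnP i n) => [lt_in | le_ni]; last by rewrite !pnat_out.
by rewrite !(pnat_ord _ (Ordinal lt_in)) pnat_ord permM.
Qed.

Lemma pnat1 i : pnat (1 : 'S_n)%g i = i.
Proof.
case: (ltnP i n) => [lt_in | le_ni]; last by rewrite !pnat_out.
by rewrite (pnat_ord _ (Ordinal lt_in)) perm1.
Qed.

Lemma pnatK w : cancel (pnat w) (pnat w^-1%g).
Proof. by move=> i; rewrite -pnatM mulgV pnat1. Qed.

Lemma pnatKV w : cancel (pnat w^-1%g) (pnat w).
Proof. by move=> i; rewrite -pnatM mulVg pnat1. Qed.

Lemma pnat_inj w : injective (pnat w).
Proof. exact: can_inj (pnatK w). Qed.

Lemma pnat_ext u v : (forall i, (i < n)%N -> pnat u i = pnat v i) -> u = v.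
Proof. by move=> eq_uv; apply/permP=> i; apply: val_inj; rewrite /= -!pnat_ord eq_uv. Qed.

Lemma pnat_sr r i : (r.+1 < n)%N -> pnat (sr n r) i = swp r i.
Proof.
move=> lt_rn; have lt_r : (r < n)%N by apply: ltnW.
rewrite /sr (insubT (fun k => k < n)%N lt_r) (insubT (fun k => k < n)%N lt_rn) /=.
case: (ltnP i n) => [lt_in | le_ni].
  rewrite (pnat_ord _ (Ordinal lt_in)) permE /= /swp -!val_eqE /=.
  by case: eqP => //; case: eqP.
by rewrite pnat_out //; move: le_ni; case_swp.
Qed.

Lemma pnat_srl r w i : (r.+1 < n)%N -> pnat (sr n r * w)%g i = pnat w (swp r i).
Proof. by move=> lt_rn; rewrite pnatM pnat_sr. Qed.

Lemma srK r : (r.+1 < n)%N -> (sr n r * sr n r = 1)%g.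
Proof. by move=> lt; apply: pnat_ext => i _; rewrite pnatM !pnat_sr // swpK pnat1. Qed.

Lemma srV r : (r.+1 < n)%N -> (sr n r)^-1%g = sr n r.
Proof. by move=> lt; rewrite -[LHS]mulg1 -(srK lt) mulKg. Qed.

Lemma srKl r w : (r.+1 < n)%N -> (sr n r * (sr n r * w) = w)%g.
Proof. by move=> lt; rewrite mulgA srK // mul1g. Qed.

Lemma srKr r w : (r.+1 < n)%N -> (w * sr n r * sr n r = w)%g.
Proof. by move=> lt; rewrite -mulgA srK // mulg1. Qed.

Lemma sr_comm r q : (r.+1 < n)%N -> (q.+1 < n)%N -> (r.+1 < q)%N \/ (q.+1 < r)%N ->
  (sr n r * sr n q = sr n q * sr n r)%g.
Proof.
move=> lr lq far; apply: pnat_ext => i _; by rewrite !pnatM !pnat_sr //; case_swp.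
Qed.

Lemma sr_braid r : (r.+2 < n)%N ->
  (sr n r * sr n r.+1 * sr n r = sr n r.+1 * sr n r * sr n r.+1)%g.
Proof.
move=> lr; have lr' := ltnW lr.
by apply: pnat_ext => i _; by rewrite !pnatM !pnat_sr //; case_swp.
Qed.

(** The Coxeter length, by [lenE]. As a cardinality of inversions it is easier to compare than the
    size of a chosen reduced word. *)
Definition ninv w := #|[pred x : 'I_n * 'I_n | (x.1 < x.2)%N && (w x.2 < w x.1)%N]|.

Lemma ninvV w : ninv w^-1%g = ninv w.
Proof.
have inj (v : 'S_n) : injective (fun x : 'I_n * 'I_n => (v x.2, v x.1)).
  by move=> [a b] [c d] [] /perm_inj -> /perm_inj ->.
rewrite /ninv -(card_image (inj w^-1%g)); apply: eq_card => -[a b].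
rewrite !inE /=; apply/imageP/idP => [[[c d]] | /andP[lt1 lt2]].
  by rewrite inE /= => /andP[lt1 lt2] [-> ->]; rewrite !permKV lt1 lt2.
by exists (w b, w a); rewrite ?inE /= ?permK ?lt1 ?lt2.
Qed.

Lemma ninv1 : ninv 1%g = 0%N.
Proof. by apply: eq_card0 => x; rewrite !inE !perm1; case: ltngtP. Qed.

Lemma ninv_max w : (ninv w <= n * n)%N.
Proof. by rewrite /ninv (leq_trans (max_card _)) // card_prod card_ord. Qed.

(** Applying s_r to both members of a pair matches the inversions of w with those of s_r w other
    than (r, r+1), which is the new one. *)
Lemma ninv_asc r w : (r.+1 < n)%N -> (pnat w r < pnat w r.+1)%N ->
  ninv (sr n r * w)%g = (ninv w).+1.
Proof.
move=> lt_r1 asc; have lt_r := ltnW lt_r1.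
pose a := Ordinal lt_r; pose b := Ordinal lt_r1.
have sE (i : 'I_n) : nat_of_ord ((sr n r : 'S_n) i) = swp r i by rewrite -pnat_ord pnat_sr.
pose s2 (x : 'I_n * 'I_n) := (sr n r x.1, sr n r x.2).
have s2inj : injective s2 by move=> [i j] [k l] [/perm_inj -> /perm_inj ->].
rewrite /ninv (cardD1 (a, b)) !inE /= ltnSn /=.
have -> : ((sr n r * w)%g b < (sr n r * w)%g a)%N.
  by rewrite -!pnat_ord !pnat_srl //= swpl swpr.
rewrite add1n; congr _.+1.
rewrite -[RHS](card_image s2inj); apply: eq_card => -[i j]; rewrite !inE /=.
have wE (k : 'I_n) : nat_of_ord ((sr n r * w)%g k) = pnat w (swp r k).
  by rewrite -pnat_ord pnat_srl.
apply/idP/imageP.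
  move=> /and3P[neq lt_ij inv]; exists (s2 (i, j)); last first.
    by rewrite /s2 /= -!permM srK // !perm1.
  rewrite inE /= !sE; move: inv; rewrite !wE -!sE !pnat_ord => ->; rewrite andbT !sE.
  move: neq; rewrite xpair_eqE -!val_eqE /=.
  move: lt_ij; move: (nat_of_ord i) (nat_of_ord j) => {}i {}j.
  by move: (r) => q; case_swp.
move=> [[k l]]; rewrite inE /= => /andP[lt_kl inv] [-> ->].
rewrite !permM -!(permM (sr n r) (sr n r)) srK // !perm1 inv andbT.
rewrite !sE xpair_eqE -!val_eqE /= !sE.
move: inv lt_kl asc; rewrite -!pnat_ord.
have := @pnat_inj w k l; move: (nat_of_ord k) (nat_of_ord l) => {}k {}l.
by case_swp.
Qed.

Lemma pnat_neqS r w : pnat w r != pnat w r.+1.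
Proof. by apply/eqP => /pnat_inj; lia. Qed.

Lemma ninv_desc r w : (r.+1 < n)%N -> (pnat w r.+1 < pnat w r)%N ->
  ninv w = (ninv (sr n r * w)%g).+1.
Proof.
move=> lt_r desc; by rewrite -{1}(srKl w lt_r) ninv_asc // !pnat_srl ?swpl ?swpr.
Qed.

Lemma ninv_ascr r w : (r.+1 < n)%N -> (pnat w^-1%g r < pnat w^-1%g r.+1)%N ->
  ninv (w * sr n r)%g = (ninv w).+1.
Proof. by move=> lt_r asc; rewrite -ninvV invMg srV // ninv_asc // ninvV. Qed.

Lemma ninv_descr r w : (r.+1 < n)%N -> (pnat w^-1%g r.+1 < pnat w^-1%g r)%N ->
  ninv w = (ninv (w * sr n r)%g).+1.
Proof.
by move=> lt_r asc; rewrite -ninvV (ninv_desc lt_r asc) -[in RHS]ninvV invMg srV.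
Qed.

(** Going up, an increasing injection satisfies i <= w i; counting down from n, injectivity then
    forces equality. *)
Lemma no_descent w : (forall r, (r.+1 < n)%N -> (pnat w r <= pnat w r.+1)%N) -> w = 1%g.
Proof.
move=> asc.
have ge_id i : (i < n)%N -> (i <= pnat w i)%N.
  elim: i => // i IHi lt_i; have := asc i lt_i; have := pnat_neqS i w.
  by have := IHi (ltnW lt_i); lia.
have le_id k i : (i + k = n)%N -> (forall j, (i <= j < n)%N -> pnat w j = j).
  elim: k i => [|k IHk] i Ek j; first by lia.
  case: (eqVneq i j) => [<- ltj|neq ltj]; last by apply: (IHk i.+1); lia.
  have [le | lt] := leqP (pnat w i) i; first by have := ge_id i; lia.
  have := IHk i.+1 _ (pnat w i) _; rewrite pnat_lt; last lia.
  by move=> E; have /pnat_inj := E ltac:(lia) ltac:(lia); lia.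
by apply: pnat_ext => i lt_i; rewrite pnat1 (le_id n 0%N).
Qed.

Lemma ex_descent w : w != 1%g -> exists r, (r.+1 < n)%N /\ (pnat w r.+1 < pnat w r)%N.
Proof.
move=> neq; apply/not_existsP => none; case/eqP: neq; apply: no_descent => r lt_r.
by rewrite leqNgt; apply/negP => lt; apply: (none r).
Qed.

Lemma ninv_eq0 w : ninv w = 0%N -> w = 1%g.
Proof.
move=> E; apply/eqP/negPn/negP => /ex_descent[r [lt_r desc]].
by have := ninv_desc lt_r desc; rewrite E.
Qed.

Lemma ninv_srl_le r w : (r.+1 < n)%N -> (ninv (sr n r * w)%g <= (ninv w).+1)%N.
Proof.
move=> lt_r; have := pnat_neqS r w; case: (ltngtP (pnat w r)) => // cmp _.
  by rewrite ninv_asc.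
by have := ninv_desc lt_r cmp; lia.
Qed.

Lemma ninv_srr_le r w : (r.+1 < n)%N -> (ninv (w * sr n r)%g <= (ninv w).+1)%N.
Proof. by move=> lt_r; rewrite -ninvV invMg srV // -[ninv w]ninvV ninv_srl_le. Qed.

(** Induction along a reduced word read from the left; most statements about [Tw] are proved this
    way. *)
Lemma perm_ind (P : 'S_n -> Prop) : P 1%g ->
  (forall r w, (r.+1 < n)%N -> (pnat w r < pnat w r.+1)%N -> P w -> P (sr n r * w)%g) ->
  forall w, P w.
Proof.
move=> P1 PS w; have [k] := ubnP (ninv w); elim: k w => // k IHk w lt_k.
case: (eqVneq w 1%g) => [-> //|/ex_descent[r [lt_r desc]]].
rewrite -(srKl w lt_r); apply: PS => //.
  by rewrite !pnat_srl ?swpl ?swpr.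
by apply: IHk; have := ninv_desc lt_r desc; lia.
Qed.

Lemma ninvM_le u v : (ninv (u * v)%g <= ninv u + ninv v)%N.
Proof.
elim/perm_ind: u => [|r u lt_r asc IHu]; first by rewrite mul1g leq_addl.
rewrite ninv_asc // -mulgA; apply: leq_trans (ninv_srl_le _ lt_r) _.
by rewrite addSn ltnS.
Qed.

Lemma redw_f_size k w : (ninv w <= k)%N -> size (redw_f k w) = ninv w.
Proof.
elim: k w => [|k IHk] w le_k /=; first by lia.
case: pickP => [r /andP[lt_r desc] | none] /=.
  by rewrite IHk; have := ninv_desc lt_r desc; lia.
case: (eqVneq w 1%g) => [->|/ex_descent[r [lt_r desc]]]; first by rewrite ninv1.
by have := none (Ordinal (ltnW lt_r)); rewrite /= lt_r desc.
Qed.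

Lemma lenE w : len w = ninv w.
Proof. exact: redw_f_size (ninv_max w). Qed.

(** Only the relations among the T_r, so that everything about [Tw] and [xpar] applies both to [H]
    and to the seminormal matrices. *)
Definition typeA (A : algType O) (T : nat -> A) : Prop :=
  [/\ forall r s, (r.+1 < n)%N -> (s.+1 < n)%N ->
        (r.+1 < s)%N \/ (s.+1 < r)%N -> T r * T s = T s * T r,
      forall s, (s.+2 < n)%N -> T s * T s.+1 * T s = T s.+1 * T s * T s.+1 &
      forall r, (r.+1 < n)%N -> (T r + 1) * (T r - t%:A) = 0].

Section Matsumoto.
Variables (A : algType O) (T : nat -> A).
Hypothesis HT : typeA T.

Let Tcomm : forall r s, (r.+1 < n)%N -> (s.+1 < n)%N ->
  (r.+1 < s)%N \/ (s.+1 < r)%N -> T r * T s = T s * T r.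
Proof. by case: HT. Qed.

Let Tbraid : forall s, (s.+2 < n)%N ->
  T s * T s.+1 * T s = T s.+1 * T s * T s.+1.
Proof. by case: HT. Qed.

(** Unfolding one letter of [redw] leaves less fuel than [n * n]; the word stays the same as long as
    the fuel covers the inversions. *)
Lemma redw_f_stable k k' w : (ninv w <= k)%N -> (ninv w <= k')%N ->
  redw_f k w = redw_f k' w.
Proof.
elim: k k' w => [|k IHk] [|k'] w le_k le_k' //=.
- case: pickP => [r /andP[lt_r desc] | //].
  by have := ninv_desc lt_r desc; lia.
- case: pickP => [r /andP[lt_r desc] | //].
  by have := ninv_desc lt_r desc; lia.
case: pickP => [r /andP[lt_r desc] | //].
by congr cons; apply: IHk; have := ninv_desc lt_r desc; lia.
Qed.

Lemma Tw1 : Tw T (1 : 'S_n)%g = 1.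
Proof.
rewrite /Tw; have : size (redw (1 : 'S_n)%g) = 0%N by rewrite -/(len _) lenE ninv1.
by case: (redw _) => // _; rewrite big_nil.
Qed.

Lemma Tw_some_descent w : w != 1%g -> exists r, [/\ (r.+1 < n)%N,
  (pnat w r.+1 < pnat w r)%N & Tw T w = T r * Tw T (sr n r * w)%g].
Proof.
move=> neq; have [r [lt_r desc]] := ex_descent neq.
have [k Ek] : exists k, (n * n)%N = k.+1 by exists (n * n).-1; nia.
rewrite /Tw /redw {1}Ek /=; case: pickP => [q /andP[lt_q dq] | none]; last first.
  by have := none (Ordinal (ltnW lt_r)); rewrite /= lt_r desc.
exists q; rewrite big_cons; split=> //; congr (_ * \prod_(i <- _) _).
have := ninv_desc lt_q dq; have := ninv_max w; rewrite Ek => *.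
by apply: redw_f_stable; lia.
Qed.

(** Matsumoto's theorem for the particular word chosen by [redw]. The letter q chosen there and the
    given descent r are compared at a common shorter element, s_q s_r w if they commute and s_r s_q
    s_r w if they are adjacent, and induction on the length applies at every intermediate
    element. *)
Lemma Tw_desc w r : (r.+1 < n)%N -> (pnat w r.+1 < pnat w r)%N ->
  Tw T w = T r * Tw T (sr n r * w)%g.
Proof.
have [k] := ubnP (ninv w); elim: k w r => // k IHk w r le_k lt_r desc.
have [q [lt_q dq ->]] : exists q, [/\ (q.+1 < n)%N,
    (pnat w q.+1 < pnat w q)%N & Tw T w = T q * Tw T (sr n q * w)%g].
  apply: Tw_some_descent; apply: contraTneq desc => ->; rewrite !pnat1; lia.
have [-> //|neq] := eqVneq q r.
have pE i j : (i.+1 < n)%N -> pnat (sr n i * w)%g j = pnat w (swp i j) by exact: pnat_srl.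
have pE2 i' i j : (i.+1 < n)%N -> (i'.+1 < n)%N ->
    pnat (sr n i' * (sr n i * w))%g j = pnat w (swp i (swp i' j)).
  by move=> *; rewrite !pnat_srl.
have lt1 := ninv_desc lt_r desc; have lt2 := ninv_desc lt_q dq.
have [far | near] := boolP ((q.+1 < r)%N || (r.+1 < q)%N).
  rewrite (IHk (sr n q * w)%g r) ?(IHk (sr n r * w)%g q) //; try lia.
  - rewrite !mulrA Tcomm //; last by apply/orP.
    by rewrite ![(_ * (_ * w))%g]mulgA sr_comm //; apply/orP; rewrite orbC.
  - by rewrite !pE //; move: desc dq far; case_swp.
  - by rewrite !pE //; move: desc dq far; case_swp.
wlog E : q r lt_q lt_r dq desc {neq near} lt1 lt2 / q = r.+1.
  move=> IH; have [E|E] : q = r.+1 \/ r = q.+1 by lia.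
    exact: IH.
  by apply/esym/IH.
subst q; rewrite (IHk (sr n r * w)%g r.+1) ?(IHk (sr n r.+1 * w)%g r) //; try lia; last 2 first.
- by rewrite !pE //; move: desc dq; case_swp.
- by rewrite !pE //; move: desc dq; case_swp.
have l1 := @ninvM_le (sr n r.+1)%g (sr n r * w)%g.
have d12 : (pnat (sr n r * w)%g r.+2 < pnat (sr n r * w)%g r.+1)%N.
  by rewrite !pE //; move: desc dq; case_swp.
have d21 : (pnat (sr n r.+1 * w)%g r.+1 < pnat (sr n r.+1 * w)%g r)%N.
  by rewrite !pE //; move: desc dq; case_swp.
have lt12 := ninv_desc lt_q d12; have lt21 := ninv_desc lt_r d21.
rewrite (IHk (sr n r.+1 * (sr n r * w))%g r) ?(IHk (sr n r * (sr n r.+1 * w))%g r.+1) //; try lia.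
- by rewrite !mulrA Tbraid // ![(_ * (_ * (_ * w)))%g]mulgA ![(_ * (_ * w))%g]mulgA sr_braid.
- by rewrite !pE2 //; move: desc dq; case_swp.
- by rewrite !pE2 //; move: desc dq; case_swp.
Qed.

Lemma Tw_asc w r : (r.+1 < n)%N -> (pnat w r < pnat w r.+1)%N ->
  T r * Tw T w = Tw T (sr n r * w)%g.
Proof.
move=> lt_r asc; rewrite (@Tw_desc (sr n r * w)%g r) // ?srKl //.
by rewrite !pnat_srl ?swpl ?swpr.
Qed.

Lemma TwM u v : ninv (u * v)%g = (ninv u + ninv v)%N -> Tw T (u * v)%g = Tw T u * Tw T v.
Proof.
elim/perm_ind: u => [|r u lt_r asc IHu]; first by rewrite mul1g Tw1 mul1r.
rewrite ninv_asc // -mulgA => E.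
have := ninvM_le u v; have := pnat_neqS r (u * v)%g.
case: (ltngtP (pnat (u * v)%g r) (pnat (u * v)%g r.+1)) => // cmp _ le.
  rewrite -!Tw_asc // IHu ?mulrA //; apply/eq_add_S.
  by rewrite -(ninv_asc lt_r cmp) E addSn.
move: le; rewrite (ninv_desc lt_r cmp) E; lia.
Qed.

Lemma Tw_sr r : (r.+1 < n)%N -> Tw T (sr n r) = T r.
Proof. by move=> lt_r; rewrite -[sr n r]mulg1 -Tw_asc ?Tw1 ?mulr1 ?pnat1. Qed.

Lemma ninv_sr r : (r.+1 < n)%N -> ninv (sr n r) = 1%N.
Proof. by move=> lt_r; rewrite -[sr n r]mulg1 ninv_asc ?ninv1 ?pnat1. Qed.

Lemma Tw_ascr w r : (r.+1 < n)%N -> (pnat w^-1%g r < pnat w^-1%g r.+1)%N ->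
  Tw T w * T r = Tw T (w * sr n r)%g.
Proof.
move=> lt_r asc; rewrite TwM ?Tw_sr //.
by rewrite ninv_ascr // ninv_sr ?addn1.
Qed.

Lemma Tw_descr w r : (r.+1 < n)%N -> (pnat w^-1%g r.+1 < pnat w^-1%g r)%N ->
  Tw T w = Tw T (w * sr n r)%g * T r.
Proof.
move=> lt_r desc; by rewrite Tw_ascr // ?srKr // invMg srV // !pnat_srl ?swpl ?swpr.
Qed.

Lemma T_sqr r : (r.+1 < n)%N -> T r * T r = (t - 1) *: T r + t%:A.
Proof.
case: HT => _ _ Tquad /Tquad; rewrite mulrDl mul1r mulrBr mulr_algr => E.
rewrite scalerBl scale1r; apply/eqP; rewrite -subr_eq0; apply/eqP; rewrite -[RHS]E.
by rewrite opprD opprB !addrA; congr (_ - _); rewrite addrAC.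
Qed.

Lemma Tw_mulr w r : (r.+1 < n)%N -> (pnat w^-1%g r.+1 < pnat w^-1%g r)%N ->
  Tw T w * T r = (t - 1) *: Tw T w + t *: Tw T (w * sr n r)%g.
Proof.
move=> lt_r desc; rewrite {1}(Tw_descr lt_r desc) -mulrA T_sqr // mulrDr -scalerAr.
by rewrite -(Tw_descr lt_r desc) mulr_algr.
Qed.

Lemma Tw_mull w r : (r.+1 < n)%N -> (pnat w r.+1 < pnat w r)%N ->
  T r * Tw T w = (t - 1) *: Tw T w + t *: Tw T (sr n r * w)%g.
Proof.
move=> lt_r desc; rewrite {1}(Tw_desc lt_r desc) mulrA T_sqr // mulrDl -scalerAl.
by rewrite -(Tw_desc lt_r desc) mulr_algl.
Qed.
End Matsumoto.
End PermNat.

(** * Young subgroups *)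

(* A composition of n is encoded by a weakly increasing colouring col of {0,..,n-1}:
   Spar col is its Young subgroup, and [incr col w] says that w is the shortest
   element of the coset (Spar col) w. *)
Section Parabolic.
Variable n : nat.
Implicit Types (u v w p c : 'S_n) (i j r : nat) (col : nat -> nat).

Definition colmono col := forall i j, (i <= j < n)%N -> (col i <= col j)%N.

Definition Spar col : {set 'S_n} :=
  [set w : 'S_n | [forall i : 'I_n, col (pnat w i) == col i]].

Definition incr col w := 
  [forall i : 'I_n, (i.+1 < n)%N && (col i == col i.+1) ==> (pnat w i < pnat w i.+1)%N].

(** [col] is at least as fine as [col0]. Testing neighbours is enough when [col] is monotone, by
    [refines_eq]. *)
Definition refines col col0 :=
  forall r, (r.+1 < n)%N -> col r = col r.+1 -> col0 r = col0 r.+1.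

Lemma SparP col w :
  reflect (forall i, (i < n)%N -> col (pnat w i) = col i) (w \in Spar col).
Proof.
rewrite inE; apply: (iffP forallP) => [H i lt_i | H i]; last by rewrite H.
by rewrite (eqP (H (Ordinal lt_i))).
Qed.

Lemma incrP col w : reflect
  (forall r, (r.+1 < n)%N -> col r = col r.+1 -> (pnat w r < pnat w r.+1)%N) (incr col w).
Proof.
apply: (iffP forallP) => [H r lt_r E | H r].
  by have := H (Ordinal (ltnW lt_r)); rewrite /= lt_r E eqxx.
by apply/implyP => /andP[lt_r /eqP E]; apply: H.
Qed.

Lemma incr_lt col w i j : colmono col -> incr col w ->
  (i < j < n)%N -> col i = col j -> (pnat w i < pnat w j)%N.
Proof.
move=> mono /incrP inc; elim: j => // j IHj /andP[le_ij lt_j] E.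
have m1 := mono i j; have m2 := mono j j.+1.
have [-> | neq] := eqVneq i j; first by apply: inc; lia.
apply: ltn_trans (inc j _ _); [apply: IHj | |]; lia.
Qed.

Lemma Spar1 col : 1%g \in Spar col.
Proof. by apply/SparP => i _; rewrite pnat1. Qed.

Lemma SparM col u v : u \in Spar col -> v \in Spar col -> (u * v)%g \in Spar col.
Proof.
by move=> /SparP Hu /SparP Hv; apply/SparP => i lt_i; rewrite pnatM Hv ?Hu ?pnat_lt.
Qed.

Lemma SparV col u : u \in Spar col -> u^-1%g \in Spar col.
Proof.
by move=> /SparP Hu; apply/SparP => i lt_i; rewrite -{2}(pnatKV u i) Hu ?pnat_lt.
Qed.

Lemma Spar_sr col r : (r.+1 < n)%N -> col r = col r.+1 -> sr n r \in Spar col.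
Proof. by move=> lt_r E; apply/SparP => i lt_i; rewrite pnat_sr //; case_swp. Qed.

Lemma Spar_desc col p r : colmono col -> p \in Spar col -> (r.+1 < n)%N ->
  (pnat p r.+1 < pnat p r)%N -> col r = col r.+1.
Proof.
move=> mono /SparP Hp lt_r desc; apply/eqP; rewrite eqn_leq mono /=; last by lia.
rewrite -Hp // -(Hp r); last by lia.
by apply: mono; rewrite (ltnW desc) pnat_lt //; lia.
Qed.

(** A descent of an element of the Young subgroup joins two positions of one class, by [Spar_desc],
    so its reduced words stay in the subgroup. *)
Lemma Spar_ind col (P : 'S_n -> Prop) : colmono col -> P 1%g ->
  (forall r p, (r.+1 < n)%N -> col r = col r.+1 -> (pnat p r < pnat p r.+1)%N ->
     p \in Spar col -> P p -> P (sr n r * p)%g) ->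
  forall p, p \in Spar col -> P p.
Proof.
move=> mono P1 PS; elim/perm_ind => // r p lt_r asc IHp Hsp.
have E : col r = col r.+1.
  by apply: (@Spar_desc _ (sr n r * p)%g r mono Hsp lt_r); rewrite !pnat_srl // swpl swpr.
have Hp : p \in Spar col by rewrite -(srKl p lt_r) SparM // Spar_sr.
exact: PS (IHp Hp).
Qed.

Lemma ninv_par col p c : colmono col -> p \in Spar col -> incr col c ->
  ninv (p * c)%g = (ninv p + ninv c)%N.
Proof.
move=> mono Hp inc; apply: (@Spar_ind col (fun p => ninv (p * c)%g = (ninv p + ninv c)%N) mono _ _ p Hp) => [|{Hp}r {}p]; first by rewrite mul1g ninv1.
move=> lt_r E asc Hp IHp; rewrite -mulgA !ninv_asc // ?IHp // !pnatM.
move/SparP: Hp => Hp; apply: incr_lt mono inc _ _; first by rewrite asc pnat_lt.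
by rewrite !Hp //; lia.
Qed.

Lemma ninv_parr col p c : colmono col -> p \in Spar col -> incr col c ->
  ninv (c^-1 * p)%g = (ninv p + ninv c)%N.
Proof.
move=> mono Hp inc; rewrite -ninvV invMg invgK (ninv_par mono _ inc) ?SparV //.
by rewrite ninvV.
Qed.

Lemma par_decomp col y : colmono col -> exists p c, [/\ p \in Spar col, incr col c & y = (p * c)%g].
Proof.
move=> mono; have [k] := ubnP (ninv y); elim: k y => // k IHk y le_k.
have [inc | /forallPn[r]] := boolP (incr col y).
  by exists 1%g, y; rewrite Spar1 mul1g.
rewrite negb_imply -leqNgt => /andP[/andP[lt_r /eqP E]].
have := pnat_neqS r y; case: (ltngtP (pnat y r) (pnat y r.+1)) => // desc _ _.
have [|p [c [Hp inc Ey]]] := IHk (sr n r * y)%g.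
  by have := ninv_desc lt_r desc; lia.
exists (sr n r * p)%g, c; rewrite inc SparM ?Spar_sr // -mulgA -Ey srKl //.
Qed.

(** The quotient g = p'^-1 p satisfies g c = c' and g^-1 c' = c. Lengths add in both products, so g
    has length 0. *)
Lemma par_uniq col p c p' c' : colmono col -> p \in Spar col -> p' \in Spar col ->
  incr col c -> incr col c' -> (p * c = p' * c')%g -> p = p' /\ c = c'.
Proof.
move=> mono Hp Hp' Hc Hc' E.
have Eq : c' = (p'^-1 * p * c)%g by rewrite -mulgA E mulKg.
have Hq : (p'^-1 * p)%g \in Spar col by rewrite SparM ?SparV.
have := ninv_par mono Hq Hc; have := ninv_par mono (SparV Hq) Hc'.
rewrite -Eq {1}Eq mulKg ninvV => e1 e2.
have /ninv_eq0 q1 : ninv (p'^-1 * p)%g = 0%N by lia.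
by move: Eq; rewrite q1 mul1g => ->; split=> //; apply/(mulgI p'^-1%g); rewrite q1 mulVg.
Qed.

Lemma refines_eq col col0 i j : colmono col -> refines col col0 ->
  (i <= j < n)%N -> col i = col j -> col0 i = col0 j.
Proof.
move=> mono ref; elim: j => [|j IHj] /andP[le_ij lt_j] E; first by have -> : i = 0%N by lia.
have m1 := mono i j; have m2 := mono j j.+1.
have [-> //| neq] := eqVneq i j.+1.
rewrite IHj; [apply: ref | |]; lia.
Qed.

Lemma Spar_refines col col0 : colmono col -> refines col col0 ->
  {subset Spar col <= Spar col0}.
Proof.
move=> mono ref w /SparP Hw; apply/SparP => i lt_i.
have [le | lt] := leqP i (pnat w i).
  by apply/esym/(refines_eq mono ref); rewrite ?le ?pnat_lt ?Hw.
by apply: (refines_eq mono ref); rewrite ?(ltnW lt) ?Hw.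
Qed.

Section Algebra.
Variables (A : algType O) (T : nat -> A).
Hypothesis HT : typeA n T.

Definition xpar col : A := \sum_(w in Spar col) Tw T w.

Lemma TwM_par col p c : colmono col -> p \in Spar col -> incr col c ->
  Tw T (p * c)%g = Tw T p * Tw T c.
Proof. by move=> *; apply: (TwM HT); apply: (@ninv_par col). Qed.

Lemma TwM_parr col p c : colmono col -> p \in Spar col -> incr col c ->
  Tw T (c^-1 * p)%g = Tw T c^-1%g * Tw T p.
Proof.
by move=> mono Hp inc; apply: TwM; rewrite // ninvV addnC; apply: (@ninv_parr col).
Qed.

Lemma Spar_mulr col r w : (r.+1 < n)%N -> col r = col r.+1 ->
  ((w * sr n r)%g \in Spar col) = (w \in Spar col).
Proof.
move=> lt_r E; apply/idP/idP => H; last by rewrite SparM ?Spar_sr.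
by rewrite -(srKr w lt_r) SparM ?Spar_sr.
Qed.

Lemma Spar_mull col r w : (r.+1 < n)%N -> col r = col r.+1 ->
  ((sr n r * w)%g \in Spar col) = (w \in Spar col).
Proof.
move=> lt_r E; apply/idP/idP => H; last by rewrite SparM ?Spar_sr.
by rewrite -(srKl w lt_r) SparM ?Spar_sr.
Qed.

(** Pairing w with w s_r gives [xpar col] as a sum of T_w (1 + T_r), and (1 + T_r) T_r = t (1 +
    T_r). *)
Lemma xpar_T col r : (r.+1 < n)%N -> col r = col r.+1 ->
  xpar col * T r = t *: xpar col.
Proof.
move=> lt_r E; pose asc w := (pnat w^-1%g r < pnat w^-1%g r.+1)%N.
have ascN w : asc (w * sr n r)%g = ~~ asc w.
  rewrite /asc invMg srV // !pnat_srl // swpl swpr.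
  by have := pnat_neqS r w^-1%g; case: ltngtP.
have reidx : \sum_(w in Spar col | ~~ asc w) Tw T w =
    \sum_(w in Spar col | asc w) Tw T w * T r.
  rewrite (reindex_inj (mulIg (sr n r))) /=; apply: eq_big => w.
    by rewrite ascN negbK Spar_mulr.
  by rewrite ascN negbK => /andP[_ aw]; rewrite Tw_ascr.
have split : xpar col = \sum_(w in Spar col | asc w) Tw T w * (1 + T r).
  rewrite /xpar (bigID asc) /= reidx -big_split /=.
  by apply: eq_bigr => w _; rewrite mulrDr mulr1.
rewrite split -mulr_suml -mulrA mulrDl mul1r (T_sqr HT) // scalerBl scale1r.
by rewrite addrA [T r + _]addrC subrK scalerAr scalerDr addrC.
Qed.

Lemma xpar_Tl col r : (r.+1 < n)%N -> col r = col r.+1 ->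
  T r * xpar col = t *: xpar col.
Proof.
move=> lt_r E; pose asc w := (pnat w r < pnat w r.+1)%N.
have ascN w : asc (sr n r * w)%g = ~~ asc w.
  rewrite /asc !pnat_srl // swpl swpr.
  by have := pnat_neqS r w; case: ltngtP.
have reidx : \sum_(w in Spar col | ~~ asc w) Tw T w =
    \sum_(w in Spar col | asc w) T r * Tw T w.
  rewrite (reindex_inj (mulgI (sr n r))) /=; apply: eq_big => w.
    by rewrite ascN negbK Spar_mull.
  by rewrite ascN negbK => /andP[_ aw]; rewrite Tw_asc.
have split : xpar col = \sum_(w in Spar col | asc w) (1 + T r) * Tw T w.
  rewrite /xpar (bigID asc) /= reidx -big_split /=.
  by apply: eq_bigr => w _; rewrite mulrDl mul1r.
rewrite split -mulr_sumr mulrA mulrDr mulr1 (T_sqr HT) // scalerBl scale1r.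
by rewrite addrA [T r + _]addrC subrK scalerAl scalerDr addrC.
Qed.

(** For [col'] refining [col]: the shortest representatives of the cosets of [Spar col'] in
    [Spar col]. *)
Definition reps col' col := [set d : 'S_n | (d \in Spar col) && incr col' d].

Lemma big_par (V : nmodType) col' col (phi : 'S_n -> V) :
  colmono col' -> refines col' col ->
  \sum_(w in Spar col) phi w =
  \sum_(p in Spar col') \sum_(d in reps col' col) phi (p * d)%g.
Proof.
move=> mono ref; rewrite pair_big /=.
pose D := [set x : 'S_n * 'S_n | (x.1 \in Spar col') && (x.2 \in reps col' col)].
rewrite (eq_bigl (mem [set (x.1 * x.2)%g | x in D])) => [|w]; last first.
  apply/idP/imsetP => [Hw | [[p d]]].
    have [p [d [Hp Hd E]]] := par_decomp w mono; exists (p, d) => //.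
    rewrite !inE /= in Hp *; rewrite Hp Hd andbT /=.
    have Hp' := Spar_refines mono ref; rewrite -(mulKg p d) -E.
    by have := SparM (SparV (Hp' p _)) Hw; rewrite !inE; apply.
  rewrite inE /= => /andP[Hp]; rewrite inE => /andP[Hd _] ->.
  by rewrite SparM // (Spar_refines mono ref).
rewrite big_imset /=; last first.
  move=> [p d] [p' d']; rewrite !inE /= => /and3P[Hp _ Hd] /and3P[Hp' _ Hd'] E.
  by have [||-> -> //] := par_uniq mono _ _ Hd Hd' E; rewrite inE.
by apply: eq_bigl => -[p d]; rewrite !inE /=.
Qed.

Lemma xpar_factor col' col : colmono col' -> refines col' col ->
  xpar col = xpar col' * \sum_(d in reps col' col) Tw T d.
Proof.
move=> mono ref; rewrite /xpar (big_par _ mono ref) mulr_suml.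
apply: eq_bigr => p Hp; rewrite mulr_sumr; apply: eq_bigr => d.
by rewrite inE => /andP[_ Hd]; rewrite (TwM_par mono).
Qed.

Lemma sum_SparV (V : nmodType) col (phi : 'S_n -> V) :
  \sum_(w in Spar col) phi w = \sum_(w in Spar col) phi w^-1%g.
Proof.
rewrite (reindex_inj invg_inj) /=; apply: eq_bigl => w.
by apply/idP/idP => /SparV; rewrite ?invgK.
Qed.

Lemma xpar_factorl col' col : colmono col' -> refines col' col ->
  xpar col = (\sum_(d in reps col' col) Tw T d^-1%g) * xpar col'.
Proof.
move=> mono ref; rewrite /xpar sum_SparV (big_par _ mono ref) exchange_big mulr_suml /=.
apply: eq_bigr => d; rewrite inE => /andP[_ Hd].
rewrite sum_SparV mulr_sumr; apply: eq_bigr => p Hp.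
by rewrite invMg invgK (TwM_parr mono).
Qed.

(** Since w increases on the classes of [col] and carries them to those of [col'], w^-1 increases on
    the latter. For u in [Spar col'] the lengths add on both sides of w u = (w u w^-1) w, so the
    sums agree term by term. *)
Lemma xpar_conj col col' w : colmono col -> colmono col' -> incr col w ->
  (forall i j, (i < n)%N -> (j < n)%N ->
     (col' (pnat w i) == col' (pnat w j)) = (col i == col j)) ->
  Tw T w * xpar col' = xpar col * Tw T w.
Proof.
move=> mono mono' inc Hcol.
have incV : incr col' w^-1%g.
  apply/incrP => r lt_r E; have := pnat_neqS r w^-1%g; case: ltngtP => // lt _.
  have := @incr_lt col w (pnat w^-1%g r.+1) (pnat w^-1%g r) mono inc.
  rewrite lt pnat_lt /= => [|]; last by lia.
  rewrite !pnatKV => /(_ isT); rewrite ltnNge leqnSn => H; apply/H/eqP.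
  by rewrite -Hcol ?pnat_lt ?pnatKV ?E //; lia.
rewrite /xpar mulr_sumr mulr_suml [RHS](reindex_inj (conjg_inj w^-1%g)) /=.
apply: eq_big => [u|u Hu].
  apply/SparP/SparP => [H i lt_i | H i lt_i].
    rewrite /conjg invgK !pnatM; apply/eqP; rewrite -Hcol ?pnat_lt //.
    by rewrite pnatKV H ?pnat_lt.
  have := H _ (pnat_lt w^-1%g lt_i); rewrite /conjg invgK !pnatM pnatKV => /eqP.
  by rewrite -Hcol ?pnat_lt // !pnatKV => /eqP.
have := TwM_parr mono' Hu incV; rewrite invgK => <-.
rewrite -(TwM_par mono) // /conjg ?invgK; first by rewrite -!mulgA mulVg mulg1.
apply/SparP => i lt_i; rewrite !pnatM; apply/eqP; rewrite -Hcol ?pnat_lt //.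
by rewrite pnatKV; move/SparP: Hu => ->; rewrite ?pnat_lt.
Qed.
End Algebra.
End Parabolic.

(** * Partial sums of row lengths *)

Lemma psum_cons x (s : seq nat) r :
  (\sum_(j < r.+1) nth 0 (x :: s) j = x + \sum_(j < r) nth 0 s j)%N.
Proof. by rewrite big_ord_recl. Qed.

Lemma psum_size (s : seq nat) r : (size s <= r)%N -> (\sum_(j < r) nth 0 s j = sumn s)%N.
Proof.
elim: s r => [|x s IHs] r /=; first by move=> _; rewrite big1 // => i _; rewrite nth_nil.
by case: r => // r le; rewrite psum_cons IHs.
Qed.

Lemma psum_le_sumn (s : seq nat) r : (\sum_(j < r) nth 0 s j <= sumn s)%N.
Proof.
elim: s r => [|x s IHs] [|r]; rewrite ?big_ord0 ?psum_cons //= ?leq_add2l //.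
  by rewrite big1 // => i; rewrite nth_nil.
exact: IHs.
Qed.

Lemma psumS (s : seq nat) r :
  (\sum_(j < r.+1) nth 0 s j = \sum_(j < r) nth 0 s j + nth 0 s r)%N.
Proof. by rewrite big_ord_recr. Qed.

Lemma psum_mono (s : seq nat) r r' : (r <= r')%N ->
  (\sum_(j < r) nth 0 s j <= \sum_(j < r') nth 0 s j)%N.
Proof.
elim: r' => [|r' IH] le; first by have -> : r = 0%N by lia.
have [->//|neq] := eqVneq r r'.+1.
by rewrite psumS; have := IH ltac:(lia); lia.
Qed.

Lemma psum_find (s : seq nat) i : (i < sumn s)%N ->
  exists r c, (c < nth 0 s r)%N /\ (\sum_(j < r) nth 0 s j + c)%N = i.
Proof.
elim: s i => [|x s IHs] i //= lt_i; have [lt | le] := ltnP i x.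
  by exists 0%N, i; rewrite big_ord0.
have [|r [c [lt_c E]]] := IHs (i - x)%N; first by lia.
by exists r.+1, c; split=> //; rewrite psum_cons; lia.
Qed.

(** * Multipartitions and their rows *)

Section Shape.
Variables (ell n : nat) (lam : mpart ell).
Implicit Types (l k : 'I_ell) (r c i j : nat) (w : 'S_n).

Definition pre l : nat := (\sum_(k < ell | (k < l)%N) sumn (lam k))%N.

Lemma tlamE l r c : tlam lam l r c = (pre l + \sum_(j < r) nth 0 (lam l) j + c)%N.
Proof. by []. Qed.

Lemma preS l k : (l < k)%N -> (pre l + sumn (lam l) <= pre k)%N.
Proof.
move=> lt; rewrite /pre [X in (_ <= X)%N](bigD1 l) //= addnC leq_add2l.
rewrite [X in (_ <= X)%N](bigID (fun j : 'I_ell => (j < l)%N)) /=.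
rewrite [X in (X <= _)%N](eq_bigl (fun i : 'I_ell => ((i < k)%N && (i != l)) && (i < l)%N)).
  exact: leq_addr.
by move=> i; rewrite -val_eqE /=; case: ltngtP => //; lia.
Qed.

Lemma sum_mp_pre l : (pre l + sumn (lam l) <= \sum_(k < ell) sumn (lam k))%N.
Proof.
rewrite /pre [X in (_ <= X)%N](bigD1 l) //= addnC leq_add2l.
rewrite [X in (_ <= X)%N](bigID (fun j : 'I_ell => (j < l)%N)) /=.
rewrite [X in (X <= _)%N](eq_bigl (fun i : 'I_ell => (i != l) && (i < l)%N)).
  exact: leq_addr.
by move=> i; rewrite -val_eqE /=; case: ltngtP.
Qed.

Lemma pre_find i : (i < \sum_(k < ell) sumn (lam k))%N ->
  exists l : 'I_ell, (pre l <= i < pre l + sumn (lam l))%N.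
Proof.
move=> lt_i; have ell0 : (0 < ell)%N.
  by case: (ell) lam lt_i => // lam0; rewrite big_ord0.
pose P m := (m < ell)%N && (\sum_(k < ell | (k < m)%N) sumn (lam k) <= i)%N.
have P0 : exists m, P m by exists 0%N; rewrite /P ell0 big1.
have Pub m : P m -> (m <= ell)%N by case/andP => /ltnW.
case: (ex_maxnP P0 Pub) => m /andP[lt_m le_i] max_m.
exists (Ordinal lt_m); rewrite /pre /= le_i /=.
have sumS : (\sum_(k < ell | (k < m.+1)%N) sumn (lam k) =
   \sum_(k < ell | (k < m)%N) sumn (lam k) + sumn (lam (Ordinal lt_m)))%N.
  rewrite (bigD1 (Ordinal lt_m)) //= addnC; congr addn; apply: eq_bigl => k.
  by rewrite -val_eqE /=; case: ltngtP; lia.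
rewrite -sumS; have [lt_m1 | ge_m1] := ltnP m.+1 ell.
  by rewrite ltnNge; apply/negP => le; have := max_m m.+1; rewrite /P lt_m1 le; lia.
rewrite (eq_bigl xpredT) // => k; have := ltn_ord k; lia.
Qed.

Lemma inmp_sumn l r c : inmp lam l r c -> (\sum_(j < r) nth 0 (lam l) j + c < sumn (lam l))%N.
Proof. by rewrite /inmp => lt; have := psum_le_sumn (lam l) r.+1; rewrite psumS; lia. Qed.

Lemma tlam_wlex l r l' r' : (l < l')%N || ((l == l') && (r <= r')%N) ->
  (tlam lam l r 0 <= tlam lam l' r' 0)%N.
Proof.
move=> /orP[lt|/andP[/eqP-> lt]]; rewrite !tlamE.
  by have := preS lt; have := psum_le_sumn (lam l) r; lia.
by have := psum_mono (lam l') lt; lia.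
Qed.

Lemma tlam_row l r c c' : (tlam lam l r c < tlam lam l r c')%N = (c < c')%N.
Proof. by rewrite !tlamE ltn_add2l. Qed.

Lemma tlam_lt_row l r c l' r' c' : inmp lam l r c ->
  (l < l')%N || ((l == l') && (r < r')%N) -> (tlam lam l r c < tlam lam l' r' c')%N.
Proof.
move=> Hin /orP[lt|/andP[/eqP El lt]]; rewrite !tlamE.
  by have := preS lt; have := inmp_sumn Hin; lia.
by subst l'; have := psum_mono (lam l) lt; move: Hin; rewrite psumS /inmp; lia.
Qed.

Lemma rowstart_le l r c k q : inmp lam l r c ->
  (tlam lam k q 0 <= tlam lam l r c)%N = ((k < l)%N || ((k == l) && (q <= r)%N)).
Proof.
move=> Hin; have [H | /negP H] := boolP ((k < l)%N || ((k == l) && (q <= r)%N)).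
  by rewrite (leq_trans (tlam_wlex H)) // !tlamE; lia.
rewrite leqNgt; apply/negbF/(tlam_lt_row _ Hin).
by move: H; rewrite -!val_eqE /=; case: ltngtP => //= _; case: ltngtP.
Qed.

Lemma tlam_inj l r c l' r' c' : inmp lam l r c -> inmp lam l' r' c' ->
  tlam lam l r c = tlam lam l' r' c' -> [/\ l = l', r = r' & c = c'].
Proof.
move=> Hin Hin' E.
have H1 := @tlam_lt_row l r c l' r' c' Hin; have H2 := @tlam_lt_row l' r' c' l r c Hin'.
have El : l = l'.
  apply/val_inj; case: (ltngtP l l') => // lt; [move: H1 | move: H2];
  by rewrite lt E ltnn => /(_ isT).
have Er : r = r'.
  subst l'; case: (ltngtP r r') => // lt; [move: H1 | move: H2];
  by rewrite lt eqxx orbT E ltnn => /(_ isT).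
by subst l' r'; split=> //; move: E; rewrite !tlamE => /addnI.
Qed.

Hypothesis Hlam : is_mpart n lam.

Lemma sum_mp : (\sum_(k < ell) sumn (lam k))%N = n.
Proof. by case/andP: Hlam => _ /eqP. Qed.

Lemma mp_part l : is_partition (lam l).
Proof. by case/andP: Hlam => /forallP. Qed.

Lemma mp_anti l r r' : (r <= r')%N -> (nth 0 (lam l) r' <= nth 0 (lam l) r)%N.
Proof.
move=> le; have [lt|ge] := ltnP r' (size (lam l)); last by rewrite nth_default.
case/andP: (mp_part l) => srt _.
have tr : transitive geq by move=> a b c; rewrite /geq /=; lia.
have rf : reflexive geq by move=> a; rewrite /geq /=.
by have := sorted_leq_nth tr rf 0 srt; apply; rewrite ?inE //; lia.
Qed.

Lemma inmp_left l r c c' : (c' <= c)%N -> inmp lam l r c -> inmp lam l r c'.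
Proof. by rewrite /inmp; lia. Qed.

Lemma inmp_up l r r' c : (r' <= r)%N -> inmp lam l r c -> inmp lam l r' c.
Proof. by move=> /(mp_anti l); rewrite /inmp; lia. Qed.

(** Each of the r rows above contributes at least one node. This bound on r + c is what the gap in
    [kappa] is measured against. *)
Lemma inmp_hook l r c : inmp lam l r c -> (r + c < sumn (lam l))%N.
Proof.
move=> Hin; have := inmp_sumn Hin; suff : (r <= \sum_(j < r) nth 0 (lam l) j)%N by lia.
have Hr r' : (r' < r)%N -> (0 < nth 0 (lam l) r')%N.
  by move=> /ltnW lt; have := inmp_up lt Hin; rewrite /inmp; lia.
elim: r Hr {Hin} => // r IHr Hr; rewrite psumS; have := Hr r (leqnn _).
by have := IHr (fun r' lt => Hr r' (ltnW lt)); lia.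
Qed.

Lemma sumn_le_n l : (sumn (lam l) <= n)%N.
Proof. by have := sum_mp_pre l; rewrite sum_mp; lia. Qed.

Lemma sumn2_le_n l l' : l != l' -> (sumn (lam l) + sumn (lam l') <= n)%N.
Proof.
wlog lt : l l' / (l < l')%N.
  move=> IH neq; case: (ltngtP l l') => [lt|lt|/val_inj E]; first exact: IH lt neq.
    by rewrite addnC; apply: (IH _ _ lt); rewrite eq_sym.
  by rewrite E eqxx in neq.
by have := preS lt; have := sum_mp_pre l'; rewrite sum_mp; lia.
Qed.

Lemma inmp_row_lt l r c : inmp lam l r c -> (r < n)%N.
Proof. by move=> Hin; have := inmp_hook Hin; have := sumn_le_n l; lia. Qed.

Lemma inmp_col_lt l r c : inmp lam l r c -> (c < n)%N.
Proof. by move=> Hin; have := inmp_hook Hin; have := sumn_le_n l; lia. Qed.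

Lemma tlam_lt_n l r c : inmp lam l r c -> (tlam lam l r c < n)%N.
Proof. by move=> Hin; have := inmp_sumn Hin; have := sum_mp_pre l; rewrite sum_mp tlamE; lia. Qed.

Lemma node_ex i : (i < n)%N -> exists l r c, inmp lam l r c /\ tlam lam l r c = i.
Proof.
rewrite -{1}sum_mp => /pre_find[l /andP[le lt]].
have [|r [c [lt_c E]]] := @psum_find (lam l) (i - pre l); first by lia.
by exists l, r, c; split=> //; rewrite tlamE; lia.
Qed.

(* a colouring which is constant exactly on the rows of t^lam: the rows starting at or before i
   are counted (empty rows beyond the diagram, too, which is harmless) *)
Definition rowcol i : nat := #|[pred x : 'I_ell * 'I_n.+1 | (tlam lam x.1 x.2 0 <= i)%N]|.

Lemma rowcol_mono i j : (i <= j)%N -> (rowcol i <= rowcol j)%N.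
Proof. by move=> le; apply/subset_leq_card/subsetP => x; rewrite !inE; lia. Qed.

Lemma rowcolE l r c : inmp lam l r c -> rowcol (tlam lam l r c) =
  #|[pred x : 'I_ell * 'I_n.+1 | (x.1 < l)%N || ((x.1 == l) && (x.2 <= r)%N)]|.
Proof. by move=> Hin; apply: eq_card => x; rewrite !inE rowstart_le. Qed.

Lemma rowcol_lt l r c l' r' c' : inmp lam l r c -> inmp lam l' r' c' ->
  (l < l')%N || ((l == l') && (r < r')%N) ->
  (rowcol (tlam lam l r c) < rowcol (tlam lam l' r' c'))%N.
Proof.
move=> Hin Hin' lt; rewrite !rowcolE //; apply/proper_card/properP; split.
  apply/subsetP => -[k q]; rewrite !inE /=; move: lt; rewrite -!val_eqE /=; lia.
have lt_r' : (r' < n.+1)%N by have := inmp_row_lt Hin'; lia.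
exists (l', Ordinal lt_r'); rewrite !inE /= ?eqxx ?leqnn ?orbT //.
by move: lt; rewrite -!val_eqE /=; lia.
Qed.

Lemma rowcol_eq l r c l' r' c' : inmp lam l r c -> inmp lam l' r' c' ->
  (rowcol (tlam lam l r c) == rowcol (tlam lam l' r' c')) = (l == l') && (r == r').
Proof.
move=> Hin Hin'; apply/idP/idP => [/eqP E | /andP[/eqP El /eqP Er]]; last first.
  by subst l' r'; rewrite !rowcolE.
have := @rowcol_lt l r c l' r' c' Hin Hin'; have := @rowcol_lt l' r' c' l r c Hin' Hin.
rewrite E ltnn -!val_eqE /=; case: (ltngtP l l') => //= _; try by move=> _ /(_ isT).
  by move=> /(_ isT).
by case: (ltngtP r r') => //= _ // => [_ | ] /(_ isT).
Qed.

Lemma colmono_rowcol : colmono n rowcol.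
Proof. by move=> i j /andP[le _]; apply: rowcol_mono. Qed.

Lemma rowstabE : rowstab n lam = Spar n rowcol.
Proof.
apply/setP => w; rewrite [LHS]inE; apply/forallP/SparP => [H i lt_i | H [[l r] c]].
  have [l [r [c [Hin Ei]]]] := node_ex lt_i; subst i.
  have lr := inmp_row_lt Hin; have lc := inmp_col_lt Hin.
  have := H (l, inord r, inord c); rewrite !inordK; try lia.
  rewrite Hin /= => /existsP[c' /andP[Hin' /eqP <-]].
  by apply/eqP; rewrite rowcol_eq // !eqxx.
apply/implyP => Hin; have lt := tlam_lt_n Hin.
have [l' [r' [c' [Hin' E]]]] := node_ex (pnat_lt w lt).
have := H _ lt => /eqP; rewrite -E rowcol_eq // => /andP[/eqP El /eqP Er]; subst l' r'.
apply/existsP; exists (inord c'); rewrite inordK; last by have := inmp_col_lt Hin'; lia.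
by rewrite Hin' E eqxx.
Qed.

Lemma StdP w : reflect (forall l r c, inmp lam l r c ->
    (inmp lam l r c.+1 -> (pnat w (tlam lam l r c) < pnat w (tlam lam l r c.+1))%N) /\
    (inmp lam l r.+1 c -> (pnat w (tlam lam l r c) < pnat w (tlam lam l r.+1 c))%N))
  (w \in Std n lam).
Proof.
rewrite inE /is_std; apply: (iffP forallP) => [H l r c Hin | H [[l r] c]].
  have lr := inmp_row_lt Hin; have lc := inmp_col_lt Hin.
  have := H (l, inord r, inord c); rewrite !inordK; try lia.
  by rewrite Hin /= => /andP[/implyP H1 /implyP H2]; split.
apply/implyP => Hin; have [H1 H2] := H _ _ _ Hin.
by apply/andP; split; apply/implyP.
Qed.

Lemma Std_incr w : w \in Std n lam -> incr rowcol w.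
Proof.
move=> /StdP H; apply/incrP => i lt_i.
have [l [r [c [Hin Ei]]]] := node_ex (ltnW lt_i).
have [l' [r' [c' [Hin' Ei']]]] := node_ex lt_i.
rewrite -Ei' -Ei => /eqP; rewrite rowcol_eq // => /andP[/eqP El /eqP Er]; subst l' r'.
have Ec : c' = c.+1 by move: Ei'; rewrite -Ei !tlamE; lia.
by subst c'; case: (H _ _ _ Hin) => /(_ Hin').
Qed.

(** When the rows increase only a column can fail; the failing pair of nodes is where the Garnir
    strip is placed. *)
Lemma incr_nStd w : incr rowcol w -> w \notin Std n lam ->
  exists l r c, [/\ inmp lam l r.+1 c &
    (pnat w (tlam lam l r.+1 c) < pnat w (tlam lam l r c))%N].
Proof.
move=> inc nstd; apply: contrapT => none; case/negP: nstd; apply/StdP => l r c Hin; split.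
  move=> Hin'; apply: (incr_lt colmono_rowcol inc).
    by rewrite tlam_row leqnn tlam_lt_n.
  by apply/eqP; rewrite rowcol_eq // !eqxx.
move=> Hin'; rewrite ltnNge leq_eqVlt negb_or; apply/andP; split; last first.
  by apply/negP => lt; apply: none; exists l, r, c.
by apply/negP => /eqP/pnat_inj/tlam_inj => /(_ Hin' Hin)[_]; lia.
Qed.

Lemma Std1 : 1%g \in Std n lam.
Proof.
apply/StdP => l r c Hin; rewrite !pnat1; split=> _; first by rewrite tlam_row.
by apply: tlam_lt_row; rewrite // eqxx ltnSn orbT.
Qed.
End Shape.

(** * Linear spans over the Laurent polynomials *)

Inductive lspan (V : lmodType O) (P : V -> Prop) : V -> Prop :=
  | lspan0 : lspan P 0
  | lspanS c g x : P g -> lspan P x -> lspan P (c *: g + x).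

Section LinearSpan.
Variables (V : lmodType O).
Implicit Types (P : V -> Prop).

Lemma lspan_gen P g : P g -> lspan P g.
Proof. by move=> Pg; rewrite -[g]addr0 -[g]scale1r; apply/lspanS/lspan0. Qed.

Lemma lspanD P x y : lspan P x -> lspan P y -> lspan P (x + y).
Proof.
by move=> Px Py; elim: Px => [|c g z Pg _ IH]; rewrite ?add0r // -addrA; apply: lspanS.
Qed.

End LinearSpan.

Lemma lspan_map (V W : lmodType O) (P : V -> Prop) (Q : W -> Prop) (f : V -> W) (x : V) : f 0 = 0 ->
  (forall c g y, f (c *: g + y) = c *: f g + f y) ->
  (forall g, P g -> lspan Q (f g)) -> lspan P x -> lspan Q (f x).
Proof.
move=> f0 flin H; elim=> [|c g y Pg _ IH]; first by rewrite f0; apply: lspan0.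
rewrite flin; apply: lspanD IH; elim: (H g Pg) => [|d h z Qh _ IH].
  by rewrite scaler0; apply: lspan0.
by rewrite scalerDr scalerA; apply: lspanS.
Qed.

Section LinearSpan2.
Variables (V : lmodType O).
Implicit Types (P Q : V -> Prop).

Lemma lspan_sub P Q x : (forall g, P g -> lspan Q g) -> lspan P x -> lspan Q x.
Proof. by move=> H; apply: (lspan_map (f := id)). Qed.

Lemma lspanZ P c x : lspan P x -> lspan P (c *: x).
Proof.
apply: (lspan_map (f := fun x => c *: x)) => [|d g y|g Pg].
- exact: scaler0.
- by rewrite scalerDr !scalerA mulrC.
- by rewrite -[_ *: _]addr0; apply/lspanS/lspan0.
Qed.

Lemma lspanN P x : lspan P x -> lspan P (- x).
Proof. by rewrite -scaleN1r; apply: lspanZ. Qed.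

Lemma lspanB P x y : lspan P x -> lspan P y -> lspan P (x - y).
Proof. by move=> Px Py; apply/lspanD/lspanN. Qed.

Lemma lspan_sum P (I : finType) (D : {pred I}) (f : I -> V) :
  (forall i, i \in D -> lspan P (f i)) -> lspan P (\sum_(i in D) f i).
Proof. by move=> H; elim/big_rec: _ => [|i x Di Px]; [apply: lspan0 | apply/lspanD/Px/H]. Qed.
End LinearSpan2.

Section LinearSpanAlg.
Variables (A : algType O).
Implicit Types (P Q : A -> Prop).

Lemma lspan_mull P Q a x : (forall g, P g -> lspan Q (a * g)) -> lspan P x -> lspan Q (a * x).
Proof.
apply: (lspan_map (f := fun x => a * x)) => [|d g y]; first exact: mulr0.
by rewrite mulrDr scalerAr.
Qed.

Lemma lspan_mulr P Q a x : (forall g, P g -> lspan Q (g * a)) -> lspan P x -> lspan Q (x * a).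
Proof.
apply: (lspan_map (f := fun x => x * a)) => [|d g y]; first exact: mul0r.
by rewrite mulrDl scalerAl.
Qed.
End LinearSpanAlg.

(** * The Laurent polynomials inside their field of fractions *)

Lemma tF_laurent : tF \in laurent_pred.
Proof. by apply/asboolP; exists 0%N, 'X; rewrite expr0 mulr1. Qed.

Lemma tF_neq0 : tF != 0.
Proof. by rewrite /tF tofrac_eq0 polyX_eq0. Qed.

Lemma tFV_laurent : tF^-1 \in laurent_pred.
Proof. by apply/asboolP; exists 1%N, 1; rewrite expr1 mulVf ?tF_neq0 // tofrac1. Qed.

Lemma Oval_t : Oval t = tF.
Proof. exact: (insubdK 0 tF_laurent). Qed.

Lemma Oval_tinv : Oval tinv = tF^-1.
Proof. exact: (insubdK 0 tFV_laurent). Qed.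

Lemma Oval_inj : injective Oval.
Proof. exact: val_inj. Qed.

Lemma OvalM : {morph Oval : x y / x * y}.
Proof. exact: (rmorphM (val : O -> F)). Qed.

Lemma OvalD : {morph Oval : x y / x + y}.
Proof. exact: (rmorphD (val : O -> F)). Qed.

Lemma Oval1 : Oval 1 = 1.
Proof. exact: (rmorph1 (val : O -> F)). Qed.

Lemma Oval0 : Oval 0 = 0.
Proof. exact: (rmorph0 (val : O -> F)). Qed.

Lemma t_tinv : t * tinv = 1.
Proof. by apply: Oval_inj; rewrite OvalM Oval_t Oval_tinv Oval1 mulfV ?tF_neq0. Qed.

(** * The Garnir relations *)

Section Measure.
Variable n : nat.
Implicit Types (col : nat -> nat) (y z : 'S_n) (i j : nat).

Definition cls col i := #|[pred j : 'I_n | col j == col i]|.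
(* the termination measure of the straightening: a Garnir strip is longer than both of the
   rows it is cut from *)
Definition msr col := (\sum_(i < n) 2 ^ cls col i)%N.

Lemma msr_max col : (msr col <= n * 2 ^ n)%N.
Proof.
rewrite -[X in (_ <= X * _)%N](card_ord n) -sum_nat_const; apply: leq_sum => i _.
by rewrite leq_exp2l // (leq_trans (max_card _)) ?card_ord.
Qed.

Lemma card_interval (x y : nat) : (y <= n)%N -> #|[pred j : 'I_n | (x <= j < y)%N]| = (y - x)%N.
Proof.
elim: y => [|y IHy] le; first by apply: eq_card0 => j; rewrite !inE; lia.
have [le_xy | lt] := leqP x y; last first.
  rewrite eq_card0 => [|j]; last by rewrite !inE; lia.
  by apply/esym/eqP; rewrite subn_eq0.
rewrite (cardD1 (Ordinal le)) !inE /= le_xy ltnSn /= subSn // -IHy; last by lia.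
by rewrite add1n; congr _.+1; apply: eq_card => j; rewrite !inE -val_eqE /=; lia.
Qed.

(** Strictness comes from a descent r of y^-1 z: the positions that y sends to r and r+1 are
    inverted by z, and not by y. *)
Lemma ninv_sub y z :
  (forall i j, (i < j < n)%N -> (pnat y j < pnat y i)%N -> (pnat z j < pnat z i)%N) ->
  y != z -> (ninv y < ninv z)%N.
Proof.
move=> sub neq; apply/proper_card/properP; split.
  apply/subsetP => -[i j]; rewrite !inE /= => /andP[lt inv]; rewrite lt.
  by have := sub i j; rewrite !pnat_ord; apply; rewrite ?lt ?ltn_ord.
have /ex_descent[r [lt_r]] : (y^-1 * z)%g != 1%g.
  by apply: contra neq => /eqP E; rewrite -[z](mulKVg y) E mulg1.
rewrite !pnatM; set i := pnat y^-1%g r; set j := pnat y^-1%g r.+1 => desc.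
have yi : pnat y i = r by rewrite pnatKV.
have yj : pnat y j = r.+1 by rewrite pnatKV.
have li : (i < n)%N by apply/pnat_lt/ltnW.
have lj : (j < n)%N by apply/pnat_lt.
have lt_ij : (i < j)%N.
  case: (ltngtP i j) => // [lt | E]; last by move: desc; rewrite E ltnn.
  by have := sub j i; rewrite yi yj lt li ltnSn => /(_ isT isT); lia.
exists (Ordinal li, Ordinal lj); rewrite !inE /= lt_ij -!pnat_ord //=.
by rewrite yi yj; lia.
Qed.
End Measure.

Section Garnir.
Variables (ell n : nat) (blk : nat -> nat).
Hypothesis blk_mono : colmono n blk.
Implicit Types (lam : mpart ell) (w : 'S_n) (col : nat -> nat).

Definition compat lam := forall (l : 'I_ell) r c, inmp lam l r c -> blk (tlam lam l r c) = l.

Lemma compat_refines lam : is_mpart n lam -> compat lam -> refines n (rowcol n lam) blk.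
Proof.
move=> Hlam Hc i lt_i.
have [l [r [c [Hin E]]]] := node_ex Hlam (ltnW lt_i).
have [l' [r' [c' [Hin' E']]]] := node_ex Hlam lt_i.
rewrite -E' -E => /eqP; rewrite rowcol_eq // => /andP[/eqP El _].
by rewrite !Hc // El.
Qed.

Lemma rowcol_row lam l r c i : is_mpart n lam -> inmp lam l r c -> (i < n)%N ->
  (rowcol n lam i == rowcol n lam (tlam lam l r c)) =
  (tlam lam l r 0 <= i < tlam lam l r 0 + nth 0%N (lam l) r)%N.
Proof.
move=> Hlam Hin lt_i; have [l' [r' [c' [Hin' Ei]]]] := node_ex Hlam lt_i.
rewrite -Ei rowcol_eq //; apply/idP/idP => [/andP[/eqP El /eqP Er]|].
  by subst l' r'; move: Hin'; rewrite /inmp !tlamE; lia.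
rewrite Ei => lt; have Hin2 : inmp lam l r (i - tlam lam l r 0) by rewrite /inmp; lia.
have [|-> -> _] := tlam_inj Hin' Hin2; last by rewrite !eqxx.
by rewrite Ei !tlamE; move: lt; rewrite !tlamE; lia.
Qed.

(* At a descent between the nodes (l,r,c) and (l,r+1,c), mu arises from the rows by making
   one class of the Garnir strip: row r from column c on and row r+1 up to column c.
   nu is the common refinement of mu and of the rows, and the z occurring in w
   is the longest representative of nu in mu. *)
Lemma garnir lam w : is_mpart n lam -> compat lam -> w \in Spar n blk ->
  incr (rowcol n lam) w -> w \notin Std n lam ->
  exists nu mu z d,
  [/\ colmono n nu, colmono n mu, refines n nu mu, refines n nu (rowcol n lam) &
      refines n mu blk] /\
  [/\ (d \in Spar n blk), z \in reps n nu mu, incr mu d, w = (z * d)%g &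
      forall y, y \in reps n nu mu -> y != z -> (ninv y < ninv z)%N] /\
  (msr n (rowcol n lam) < msr n mu)%N.
Proof.
move=> Hlam Hcmp Hw inc nstd; have [l [r [c [Hin lt_w]]]] := incr_nStd Hlam inc nstd.
have Hup : inmp lam l r c by apply: (inmp_up Hlam (leqnSn r)).
set rc := rowcol n lam in inc *; set R0 := tlam lam l r 0.
set p := nth 0%N (lam l) r; set q := nth 0%N (lam l) r.+1.
have le_qp : (q <= p)%N by apply: (mp_anti Hlam).
have lt_cq : (c < q)%N by [].
set p0 := tlam lam l r c in lt_w; set p1 := tlam lam l r.+1 c in lt_w.
have E0 : p0 = (R0 + c)%N by rewrite /p0 /R0 !tlamE; lia.
have E1 : p1 = (R0 + p + c)%N by rewrite /p1 /R0 !tlamE psumS /p; lia.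
have Eq0 : tlam lam l r.+1 0 = (R0 + p)%N by rewrite /R0 !tlamE psumS /p; lia.
have SN : (R0 + p + q <= n)%N.
  have : inmp lam l r.+1 q.-1 by rewrite /inmp -/q; lia.
  by move=> /(tlam_lt_n Hlam); rewrite !tlamE psumS; rewrite /R0 !tlamE /p; lia.
set a := rc p0; set b := rc p1.
have lt_ab : (a < b)%N by apply: rowcol_lt; rewrite // eqxx ltnSn orbT.
have rowA i : (i < n)%N -> (rc i == a) = (R0 <= i < R0 + p)%N by apply: rowcol_row.
have rowB i : (i < n)%N -> (rc i == b) = (R0 + p <= i < R0 + p + q)%N.
  by rewrite -Eq0; apply: rowcol_row.
have mono_rc := @rowcol_mono _ n lam Hlam; rewrite -/rc in mono_rc.
have blk_row i : (R0 <= i < R0 + p + q)%N -> blk i = l.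
  move=> lt_i; have [lt | ge] := ltnP i (R0 + p).
    rewrite -(Hcmp l r (i - R0)%N); last by rewrite /inmp -/p; lia.
    by rewrite tlamE; congr blk; move: lt_i; rewrite /R0 !tlamE; lia.
  rewrite -(Hcmp l r.+1 (i - R0 - p)%N); last by rewrite /inmp -/q; lia.
  by rewrite tlamE; congr blk; rewrite psumS -/p; move: lt_i ge; rewrite /R0 !tlamE; lia.
have ref_rb : refines n rc blk by apply: compat_refines.
have mono_c : colmono n rc by apply: colmono_rowcol.
have rc_le i : (i <= p0)%N -> (rc i <= a)%N by apply: mono_rc.
have rc_ge i : (p1 <= i)%N -> (b <= rc i)%N by apply: mono_rc.
have Ea : rc p0 = a by [].
have Eb : rc p1 = b by [].
clearbody rc R0 p q p0 p1 a b.
(* The factor 3 makes room for two new colours between those of the rows: row r left of column c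
   keeps 3a, row r+1 right of column c keeps 3b, and the strip from [p0] to [p1] gets 3a+1, split by
   [nu] into 3a+1 and 3a+2. *)
pose mu i := if (p0 <= i <= p1)%N then (3 * a + 1)%N else (3 * rc i)%N.
pose nu i := if (p0 <= i < R0 + p)%N then (3 * a + 1)%N else
             if (R0 + p <= i <= p1)%N then (3 * a + 2)%N else (3 * rc i)%N.
have mono_mu : colmono n mu.
  move=> i j /andP[le lt_j]; move: (mono_rc i j le) (rc_le i) (rc_ge j) lt_ab (le).
  by rewrite /mu; clear; repeat (case: ifP => ?); lia.
have mono_nu : colmono n nu.
  move=> i j /andP[le lt_j]; move: (mono_rc i j le) (rc_le i) (rc_ge j) lt_ab (le) E0 E1 lt_cq le_qp.
  by rewrite /nu; clear; repeat (case: ifP => ?); lia.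
have ref_nm : refines n nu mu.
  move=> i _; rewrite /nu /mu; move: E0 E1 lt_cq le_qp; clear.
  by repeat (case: ifP => ?); lia.
have ref_nr : refines n nu rc.
  move=> i lt_i; have := rowA i (ltnW lt_i); have := rowA i.+1 lt_i.
  have := rowB i (ltnW lt_i); have := rowB i.+1 lt_i.
  by rewrite /nu; move: E0 E1 lt_cq le_qp; clear; repeat (case: ifP => ?); lia.
have ref_mb : refines n mu blk.
  move=> i lt_i; move: (ref_rb i lt_i) (blk_row i) (blk_row i.+1) E0 E1 lt_cq le_qp.
  by rewrite /mu; clear; repeat (case: ifP => ?); lia.
have munu i j : (i < j)%N -> mu i = mu j -> nu i <> nu j ->
    (p0 <= i < R0 + p)%N /\ (R0 + p <= j <= p1)%N.
  rewrite /mu /nu; move: E0 E1 lt_cq le_qp; clear => ? ? ? ? ?.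
  by repeat (case: ifP => ?); lia.
(* The two rows, of lengths p >= q, contribute at most (p+q) 2^p, whereas the strip alone has p+1
   positions and contributes at least (p+1) 2^(p+1). *)
have lt_msr : (msr n rc < msr n mu)%N.
  pose S := [pred i : 'I_n | (R0 <= i < R0 + p + q)%N].
  pose P := [pred i : 'I_n | (p0 <= i < p1.+1)%N].
  rewrite /msr (bigID S) [X in (_ < X)%N](bigID S) /=.
  have -> : (\sum_(i < n | ~~ S i) 2 ^ cls n rc i = \sum_(i < n | ~~ S i) 2 ^ cls n mu i)%N.
    apply: eq_bigr => i /= nS; congr (2 ^ _)%N; apply: eq_card => j; rewrite !inE.
    have iP : (p0 <= i <= p1)%N = false.
      by move: nS E0 E1 lt_cq le_qp; rewrite /S /=; clear; lia.
    rewrite /mu iP; case: ifP => Pj; last by rewrite eqn_pmul2l.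
    have [na nb] : rc i != a /\ rc i != b.
      by move: nS; rewrite rowA // rowB // /S /=; clear; lia.
    have : (rc j == a) || (rc j == b).
      by move: Pj E0 E1 lt_cq le_qp; rewrite rowA // rowB //; clear; lia.
    by move: na nb; clear; lia.
  rewrite ltn_add2r.
  have le1 : (\sum_(i < n | S i) 2 ^ cls n rc i <= (p + q) * 2 ^ p)%N.
    have -> : (p + q = #|S|)%N by rewrite card_interval //; lia.
    rewrite -sum_nat_const; apply: leq_sum => i /= Si; rewrite leq_exp2l //.
    have rA := rowA i (ltn_ord i); have rB := rowB i (ltn_ord i).
    have [lt | ge] := ltnP i (R0 + p).
      rewrite /cls (eq_card (B := [pred j : 'I_n | (R0 <= j < R0 + p)%N])) => [|j].
        by rewrite card_interval; lia.
      by rewrite !inE -rowA //; move: rA; lia.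
    rewrite /cls (eq_card (B := [pred j : 'I_n | (R0 + p <= j < R0 + p + q)%N])) => [|j].
      by rewrite card_interval; lia.
    by rewrite !inE -rowB //; move: rB; lia.
  apply: leq_ltn_trans le1 _.
  have le2 : ((p.+1) * 2 ^ p.+1 <= \sum_(i < n | S i) 2 ^ cls n mu i)%N.
    rewrite [X in (_ <= X)%N](bigID P) /=; apply: leq_trans (leq_addr _ _).
    rewrite (eq_bigl P) => [|i]; last by rewrite /= ; lia.
    have -> : (p.+1 = #|P|)%N by rewrite card_interval //; lia.
    rewrite -sum_nat_const; apply: leq_sum => i /= Pi; rewrite leq_exp2l //.
    apply/subset_leq_card/subsetP => j; rewrite !inE => Pj.
    by move: Pi Pj; rewrite /mu inE /=; clear; repeat (case: ifP => ?); lia.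
  apply: leq_trans le2; rewrite expnS mulnCA mulnA.
  have : (0 < 2 ^ p)%N by rewrite expn_gt0.
  by move: (2 ^ p)%N => N; nia.
clearbody mu nu.
have [z [d [Hz Hd Ew]]] := par_decomp w mono_mu.
have Hzb : z \in Spar n blk by apply: Spar_refines mono_mu ref_mb _ Hz.
have zlt i j : (i < n)%N -> (j < n)%N -> mu i = mu j -> (pnat w i < pnat w j)%N ->
    (pnat z i < pnat z j)%N.
  move=> li lj Em lt; case: (ltngtP (pnat z i) (pnat z j)) => // [lt' | /pnat_inj E].
    have := @incr_lt n mu d (pnat z j) (pnat z i) mono_mu Hd.
    rewrite lt' pnat_lt //; move/SparP: Hz => Hz; rewrite !Hz //.
    by move=> /(_ isT (esym Em)); rewrite -!pnatM -Ew ltnNge (ltnW lt).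
  by move: lt; rewrite E ltnn.
exists nu, mu, z, d; split=> //; split=> //.
  split=> //.
  - by rewrite -[d](mulKg z) -Ew SparM ?SparV.
  - rewrite inE Hz; apply/incrP => i lt_i En.
    apply: (zlt _ _ (ltnW lt_i) lt_i (ref_nm _ lt_i En)).
    by apply: (incr_lt mono_c inc); [rewrite ltnSn | apply: ref_nr].
  move=> y; rewrite inE => /andP[Hy incy] neq; apply: ninv_sub neq => i j /andP[lt_ij lt_j] inv.
  have lt_i := ltn_trans lt_ij lt_j.
  have Em : mu i = mu j.
    apply/eqP; rewrite eqn_leq mono_mu ?(ltnW lt_ij) //=.
    move/SparP: Hy => Hy; rewrite -Hy // -(Hy i) //; apply: mono_mu.
    by rewrite ltnW // pnat_lt.
  have neq : nu i <> nu j.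
    move=> En; have := @incr_lt n nu y i j mono_nu incy; rewrite lt_ij lt_j En.
    by move=> /(_ isT erefl); rewrite ltnNge (ltnW inv).
  apply: zlt => //.
  have [Hi Hj] : (p0 <= i < R0 + p)%N /\ (R0 + p <= j <= p1)%N.
    exact: munu.
  (* As the rows of t^lam w increase, w j <= w p1 < w p0 <= w i: every pair across the strip is
     inverted by w, and therefore by z. *)
  have le1 : (pnat w p0 <= pnat w i)%N.
    have [<- //| ne] := eqVneq p0 i; apply/ltnW/(incr_lt mono_c inc).
      by rewrite ltn_neqAle ne lt_i andbT; case/andP: Hi.
    by rewrite Ea; apply/esym/eqP; rewrite rowA //; move: Hi E0; clear; lia.
  have le2 : (pnat w j <= pnat w p1)%N.
    have [-> //| ne] := eqVneq j p1; apply/ltnW/(incr_lt mono_c inc).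
      rewrite ltn_neqAle ne /=; move: Hj E1 SN lt_cq; clear; lia.
    by rewrite Eb; apply/eqP; rewrite rowB //; move: Hj E1 lt_cq; clear; lia.
  by apply: leq_ltn_trans le2 _; apply: leq_trans lt_w le1.
Qed.
End Garnir.

Section Sorting.
Variables (ell n : nat) (blk : nat -> nat).
Hypothesis blk_mono : colmono n blk.
Implicit Types (lam : mpart ell) (w : 'S_n) (col : nat -> nat).

Lemma Spar_of_incr w : (forall i j, (i < n)%N -> (j < n)%N -> (blk i < blk j)%N ->
  (pnat w i < pnat w j)%N) -> w \in Spar n blk.
Proof.
move=> Hw; have [p [c [Hp Hc Ew]]] := par_decomp w blk_mono.
suff c1 : c = 1%g by rewrite Ew c1 mulg1.
apply/eqP/negPn/negP => /ex_descent[r [lt_r desc]].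
have [E | neq] := eqVneq (blk r) (blk r.+1).
  by move/incrP: Hc => /(_ r lt_r E); lia.
have lt : (blk r < blk r.+1)%N by rewrite ltn_neqAle neq blk_mono // leqnSn.
have := Hw (pnat p^-1%g r) (pnat p^-1%g r.+1); rewrite Ew !pnatM !pnatKV.
have /SparP Hq := SparV Hp; rewrite !Hq ?pnat_lt ?(ltnW lt_r) //.
by move=> /(_ isT isT lt); lia.
Qed.

(** A stable sort by the key [K]: the image of i is the number of positions preceding it when ties
    are broken by position. *)
Lemma rank_perm (K : nat -> nat) : exists w : 'S_n,
  forall i j, (i < n)%N -> (j < n)%N ->
  (pnat w i < pnat w j)%N = (K i < K j)%N || ((K i == K j) && (i < j)%N).
Proof.
pose lt i j := (K i < K j)%N || ((K i == K j) && (i < j)%N).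
have lt_irr i : lt i i = false by rewrite /lt ltnn eqxx ltnn.
have lt_tr j i k : lt i j -> lt j k -> lt i k by rewrite /lt; lia.
have lt_tot i j : i <> j -> lt i j || lt j i by rewrite /lt; lia.
pose rk (i : nat) := #|[pred j : 'I_n | lt j i]|.
have rk_lt i j : (i < n)%N -> lt i j -> (rk i < rk j)%N.
  move=> li H; apply/proper_card/properP; split.
    by apply/subsetP => k; rewrite !inE => /lt_tr; apply.
  by exists (Ordinal li); rewrite !inE //= lt_irr.
have rk_n i : (i < n)%N -> (rk i < n)%N.
  move=> li; rewrite -[X in (_ < X)%N](card_ord n); apply/proper_card/properP.
  by split; [apply/subsetP | exists (Ordinal li); rewrite // !inE /= lt_irr].
pose f (i : 'I_n) := Ordinal (rk_n i (ltn_ord i)).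
have finj : injective f.
  move=> i j /(congr1 val) /= E; apply/val_inj/eqP/negPn/negP => /eqP neq.
  by case/orP: (lt_tot _ _ neq) => /rk_lt H; have := H (ltn_ord _); rewrite E ltnn.
exists (perm finj) => i j li lj.
rewrite (pnat_ord _ (Ordinal li)) (pnat_ord _ (Ordinal lj)) !permE /= -/(lt i j); apply/idP/idP => [lt_ij | ]; last exact: rk_lt.
have [E | /eqP neq] := eqVneq i j; first by rewrite E ltnn in lt_ij.
by case/orP: (lt_tot _ _ neq) => // /(rk_lt _ _ lj); lia.
Qed.

(** Inside a block the class sizes need not decrease. A permutation of whole classes within the
    blocks turns them into the rows of a multipartition and leaves [msr] unchanged. *)
Lemma sort_col col : colmono n col -> refines n col blk -> exists (w : 'S_n) col',
  [/\ w \in Spar n blk, colmono n col', refines n col' blk, incr col w &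
    (forall i j, (i < n)%N -> (j < n)%N ->
     (col' (pnat w i) == col' (pnat w j)) = (col i == col j))] /\
  (forall i j, (i <= j < n)%N -> blk i = blk j -> (cls n col' j <= cls n col' i)%N) /\
  msr n col' = msr n col.
Proof.
move=> mono ref; pose B := (\sum_(i < n) col i + n.+1)%N.
have lt_colB i : (i < n)%N -> (col i < B)%N.
  by move=> li; rewrite /B (bigD1 (Ordinal li)) //=; lia.
have cls_n i : (n - cls n col i < B)%N by rewrite /B; lia.
(* In base B the digits of the key are the block, the complement of the class size and the colour:
   sorting stays inside blocks, puts larger classes first and keeps each class together. B exceeds
   every colour and n. *)
pose K i := ((blk i * B + (n - cls n col i)) * B + col i)%N.
have B0 : (0 < B)%N by rewrite /B; lia.
have clsE i j : col i = col j -> cls n col i = cls n col j.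
  by move=> E; apply: eq_card => k; rewrite !inE E.
have cls_le i : (cls n col i <= n)%N by rewrite (leq_trans (max_card _)) ?card_ord.
have Kmod i : (i < n)%N -> (K i %% B)%N = col i.
  by move=> li; rewrite /K modnMDl modn_small ?lt_colB.
have Kdiv i : (i < n)%N -> (K i %/ B)%N = (blk i * B + (n - cls n col i))%N.
  by move=> li; rewrite /K divnMDl // divn_small ?addn0 ?lt_colB.
have Kdiv2 i : (i < n)%N -> (K i %/ B %/ B)%N = blk i.
  by move=> li; rewrite Kdiv // divnMDl // divn_small ?addn0 ?cls_n.
have Kblk i j : (i < n)%N -> (j < n)%N -> (K i <= K j)%N -> (blk i <= blk j)%N.
  by move=> li lj le; rewrite -!Kdiv2 // !leq_div2r.
have Kcls i j : (i < n)%N -> (j < n)%N -> (K i <= K j)%N -> blk i = blk j ->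
    (cls n col j <= cls n col i)%N.
  move=> li lj /(leq_div2r B); rewrite !Kdiv // => + E; rewrite E leq_add2l.
  by have := cls_le i; have := cls_le j; lia.
have Keq i j : (i < n)%N -> (j < n)%N -> (K i == K j) = (col i == col j).
  move=> li lj; apply/eqP/eqP => [E | E]; first by rewrite -!Kmod // E.
  rewrite /K E (clsE i j E); congr ((_ * _ + _) * _ + _)%N.
  wlog le : i j li lj E / (i <= j)%N.
    by move=> IH; case: (leqP i j) => [|/ltnW] le; [exact: IH | apply/esym/IH].
  by apply: (refines_eq mono ref); rewrite ?le.
have [w Hw] := rank_perm K.
have Kle i j : (i <= j < n)%N -> (K (pnat w^-1%g i) <= K (pnat w^-1%g j))%N.
  move=> /andP[le lj]; rewrite leqNgt; apply/negP => lt.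
  have li := leq_ltn_trans le lj.
  have : (pnat w (pnat w^-1%g j) < pnat w (pnat w^-1%g i))%N by rewrite Hw ?pnat_lt ?lt.
  by rewrite !pnatKV ltnNge le.
have Hsp : w \in Spar n blk.
  apply: Spar_of_incr => i j li lj lt; rewrite Hw // [(K i < K j)%N]ltnNge.
  by apply/orP; left; apply: contraL lt => /(Kblk j i lj li); rewrite -leqNgt.
have /SparP HspV := SparV Hsp.
have clsw i : (i < n)%N -> cls n (fun m => K (pnat w^-1%g m)) i = cls n col (pnat w^-1%g i).
  move=> li; rewrite /cls -[RHS](card_image (@perm_inj _ w)); apply: eq_card => j.
  rewrite !inE Keq ?pnat_lt //; apply/idP/imageP => [H | [k]].
    by exists (w^-1%g j); rewrite ?permKV // inE -pnat_ord.
  by rewrite inE => H ->; rewrite -pnat_ord pnatK.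
exists w, (fun m => K (pnat w^-1%g m)); split; first split=> //.
- move=> r lt_r /eqP; rewrite Keq ?pnat_lt //; last by lia.
  move=> /eqP E; rewrite -(HspV r) ?(ltnW lt_r) // -(HspV r.+1) //.
  have le := HspV.
  wlog le' : / (pnat w^-1%g r <= pnat w^-1%g r.+1)%N.
    move=> IH; case: (leqP (pnat w^-1%g r) (pnat w^-1%g r.+1)) => [|/ltnW le']; first exact: IH.
    apply/esym/(refines_eq mono ref); rewrite ?le' ?pnat_lt //; lia.
  by apply: (refines_eq mono ref); rewrite ?le' ?pnat_lt.
- apply/incrP => r lt_r E; rewrite Hw //; last by lia.
  by have := Keq r r.+1; rewrite E eqxx => ->; rewrite ?ltnSn ?orbT //; lia.
- by move=> i j li lj; rewrite !pnatK Keq.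
split.
  move=> i j /andP[le lj] E; rewrite !clsw //; last by lia.
  apply: Kcls; rewrite ?pnat_lt ?Kle ?le //; try lia.
  by rewrite !HspV //; lia.
rewrite /msr (reindex_inj (@perm_inj _ w)) /=; apply: eq_bigr => i _.
by rewrite -pnat_ord clsw ?pnat_lt // pnatK.
Qed.
End Sorting.

Section ColToShape.
Variables (ell n : nat) (blk col : nat -> nat).
Hypothesis blk_mono : colmono n blk.
Hypothesis blk_ell : forall i, (i < n)%N -> (blk i < ell)%N.
Hypothesis mono : colmono n col.
Hypothesis ref : refines n col blk.
Hypothesis sorted_cls : forall i j, (i <= j < n)%N -> blk i = blk j ->
  (cls n col j <= cls n col i)%N.

(** [start] marks the first position of each class, so that [rnk] is the index of a class within its
    block and [nrows] the number of classes of a block. *)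
Let start j := (j == 0)%N || (col j.-1 != col j).
Let rnk i := #|[pred j : 'I_n | [&& start j, blk j == blk i & (j <= i)%N]]|.-1.
Let nrows b := #|[pred j : 'I_n | start j && (blk j == b)]|.

Lemma first_of_class i : (i < n)%N ->
  exists j, [/\ (j <= i)%N, start j & col j = col i].
Proof.
elim: i => [|i IHi] li; first by exists 0%N.
have [E | neq] := eqVneq (col i) (col i.+1); last by exists i.+1; split=> //; rewrite /start neq orbT.
have [j [le st Ej]] := IHi (ltnW li).
by exists j; split=> //; [lia | rewrite Ej].
Qed.

Lemma start_col i j : (i < j < n)%N -> start j -> (col i < col j)%N.
Proof.
move=> /andP[lt lj]; rewrite /start; have -> /= : (j == 0)%N = false by lia.
move=> neq; have m1 : (col i <= col j.-1)%N by apply: mono; lia.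
have m2 : (col j.-1 <= col j)%N by apply: mono; lia.
by move: neq m1 m2; lia.
Qed.

Lemma col_blk i j : (i < n)%N -> (j < n)%N -> col i = col j -> blk i = blk j.
Proof.
wlog le : i j / (i <= j)%N.
  by move=> IH li lj E; case: (leqP i j) => [|/ltnW] le; [exact: IH | apply/esym/IH].
by move=> li lj E; apply: (refines_eq mono ref) => //; rewrite le.
Qed.

Let R i := #|[pred j : 'I_n | [&& start j, blk j == blk i & (j <= i)%N]]|.

Lemma R_gt0 i : (i < n)%N -> (0 < R i)%N.
Proof.
move=> li; have [j [le st E]] := first_of_class li; have lj := leq_ltn_trans le li.
by apply/card_gt0P; exists (Ordinal lj); rewrite inE /= st le andbT; apply/eqP/col_blk.
Qed.

Lemma R_lt i j : (i < j < n)%N -> blk i = blk j -> (R i < R j)%N = (col i != col j).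
Proof.
move=> /andP[lt lj] Eb; have li := ltn_trans lt lj.
have sub : [pred k : 'I_n | [&& start k, blk k == blk i & (k <= i)%N]] \subset
           [pred k : 'I_n | [&& start k, blk k == blk j & (k <= j)%N]].
  by apply/subsetP => k; rewrite !inE Eb => /and3P[-> -> ?] /=; lia.
apply/idP/idP => [|neq].
  apply: contraTN => /eqP E; rewrite -leqNgt; apply/subset_leq_card/subsetP => k.
  rewrite !inE Eb => /and3P[st -> le] /=; rewrite st /= leqNgt; apply/negP => lt_ik.
  have := @start_col i k; rewrite lt_ik ltn_ord st => /(_ isT isT); rewrite E ltnNge.
  by rewrite mono // le.
apply/proper_card/properP; split=> //; have [k [le st Ek]] := first_of_class lj.
have lk := leq_ltn_trans le lj; exists (Ordinal lk); rewrite !inE /= st ?le ?andbT.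
  by rewrite /=; apply/eqP/col_blk.
apply/negP => /and3P[_ _ le_ki].
by case/eqP: neq; apply/eqP; rewrite eqn_leq mono ?(ltnW lt) // -Ek mono ?le_ki.
Qed.

Lemma rnkE i : (i < n)%N -> (rnk i).+1 = R i.
Proof. by move=> /R_gt0; rewrite /rnk -/(R i); case: (R i). Qed.

Lemma rnk_le i j : (i <= j < n)%N -> blk i = blk j -> (rnk i <= rnk j)%N.
Proof.
move=> /andP[le lj] Eb; have li := leq_ltn_trans le lj.
rewrite -ltnS !rnkE // ; apply/subset_leq_card/subsetP => k.
by rewrite !inE Eb => /and3P[-> -> ?] /=; lia.
Qed.

Lemma rnk_eq i j : (i < n)%N -> (j < n)%N -> blk i = blk j ->
  (rnk i == rnk j) = (col i == col j).
Proof.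
wlog le : i j / (i <= j)%N.
  move=> IH li lj E; case: (leqP i j) => [|/ltnW] le; first exact: IH.
  by rewrite eq_sym [RHS]eq_sym; apply: IH.
move=> li lj E; have [-> | neq] := eqVneq i j; first by rewrite !eqxx.
have := @R_lt i j; rewrite ltn_neqAle neq le lj -!rnkE // ltnS => /(_ isT E).
by have := @rnk_le i j; rewrite le lj => /(_ isT E); lia.
Qed.

Lemma rnk_nrows i : (i < n)%N -> (rnk i < nrows (blk i))%N.
Proof.
move=> li; rewrite rnkE //; apply/subset_leq_card/subsetP => k.
by rewrite !inE => /and3P[-> ->].
Qed.

(** Starting positions of the block have distinct ranks below [nrows b], and there are [nrows b] of
    them. *)
Lemma rnk_surj b r : (r < nrows b)%N -> exists i, [/\ (i < n)%N, blk i = b & rnk i = r].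
Proof.
move=> lt_r; pose S := enum [pred j : 'I_n | start j && (blk j == b)].
have u : uniq [seq rnk i | i : 'I_n <- S].
  rewrite map_inj_in_uniq ?enum_uniq // => i j.
  rewrite !mem_enum !inE => /andP[si /eqP bi] /andP[sj /eqP bj] /eqP.
  rewrite rnk_eq ?bi ?bj // => /eqP E; apply/val_inj; case: (ltngtP i j) => // lt.
    by have := @start_col i j; rewrite lt ltn_ord E ltnn => /(_ isT sj).
  by have := @start_col j i; rewrite lt ltn_ord E ltnn => /(_ isT si).
have sub : {subset [seq rnk i | i : 'I_n <- S] <= iota 0 (nrows b)}.
  move=> x /mapP[i]; rewrite mem_enum inE => /andP[_ /eqP <-] ->.
  by rewrite mem_iota rnk_nrows.
have [|_ H] := uniq_min_size u sub; first by rewrite size_iota size_map -cardE.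
have : r \in [seq rnk i | i : 'I_n <- S].
  by rewrite H mem_iota.
by case/mapP => i; rewrite mem_enum inE => /andP[_ /eqP Eb] ->; exists i.
Qed.

(* the rows of component l are the colour classes inside the block l *)
Definition shape_of : mpart ell := fun l =>
  mkseq (fun r => #|[pred i : 'I_n | (blk i == l) && (rnk i == r)]|) (nrows l).

Lemma nth_shape (l : 'I_ell) r :
  nth 0%N (shape_of l) r = #|[pred i : 'I_n | (blk i == l) && (rnk i == r)]|.
Proof.
have [lt | ge] := ltnP r (nrows l); first by rewrite nth_mkseq.
rewrite nth_default ?size_mkseq //; apply/esym/eq_card0 => i; rewrite !inE.
apply/negbTE/negP => /andP[/eqP Eb /eqP Er].
by have := rnk_nrows (ltn_ord i); rewrite Eb Er ltnNge ge.
Qed.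

Lemma psum_shape (l : 'I_ell) r : (\sum_(j < r) nth 0 (shape_of l) j)%N =
  #|[pred i : 'I_n | (blk i == l) && (rnk i < r)%N]|.
Proof.
elim: r => [|r IHr]; first by rewrite big_ord0; apply/esym/eq_card0 => i; rewrite !inE andbF.
rewrite psumS IHr nth_shape -cardUI addnC eq_card0 => [|i]; last by rewrite !inE; lia.
by apply: eq_card => i; rewrite !inE ltnS leq_eqVlt; case: (blk i == l) => //=; lia.
Qed.

Lemma sumn_shape (l : 'I_ell) : sumn (shape_of l) = #|[pred i : 'I_n | blk i == l]|.
Proof.
rewrite -(@psum_size _ (nrows l)) ?size_mkseq // psum_shape; apply: eq_card => i.
rewrite !inE; case: eqP => //= <-; exact: rnk_nrows.
Qed.

Lemma pre_shape (l : 'I_ell) : pre shape_of l = #|[pred i : 'I_n | (blk i < l)%N]|.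
Proof.
rewrite /pre (eq_bigr (fun k : 'I_ell => #|[pred i : 'I_n | blk i == k]|)) => [|k _].
  rewrite -sum1_card (partition_big (fun i : 'I_n => Ordinal (blk_ell (ltn_ord i)))
    (fun k : 'I_ell => (k < l)%N)) //=.
  apply: eq_bigr => k lt; rewrite -sum1_card; apply: eq_bigl => i.
  by rewrite !inE -val_eqE /=; case: eqP => [->|]; rewrite ?lt ?andbF.
exact: sumn_shape.
Qed.

Lemma card_below i : (i <= n)%N -> #|[pred j : 'I_n | (j < i)%N]| = i.
Proof. by move=> le; have := @card_interval n 0 i le; rewrite subn0. Qed.

(** The positions before i split into earlier blocks, earlier classes of the same block and earlier
    members of the same class; these are the three summands of [tlam]. *)
Lemma tlam_shape i (li : (i < n)%N) : exists c,
  inmp shape_of (Ordinal (blk_ell li)) (rnk i) c /\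
  tlam shape_of (Ordinal (blk_ell li)) (rnk i) c = i.
Proof.
pose c := #|[pred j : 'I_n | (col j == col i) && (j < i)%N]|; exists c.
set l := Ordinal _; split.
  rewrite /inmp nth_shape; apply/proper_card/properP; split.
    apply/subsetP => j; rewrite !inE => /andP[/eqP E lt].
    by have Eb := col_blk (ltn_ord j) li E; rewrite Eb eqxx rnk_eq // E eqxx.
  by exists (Ordinal li); rewrite !inE /= ?eqxx // ltnn andbF.
rewrite tlamE pre_shape psum_shape /c -{4}(card_below (ltnW li)).
rewrite -cardUI [X in (_ + X + _)%N]eq_card0 ?addn0 => [|j]; last by rewrite !inE /=; lia.
rewrite -cardUI [X in (_ + X)%N]eq_card0 ?addn0 => [|j]; last first.
  rewrite !inE /=; apply/negbTE/negP => /andP[H /andP[/eqP E lt]].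
  have Eb := col_blk (ltn_ord j) li E; move: H; rewrite Eb ltnn eqxx /=.
  by have := rnk_eq (ltn_ord j) li Eb; rewrite E eqxx; lia.
apply: eq_card => j; rewrite !inE /=.
apply/idP/idP => [/orP[/orP[|]|/andP[]//] | lt].
- by apply: contraTT; rewrite -!leqNgt => le; apply: blk_mono; rewrite le /=.
- move=> /andP[/eqP Eb]; apply: contraTT; rewrite -!leqNgt => le.
  by apply: rnk_le; rewrite ?le //=.
have := blk_mono (i := j) (j := i); rewrite (ltnW lt) li => /(_ isT).
rewrite leq_eqVlt => /orP[/eqP Eb | ->//]; rewrite Eb eqxx lt andbT /= ltnn /=.
have := @rnk_le j i; rewrite (ltnW lt) li => /(_ isT Eb).
by rewrite leq_eqVlt rnk_eq // => /orP[->|->]; rewrite ?orbT.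
Qed.

Lemma nth_shape_cls (l : 'I_ell) i : (i < n)%N -> blk i = l ->
  nth 0%N (shape_of l) (rnk i) = cls n col i.
Proof.
move=> li Eb; rewrite nth_shape; apply: eq_card => j; rewrite !inE.
apply/andP/eqP => [[/eqP Ej]|E]; first by rewrite rnk_eq ?Ej // => /eqP.
by have Ej := col_blk (ltn_ord j) li E; rewrite Ej Eb rnk_eq // E !eqxx.
Qed.

Lemma shape_of_mpart : is_mpart n shape_of.
Proof.
apply/andP; split; last first.
  apply/eqP; rewrite (eq_bigr (fun k : 'I_ell => #|[pred i : 'I_n | blk i == k]|)) => [|k _].
    rewrite -[RHS](card_ord n) -sum1_card
      (partition_big (fun i : 'I_n => Ordinal (blk_ell (ltn_ord i))) xpredT) //=.
    by apply: eq_bigr => k lt; rewrite -sum1_card; apply: eq_bigl => i.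
  exact: sumn_shape.
apply/forallP => l; apply/andP; split.
  apply/(sortedP 0%N) => r; rewrite size_mkseq => lt_r /=.
  have [i [li bi ri]] := rnk_surj (ltnW lt_r); have [j [lj bj rj]] := rnk_surj lt_r.
  rewrite /geq /= -{1}rj -{1}ri !nth_shape_cls //; apply: sorted_cls; rewrite ?bi ?bj //.
  rewrite lj andbT; case: (leqP i j) => // /ltnW le.
  by have := @rnk_le j i; rewrite le li bi bj ri rj => /(_ isT erefl); rewrite ltnn.
apply/allP => x /(nthP 0%N)[r]; rewrite size_mkseq => lt_r <-.
have [i [li bi <-]] := rnk_surj lt_r; rewrite nth_shape_cls //.
by apply/card_gt0P; exists (Ordinal li); rewrite inE /=.
Qed.

Lemma shape_of_compat : compat blk shape_of.
Proof.
move=> l r c Hin; have Hlam := shape_of_mpart; have li := tlam_lt_n Hlam Hin.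
have [c' [Hin' E]] := tlam_shape li.
have [El _ _] := tlam_inj Hin' Hin E.
exact: (congr1 (@nat_of_ord ell) El).
Qed.

Lemma rowcol_shape_of i j : (i < n)%N -> (j < n)%N ->
  (rowcol n shape_of i == rowcol n shape_of j) = (col i == col j).
Proof.
move=> li lj; have Hlam := shape_of_mpart.
have [c [Hin E]] := tlam_shape li; have [c' [Hin' E']] := tlam_shape lj.
rewrite -{1}E -{1}E' rowcol_eq // -val_eqE /=.
apply/andP/eqP => [[/eqP Eb]|Ec]; first by rewrite rnk_eq // => /eqP.
by have Eb := col_blk li lj Ec; rewrite Eb rnk_eq // Ec !eqxx.
Qed.
End ColToShape.

(** * Murphy elements span *)

Section MurphySpan.
Variables (ell n : nat) (blk : nat -> nat).
Hypothesis blk_mono : colmono n blk.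
Hypothesis blk_ell : forall i, (i < n)%N -> (blk i < ell)%N.
Variables (A : algType O) (T : nat -> A).
Hypothesis HT : typeA n T.
Implicit Types (lam : mpart ell) (x y w : 'S_n) (col : nat -> nat).

Local Notation Tw := (Tw T).
Local Notation xpar := (xpar n T).

Definition spar_span (z : A) : Prop := exists2 w, w \in Spar n blk & z = Tw w.

Lemma T_Tw_span r w : (r.+1 < n)%N -> blk r = blk r.+1 -> w \in Spar n blk ->
  lspan spar_span (T r * Tw w).
Proof.
move=> lt_r E Hw; have Hsw : (sr n r * w)%g \in Spar n blk by rewrite SparM ?Spar_sr.
have := pnat_neqS r w; case: (ltngtP (pnat w r) (pnat w r.+1)) => // cmp _.
  by rewrite (Tw_asc HT) //; apply: lspan_gen; exists (sr n r * w)%g.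
rewrite (Tw_mull HT) //; apply: lspanD; apply/lspanZ/lspan_gen; first by exists w.
by exists (sr n r * w)%g.
Qed.

Lemma TwTw_span x y : x \in Spar n blk -> y \in Spar n blk -> lspan spar_span (Tw x * Tw y).
Proof.
move=> Hx Hy; apply: (@Spar_ind n blk (fun x => lspan spar_span (Tw x * Tw y)) blk_mono _ _ x Hx).
  by rewrite Tw1 mul1r; apply: lspan_gen; exists y.
move=> r p lt_r E asc Hp IH; rewrite -(Tw_asc HT) // -mulrA.
by apply: lspan_mull IH => _ [w Hw ->]; apply: T_Tw_span.
Qed.

(** T_r has the inverse t^-1 (T_r - t + 1), for which t must be a unit of [O]. It allows T_w to be
    inserted next to [xpar] when the classes are sorted. *)
Lemma Tw_right_inv w : w \in Spar n blk -> exists2 z, lspan spar_span z & Tw w * z = 1.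
Proof.
move=> Hw; apply: (@Spar_ind n blk (fun w => exists2 z, lspan spar_span z & Tw w * z = 1)
  blk_mono _ _ w Hw).
  exists 1; last by rewrite Tw1 mulr1.
  by apply: lspan_gen; exists 1%g; rewrite ?Spar1 ?Tw1.
move=> r p lt_r E asc Hp [z Hz Ez]; rewrite -(Tw_asc HT) //.
have sE : Tw (sr n r) = T r by apply: Tw_sr.
exists (z * (tinv *: (T r - (t - 1)%:A))).
  apply: (lspan_mulr _ Hz) => _ [v Hv ->].
  rewrite -scalerAr mulrBr mulr_algr; apply: lspanZ; apply: lspanB.
    by rewrite -sE; apply: TwTw_span; rewrite ?Spar_sr.
  by apply/lspanZ/lspan_gen; exists v.
rewrite mulrA -[T r * _ * z]mulrA Ez mulr1 -scalerAr mulrBr mulr_algr (T_sqr HT) //.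
by rewrite addrC addKr scalerA mulrC t_tinv scale1r.
Qed.

(** The error terms of straightening. They are controlled by [msr] only and need not come from
    multipartitions; the outer induction in [murphy_par_span] absorbs them. *)
Definition above lam (g : A) : Prop := exists mu x y,
  [/\ colmono n mu, refines n mu blk, (msr n (rowcol n lam) < msr n mu)%N,
      x \in Spar n blk /\ y \in Spar n blk & g = Tw x * xpar mu * Tw y].

(** The Garnir relation: [xpar rc] times the sum of T_y over [reps n nu mu] equals a combination of
    the T_v^-1 times [xpar mu], both sides factoring through [xpar nu]. As w = z d with z the unique
    longest of the y, T_w is expressed by shorter terms and terms in [above]. *)
Lemma straighten lam w : is_mpart n lam -> compat blk lam -> w \in Spar n blk ->
  lspan (fun g => (exists v, [/\ v \in Std n lam, v \in Spar n blk &
     g = xpar (rowcol n lam) * Tw v]) \/ above lam g) (xpar (rowcol n lam) * Tw w).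
Proof.
move=> Hlam Hcmp; set rc := rowcol n lam; set Q := fun g : A => _ \/ _.
have mono_rc : colmono n rc by apply: colmono_rowcol.
have ref_rb : refines n rc blk by apply: compat_refines.
have [k] := ubnP (ninv w); elim: k w => // k IHk w le_k Hw.
have [inc | /forallPn[r]] := boolP (incr rc w); last first.
  rewrite negb_imply -leqNgt => /andP[/andP[lt_r /eqP E]].
  have := pnat_neqS r w; case: (ltngtP (pnat w r) (pnat w r.+1)) => // desc _ _.
  rewrite (Tw_desc HT lt_r desc) mulrA (xpar_T HT) // -scalerAl; apply: lspanZ.
  apply: IHk; first by have := ninv_desc lt_r desc; lia.
  by rewrite SparM // Spar_sr // ref_rb.
have [std | nstd] := boolP (w \in Std n lam).
  by apply: lspan_gen; left; exists w.
have [nu [mu [z [d [[mono_nu mono_mu ref_nm ref_nr ref_mb] [[Hd Hz incd Ew maxz] lt_m]]]]]] :=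
  garnir Hlam Hcmp Hw inc nstd.
have Hrep y : y \in reps n nu mu -> (y \in Spar n mu) && (y \in Spar n blk).
  by rewrite inE => /andP[Hy _]; rewrite Hy (Spar_refines mono_mu ref_mb Hy).
have step y : y \in reps n nu mu -> Tw (y * d)%g = Tw y * Tw d.
  by move=> /Hrep/andP[Hy _]; apply: (TwM_par HT mono_mu).
have sumE : xpar rc * (\sum_(y in reps n nu mu) Tw y) * Tw d =
   (\sum_(v in reps n nu rc) Tw v^-1%g) * xpar mu * Tw d.
  by rewrite (xpar_factorl HT mono_nu ref_nr) (xpar_factor HT mono_nu ref_nm) !mulrA.
have -> : xpar rc * Tw w = (\sum_(v in reps n nu rc) Tw v^-1%g) * xpar mu * Tw d -
    \sum_(y in reps n nu mu | y != z) xpar rc * Tw (y * d)%g.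
  rewrite -sumE (bigD1 z) //= mulrDr mulrDl -mulrA -step // -Ew.
  apply/esym/eqP; rewrite subr_eq; apply/eqP; congr (_ + _).
  rewrite mulr_sumr mulr_suml; apply: eq_bigr => y /andP[Hy _].
  by rewrite step // mulrA.
apply: lspanB.
  rewrite !mulr_suml; apply: lspan_sum => v; rewrite inE => /andP[Hv _].
  apply: lspan_gen; right; exists mu, v^-1%g, d; split=> //; split=> //.
  by apply: SparV; apply: Spar_refines mono_rc ref_rb _ Hv.
elim/big_rec: _ => [|y s /andP[Hy neq] IH]; first exact: lspan0.
apply: lspanD IH; have /andP[Hym Hyb] := Hrep _ Hy.
apply: IHk; last by rewrite SparM.
have := maxz y Hy neq; have := ninv_par mono_mu Hym incd.
have /andP[Hzm _] := Hrep _ Hz; have := ninv_par mono_mu Hzm incd; rewrite -Ew.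
by move=> E1 E2 lt; rewrite E2; move: le_k lt; rewrite E1; clear; lia.
Qed.

(** The mirror image of [straighten], proved separately since [A] comes without an anti-involution
    exchanging the two sides. *)
Lemma straightenl lam w : is_mpart n lam -> compat blk lam -> w \in Spar n blk ->
  lspan (fun g => (exists v, [/\ v \in Std n lam, v \in Spar n blk &
     g = Tw v^-1%g * xpar (rowcol n lam)]) \/ above lam g) (Tw w^-1%g * xpar (rowcol n lam)).
Proof.
move=> Hlam Hcmp; set rc := rowcol n lam; set Q := fun g : A => _ \/ _.
have mono_rc : colmono n rc by apply: colmono_rowcol.
have ref_rb : refines n rc blk by apply: compat_refines.
have [k] := ubnP (ninv w); elim: k w => // k IHk w le_k Hw.
have [inc | /forallPn[r]] := boolP (incr rc w); last first.
  rewrite negb_imply -leqNgt => /andP[/andP[lt_r /eqP E]].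
  have := pnat_neqS r w; case: (ltngtP (pnat w r) (pnat w r.+1)) => // desc _ _.
  rewrite (@Tw_descr _ _ _ HT w^-1%g r) ?invgK //.
  rewrite -mulrA (xpar_Tl HT) // -scalerAr; apply: lspanZ.
  rewrite -{1}(srV lt_r) -invMg.
  apply: IHk; first by rewrite -ltnS -(ninv_desc lt_r desc).
  by rewrite SparM // Spar_sr // ref_rb.
have [std | nstd] := boolP (w \in Std n lam).
  by apply: lspan_gen; left; exists w.
have [nu [mu [z [d [[mono_nu mono_mu ref_nm ref_nr ref_mb] [[Hd Hz incd Ew maxz] lt_m]]]]]] :=
  garnir Hlam Hcmp Hw inc nstd.
have Hrep y : y \in reps n nu mu -> (y \in Spar n mu) && (y \in Spar n blk).
  by rewrite inE => /andP[Hy _]; rewrite Hy (Spar_refines mono_mu ref_mb Hy).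
have step y : y \in reps n nu mu -> Tw (y * d)^-1%g = Tw d^-1%g * Tw y^-1%g.
  by move=> /Hrep/andP[Hy _]; rewrite invMg; apply: (TwM_parr HT mono_mu); rewrite ?SparV.
have sumE : Tw d^-1%g * (\sum_(y in reps n nu mu) Tw y^-1%g) * xpar rc =
   Tw d^-1%g * xpar mu * (\sum_(v in reps n nu rc) Tw v).
  by rewrite (xpar_factor HT mono_nu ref_nr) (xpar_factorl HT mono_nu ref_nm) !mulrA.
have -> : Tw w^-1%g * xpar rc = Tw d^-1%g * xpar mu * (\sum_(v in reps n nu rc) Tw v) -
    \sum_(y in reps n nu mu | y != z) Tw (y * d)^-1%g * xpar rc.
  rewrite -sumE (bigD1 z) //= mulrDr mulrDl -step // -Ew.
  apply/esym/eqP; rewrite subr_eq; apply/eqP; congr (_ + _).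
  rewrite -mulrA mulr_suml mulr_sumr; apply: eq_bigr => y /andP[Hy _].
  by rewrite step // mulrA.
apply: lspanB.
  rewrite mulr_sumr; apply: lspan_sum => v; rewrite inE => /andP[Hv _].
  apply: lspan_gen; right; exists mu, d^-1%g, v; split=> //; split; first exact: SparV.
  by apply: Spar_refines mono_rc ref_rb _ Hv.
elim/big_rec: _ => [|y s /andP[Hy neq] IH]; first exact: lspan0.
apply: lspanD IH; have /andP[Hym Hyb] := Hrep _ Hy.
apply: IHk; last by rewrite SparM.
have := maxz y Hy neq; have := ninv_par mono_mu Hym incd.
have /andP[Hzm _] := Hrep _ Hz; have := ninv_par mono_mu Hzm incd; rewrite -Ew.
by move=> E1 E2 lt; rewrite E2; move: le_k lt; rewrite E1; clear; lia.
Qed.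

(** Murphy elements of the block subgroup without the factor u_lam, which [gen1_murphy] supplies. *)
Definition murphy_par (g : A) : Prop := exists lam u v,
  [/\ is_mpart n lam, compat blk lam, u \in Std n lam /\ u \in Spar n blk,
      v \in Std n lam /\ v \in Spar n blk & g = Tw u^-1%g * xpar (rowcol n lam) * Tw v].

Lemma xpar_congr col col' : (forall i j, (i < n)%N -> (j < n)%N ->
  (col i == col j) = (col' i == col' j)) -> xpar col = xpar col'.
Proof.
move=> E; apply: eq_bigl => w; apply/SparP/SparP => H i li; apply/eqP.
  by rewrite -E ?pnat_lt ?H.
by rewrite E ?pnat_lt ?H.
Qed.

Lemma msr_congr col col' : (forall i j, (i < n)%N -> (j < n)%N ->
  (col i == col j) = (col' i == col' j)) -> msr n col = msr n col'.
Proof.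
by move=> E; apply: eq_bigr => i _; congr (2 ^ _)%N; apply: eq_card => j; rewrite !inE E.
Qed.

(** Induction on the distance of [msr] from its bound [msr_max]. The classes are first sorted into
    rows of a shape by conjugation, then both sides are straightened, and the terms in [above] have
    a larger measure. *)
Lemma murphy_par_span col x y : colmono n col -> refines n col blk ->
  x \in Spar n blk -> y \in Spar n blk -> lspan murphy_par (Tw x * xpar col * Tw y).
Proof.
have [k] := ubnP (n * 2 ^ n - msr n col)%N; elim: k col x y => // k IHk col x y le_k mono ref Hx Hy.
have [w [col' [[Hw mono' ref' incw Ecol] [srt Emsr]]]] := sort_col blk_mono mono ref.
pose lam : mpart ell := shape_of n blk col'.
have Hlam : is_mpart n lam by apply: shape_of_mpart.
have Hcmp : compat blk lam by apply: shape_of_compat.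
set rc := rowcol n lam.
have Erc i j : (i < n)%N -> (j < n)%N -> (rc i == rc j) = (col' i == col' j).
  by move=> li lj; apply: rowcol_shape_of.
have above_span g : above lam g -> lspan murphy_par g.
  move=> [mu [x' [y' [mono_mu ref_mu lt [Hx' Hy'] ->]]]]; apply: IHk => //.
  move: lt; rewrite -/rc (msr_congr Erc) Emsr => lt; have := msr_max n mu.
  by move: lt le_k; clear; lia.
have aboveM g p q : p \in Spar n blk -> q \in Spar n blk -> above lam g ->
    lspan (above lam) (Tw p * g * Tw q).
  move=> Hp Hq [mu [x' [y' [mono_mu ref_mu lt [Hx' Hy'] ->]]]].
  have -> : Tw p * (Tw x' * xpar mu * Tw y') * Tw q =
            (Tw p * Tw x') * (xpar mu * (Tw y' * Tw q)) by rewrite !mulrA.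
  apply: (lspan_mulr _ (TwTw_span Hp Hx')) => _ [p' Hp' ->].
  rewrite mulrA; apply: (lspan_mull _ (TwTw_span Hy' Hq)) => _ [q' Hq' ->].
  by apply: lspan_gen; exists mu, p', q'.
have core p q : p \in Spar n blk -> q \in Spar n blk -> lspan murphy_par (Tw p * xpar rc * Tw q).
  move=> Hp Hq; rewrite -mulrA; apply: (lspan_mull _ (straighten Hlam Hcmp Hq)) => g [].
    move=> [v [Hv Hvb ->]]; rewrite mulrA.
    have := straightenl Hlam Hcmp (SparV Hp); rewrite invgK => sp.
    apply: (lspan_mulr _ sp) => h [[u [Hu Hub ->]] | ab].
      by apply: lspan_gen; exists lam, u, v.
    have := aboveM h 1%g v (Spar1 _ _) Hvb ab; rewrite Tw1 mul1r.
    exact: lspan_sub.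
  move=> ab; have := aboveM g p 1%g Hp (Spar1 _ _) ab; rewrite Tw1 mulr1.
  exact: lspan_sub.
have [z Hz Ez] := Tw_right_inv Hw.
have -> : Tw x * xpar col * Tw y = Tw x * Tw w * (xpar col' * (z * Tw y)).
  have := xpar_conj HT mono mono' incw Ecol => E.
  have -> : Tw x * Tw w * (xpar col' * (z * Tw y)) = Tw x * (Tw w * xpar col') * z * Tw y.
    by rewrite !mulrA.
  by rewrite E !mulrA -[_ * _ * z]mulrA Ez mulr1.
apply: (lspan_mulr _ (TwTw_span Hx Hw)) => _ [p Hp ->].
rewrite mulrA; apply: lspan_mull; last first.
  apply: (lspan_mulr (Q := spar_span) _ Hz) => _ [q Hq ->]; exact: TwTw_span.
move=> _ [q Hq ->]; rewrite -(xpar_congr Erc); exact: core.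
Qed.
End MurphySpan.

(** * Spanning in the cyclotomic Hecke algebra *)

Lemma tzN k : tz (- k) * tz k = 1.
Proof.
have tinv_t : tinv * t = 1 by rewrite mulrC t_tinv.
case: k => [[|m]|m]; rewrite ?oppr0 /= ?expr0 ?mulr1 //.
  by rewrite -exprMn tinv_t expr1n.
by rewrite -exprMn t_tinv expr1n.
Qed.

(* zmod_eq proves identities in abelian groups; ring does not apply to the
   noncommutative algebra H. *)
Ltac zm_next x tac :=
  lazymatch goal with
  | |- context [x + (?y + ?w)] => rewrite (addrCA x y w); tac x
  | |- context [x + ?y] => rewrite (addrC x y)
  end.

Ltac zm_bubble x :=
  lazymatch x with
  | - ?z => first [rewrite (addKr z) | rewrite (addNr z) | zm_next x zm_bubble]
  | _ => first [rewrite (addNKr x) | rewrite (subrr x) | zm_next x zm_bubble]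
  end.

Ltac zmod_eq :=
  apply/eqP; rewrite -subr_eq0; apply/eqP; rewrite ?(opprD, opprK, addr0, add0r, oppr0) -?addrA;
  do 40 try (lazymatch goal with |- ?x + _ = 0 => zm_bubble x; rewrite ?(addr0, add0r) end);
  reflexivity.

Lemma prod_ord_split (R : pzRingType) m (q : nat -> R) : (0 < m)%N ->
  \prod_(l < m) q l = q 0%N * \prod_(l < m | (l.+1 < m)%N) q l.+1.
Proof.
case: m => // m _; rewrite big_ord_recl; congr (_ * _).
rewrite [RHS]big_mkcond big_ord_recr /= ltnn mulr1; apply: eq_bigr => i _.
by rewrite ltnS ltn_ord.
Qed.

Section HeckeSpan.
Variables (ell n : nat) (kappa : 'I_ell -> int).
Variables (A : algType O) (L T : nat -> A).
Hypothesis HR : hecke_rel n kappa L T.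
Implicit Types (x y w : 'S_n) (a : nat -> nat).

Local Notation Tw := (Tw T).

Lemma hecke_typeA : typeA n T.
Proof. by case: HR => _ [? [_ [? [? _]]]]; split. Qed.
Let HT := hecke_typeA.

Lemma LC r s : (r < n)%N -> (s < n)%N -> L r * L s = L s * L r.
Proof. by case: HR => _ [_ [H _]]; apply: H. Qed.

Lemma TLC r s : (r.+1 < n)%N -> (s < n)%N -> s <> r -> s <> r.+1 -> T r * L s = L s * T r.
Proof. by case: HR => _ [_ [_ [_ [_ [H _]]]]]; apply: H. Qed.

Lemma LST r : (r.+1 < n)%N -> L r.+1 * T r = T r * L r + 1 + (t - 1) *: L r.+1.
Proof.
case: HR => _ [_ [_ [_ [_ [_ H]]]]] /H <-.
by rewrite mulrDr mulrBr mulr1 mulr_algr scalerBl scale1r; zmod_eq.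
Qed.

(** [LST] multiplied by T_r on the right: the terms (t-1) L_{r+1} T_r cancel. The result expresses
    L_{r+1} through L_r, which drives the induction in [ua_L]. *)
Lemma LS r : (r.+1 < n)%N -> t *: L r.+1 = T r * L r * T r + T r.
Proof.
move=> lt_r; have E := LST lt_r.
have : L r.+1 * (T r * T r) = (T r * L r + 1 + (t - 1) *: L r.+1) * T r by rewrite mulrA E.
rewrite (T_sqr HT) // mulrDr -scalerAr mulr_algr !mulrDl -scalerAl mul1r.
by rewrite addrC => /addIr.
Qed.

Lemma tK (z : A) : tinv *: (t *: z) = z.
Proof. by rewrite scalerA mulrC t_tinv scale1r. Qed.

Lemma TLS r : (r.+1 < n)%N -> T r * L r.+1 = (t - 1) *: L r.+1 + L r * T r + 1.
Proof.
move=> lt_r; rewrite -[LHS]tK -[RHS]tK; congr (tinv *: _).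
rewrite scalerAr LS // mulrDr !mulrA (T_sqr HT) // !mulrDl -!scalerAl !mul1r.
rewrite !scalerDr scalerA mulrC -scalerA LS // scalerDr.
by zmod_eq.
Qed.

Definition uf (k : int) r : A := (tz (- k))%:A * (L r - (qint k)%:A).

(* u_lam depends on lam only through a l = |lam^(0)| + .. + |lam^(l)|.  For arbitrary
   admissible a, the span gen1 of the T_x u_a T_y contains 1 (take a = 0) and is stable
   under right multiplication by all generators. *)
Definition ua a : A :=
  \prod_(l < ell | (l.+1 < ell)%N) \prod_(r < a l) uf (kap kappa l.+1) r.

Lemma u_mpE (lam : mpart ell) :
  u_mp kappa L lam = ua (fun l => \sum_(k < ell | (k <= l)%N) sumn (lam k))%N.
Proof. by []. Qed.

Lemma uf_comm_L k r s : (r < n)%N -> (s < n)%N -> GRing.comm (L s) (uf k r).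
Proof.
move=> lr ls; rewrite /GRing.comm /uf mulr_algl -scalerAr -scalerAl.
by rewrite mulrBr mulrBl mulr_algr mulr_algl LC.
Qed.

Lemma uf_comm_T k r s : (r.+1 < n)%N -> (s < n)%N -> s <> r -> s <> r.+1 ->
  GRing.comm (T r) (uf k s).
Proof.
move=> lr ls n1 n2; rewrite /GRing.comm /uf mulr_algl -scalerAr -scalerAl.
by rewrite mulrBr mulrBl mulr_algr mulr_algl TLC.
Qed.

(** T_r commutes with the sum and the product of L_r and L_{r+1}, hence with the symmetric
    expression (L_r - [k]) (L_{r+1} - [k]). *)
Lemma uf2_comm_T k r : (r.+1 < n)%N -> GRing.comm (T r) (uf k r * uf k r.+1).
Proof.
move=> lr; rewrite /GRing.comm /uf !mulr_algl -!scalerAr -!scalerAl -scalerAr.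
congr (_ *: (_ *: _)).
have E1 := LST lr; have E2 := TLS lr; have E3 := LC lr (ltnW lr).
have sumE : T r * (L r + L r.+1) = (L r + L r.+1) * T r.
  by rewrite mulrDr mulrDl E1 E2; zmod_eq.
have prodE : T r * (L r * L r.+1) = L r * L r.+1 * T r.
  have TL : T r * L r = L r.+1 * T r - 1 - (t - 1) *: L r.+1 by rewrite E1; zmod_eq.
  rewrite mulrA TL !mulrBl mul1r -[L r.+1 * T r * _]mulrA E2 !mulrDr mulr1.
  by rewrite -scalerAr -scalerAl !mulrA E3; zmod_eq.
have -> : (L r - (qint k)%:A) * (L r.+1 - (qint k)%:A) =
   L r * L r.+1 - (qint k) *: (L r + L r.+1) + (qint k * qint k)%:A.
  by rewrite mulrBr !mulrBl !mulr_algr !mulr_algl scalerDr scalerA; zmod_eq.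
by rewrite mulrDr mulrBr mulrDl mulrBl -scalerAr -scalerAl sumE prodE mulr_algr mulr_algl.
Qed.

(** Unless m = r+1, the product contains both of the factors with index r and r+1 or neither. *)
Lemma ufs_comm_T k r m : (r.+1 < n)%N -> (m <= n)%N -> r.+1 <> m ->
  GRing.comm (T r) (\prod_(s < m) uf k s).
Proof.
move=> lr; elim: m => [|m IHm] le_m neq; first by rewrite big_ord0; apply: commr1.
have [E | neq2] := eqVneq m r.+1.
  subst m; rewrite !big_ord_recr /= -mulrA; apply: commrM; last exact: uf2_comm_T.
  apply: commr_prod => s _; apply: uf_comm_T => //; have := ltn_ord s; lia.
have [E | neq3] := eqVneq m r; first by lia.
rewrite big_ord_recr /=; apply: commrM; first by apply: IHm; lia.
by apply: uf_comm_T => //; lia.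
Qed.

(** Cut points must increase weakly with l; the last component is exempt because it has no factor in
    [ua]. *)
Definition adm a := (forall l l', (l <= l')%N -> (l'.+1 < ell)%N -> (a l <= a l')%N) /\
  (forall l, (l.+1 < ell)%N -> (a l <= n)%N).

Lemma ua_comm_T a r : adm a -> (r.+1 < n)%N ->
  (forall l, (l.+1 < ell)%N -> a l <> r.+1) -> GRing.comm (T r) (ua a).
Proof.
move=> [_ le_a] lr neq; apply: commr_prod => l lt_l; apply: ufs_comm_T => //.
  exact: le_a.
by move=> E; apply: (neq l lt_l).
Qed.

Lemma ufs_comm_L k s m : (s < n)%N -> (m <= n)%N -> GRing.comm (L s) (\prod_(r < m) uf k r).
Proof.
move=> ls le_m; apply: commr_prod => r _; apply: uf_comm_L => //.
by have := ltn_ord r; lia.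
Qed.

Lemma uf_comm_ufs k k' s m : (s < n)%N -> (m <= n)%N ->
  GRing.comm (uf k s) (\prod_(r < m) uf k' r).
Proof.
move=> ls le_m; rewrite /uf mulr_algl; apply/commr_sym; rewrite /GRing.comm -scalerAl -scalerAr.
congr (_ *: _); apply: commrB; last by rewrite /GRing.comm mulr_algl mulr_algr.
exact/commr_sym/ufs_comm_L.
Qed.

(* ua is a product over a non-commutative index, so factors are extracted from the right *)
Lemma ua_incr a l0 : adm a -> (l0.+1 < ell)%N -> (a l0 < n)%N ->
  ua (fun l => if l == l0 then (a l0).+1 else a l) = ua a * uf (kap kappa l0.+1) (a l0).
Proof.
move=> [_ le_a] lt_l0 lt_n; rewrite /ua.
have lt0 : (l0 < ell)%N by apply: ltnW.
pose f (l : 'I_ell) := \prod_(r < a l) uf (kap kappa l.+1) r.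
pose x := uf (kap kappa l0.+1) (a l0).
have cx (l : 'I_ell) : (l.+1 < ell)%N -> GRing.comm x (f l).
  by move=> lt_l; apply: uf_comm_ufs; rewrite ?le_a.
pose g (l : 'I_ell) := if l == l0 :> nat then f l * x else f l.
rewrite (eq_bigr g) => [|l lt_l]; last first.
  by rewrite /g /f /x; case: eqP => [->|//]; rewrite big_ord_recr.
rewrite -/x; clearbody x.
have : exists i : 'I_ell, (i == Ordinal lt0) && (i \in index_enum 'I_ell).
  by exists (Ordinal lt0); rewrite eqxx mem_index_enum.
have main (s : seq 'I_ell) : uniq s -> \prod_(l <- s | (l.+1 < ell)%N) g l =
   \prod_(l <- s | (l.+1 < ell)%N) f l * (if Ordinal lt0 \in s then x else 1).
  elim: s => [|i s IHs] /=; first by rewrite !big_nil mulr1.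
  move=> /andP[nin u]; rewrite !big_cons in_cons IHs // {1}/g -!val_eqE /=.
  case: (eqVneq (val i) l0) => [E | neq].
    have Ei : i = Ordinal lt0 by apply: val_inj.
    have lt_i : (i.+1 < ell)%N by rewrite Ei.
    rewrite lt_i /= -Ei (negbTE nin) mulr1 -!mulrA; congr (_ * _).
    apply: commr_prod => l lt_l; exact: cx.
  by case: ifP => _ /=; rewrite ?mulrA.
by move=> _; rewrite main ?index_enum_uniq // mem_index_enum.
Qed.

(** With all cuts positive, [ua a] contains every factor L_0 - [kappa_l] with l > 0. Multiplying by
    L_0 - [kappa_0] completes the cyclotomic relation. *)
Lemma ua_zero a : (0 < ell)%N -> adm a -> (0 < n)%N ->
  (forall l, (l.+1 < ell)%N -> (0 < a l)%N) ->
  ua a * L 0 = qint (kap kappa 0) *: ua a.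
Proof.
move=> ell0 [_ le_a] n0 pos.
pose q l := L 0 - (qint (kap kappa l))%:A.
have cq l s : (s < n)%N -> GRing.comm (L s) (q l).
  by move=> ls; apply: commrB; [apply: LC | rewrite /GRing.comm mulr_algl mulr_algr].
have cqq l l' : GRing.comm (q l) (q l').
  by apply/commr_sym/commrB; [apply/commr_sym/cq | rewrite /GRing.comm mulr_algl mulr_algr].
have [w [Ew cw _]] : exists w : A, [/\ ua a = w * \prod_(l < ell | (l.+1 < ell)%N) q l.+1,
    (forall l, GRing.comm (q l) w) & True].
  rewrite /ua; pose K (x y : A) := exists w : A, [/\ x = w * y, (forall l, GRing.comm (q l) w) & True].
  apply: (big_rec2 K) => [|l x y lt_l [w [-> cw _]]].
    by exists 1; split=> //; [rewrite mulr1 | move=> l; apply: commr1].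
  case Ea : (a l) (pos l lt_l) (le_a l lt_l) => [//|m] _ le_m.
  rewrite big_ord_recl.
  pose v := \prod_(i < m) uf (kap kappa l.+1) (lift ord0 i).
  have cv l' : GRing.comm (q l') v.
    apply/commr_sym/commrB; last by rewrite /GRing.comm mulr_algl mulr_algr.
    apply/commr_sym/commr_prod => i _; apply: uf_comm_L => //.
    by rewrite /= /bump /=; have := ltn_ord i; lia.
  exists ((tz (- kap kappa l.+1)) *: (v * w)); split=> //.
    have -> : uf (kap kappa l.+1) (ord0 : 'I_m.+1) = tz (- kap kappa l.+1) *: q l.+1 by rewrite /uf mulr_algl.
    rewrite -/v -!scalerAl; congr (_ *: _).
    by rewrite (cv l.+1) -!mulrA; congr (_ * _); rewrite !mulrA (cw l.+1).
  by move=> l'; rewrite /GRing.comm -scalerAl -scalerAr; congr (_ *: _); apply: commrM.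
apply/eqP; rewrite -subr_eq0 -mulr_algr -mulrBr -/(q 0%N) Ew -mulrA.
have : \prod_(l < ell) q l = 0.
  case: HR => /(_ n0) H _; rewrite -[RHS]H; apply: eq_bigr => l _; rewrite /q /kap.
  by rewrite (insubT (fun k => k < ell)%N (ltn_ord l)) /=; congr (_ - (qint (kappa _))%:A); apply: val_inj.
rewrite prod_ord_split // => E.
have <- : q 0%N * \prod_(l < ell | (l.+1 < ell)%N) q l.+1 =
    \prod_(l < ell | (l.+1 < ell)%N) q l.+1 * q 0%N.
  by apply: commr_prod => i _; apply: cqq.
by rewrite E mulr0.
Qed.

Definition gen1 (g : A) : Prop := exists x y a, adm a /\ g = Tw x * ua a * Tw y.

Lemma T_Tw x r : (r.+1 < n)%N -> lspan (fun g => exists w, g = Tw w) (T r * Tw x).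
Proof.
move=> lt_r; have := pnat_neqS r x; case: (ltngtP (pnat x r) (pnat x r.+1)) => // cmp _.
  by rewrite (Tw_asc HT) //; apply: lspan_gen; exists (sr n r * x)%g.
rewrite (Tw_mull HT) //; apply: lspanD; apply/lspanZ/lspan_gen; first by exists x.
by exists (sr n r * x)%g.
Qed.

Lemma Tw_T x r : (r.+1 < n)%N -> lspan (fun g => exists w, g = Tw w) (Tw x * T r).
Proof.
move=> lt_r; have := pnat_neqS r x^-1%g.
case: (ltngtP (pnat x^-1%g r) (pnat x^-1%g r.+1)) => // cmp _.
  by rewrite (Tw_ascr HT) //; apply: lspan_gen; exists (x * sr n r)%g.
rewrite (Tw_mulr HT) //; apply: lspanD; apply/lspanZ/lspan_gen; first by exists x.
by exists (x * sr n r)%g.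
Qed.

Lemma gen1_T g r : (r.+1 < n)%N -> lspan gen1 g -> lspan gen1 (g * T r).
Proof.
move=> lt_r; apply: lspan_mulr => _ [x [y [a [Ha ->]]]].
have -> : Tw x * ua a * Tw y * T r = Tw x * ua a * (Tw y * T r) by rewrite mulrA.
by apply: (lspan_mull _ (Tw_T y lt_r)) => _ [w ->]; apply: lspan_gen; exists x, w, a.
Qed.

Lemma gen1_Tl g r : (r.+1 < n)%N -> lspan gen1 g -> lspan gen1 (T r * g).
Proof.
move=> lt_r; apply: lspan_mull => _ [x [y [a [Ha ->]]]].
have -> : T r * (Tw x * ua a * Tw y) = T r * Tw x * (ua a * Tw y) by rewrite !mulrA.
apply: (lspan_mulr _ (T_Tw x lt_r)) => _ [w ->]; rewrite mulrA.
by apply: lspan_gen; exists w, y, a.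
Qed.

Lemma gen1_Tw g w : lspan gen1 g -> lspan gen1 (g * Tw w).
Proof.
move=> Hg; elim/perm_ind: w g Hg => [|r w lt_r asc IH] g Hg; first by rewrite Tw1 mulr1.
by rewrite -(Tw_asc HT) // mulrA; apply/IH/gen1_T.
Qed.

Lemma Tw_L y k : (k < n)%N ->
  lspan (fun g => exists w, g = Tw w \/ exists2 j, (j < n)%N & g = L j * Tw w) (Tw y * L k).
Proof.
move=> lt_k; elim/perm_ind: y => [|r y lt_r asc IH].
  rewrite Tw1 mul1r; apply: lspan_gen; exists 1%g; right; exists k; rewrite ?Tw1 ?mulr1 //.
rewrite -(Tw_asc HT) // -mulrA; apply: lspan_mull IH => g [w [->|[j lt_j ->]]].
  by apply: lspan_sub (T_Tw w lt_r) => _ [v ->]; apply: lspan_gen; exists v; left.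
have LT i : (i < n)%N -> lspan (fun g => exists w, g = Tw w \/
    exists2 j, (j < n)%N & g = L j * Tw w) (L i * (T r * Tw w)).
  move=> lt_i; apply: lspan_mull (T_Tw w lt_r) => _ [v ->].
  by apply: lspan_gen; exists v; right; exists i.
have LW i : (i < n)%N -> lspan (fun g => exists w, g = Tw w \/
    exists2 j, (j < n)%N & g = L j * Tw w) (L i * Tw w).
  by move=> lt_i; apply: lspan_gen; exists w; right; exists i.
have W : lspan (fun g => exists w, g = Tw w \/
    exists2 j, (j < n)%N & g = L j * Tw w) (Tw w) by apply: lspan_gen; exists w; left.
rewrite mulrA; have [E | n1] := eqVneq j r.
  subst j; have -> : T r * L r = L r.+1 * T r - 1 - (t - 1) *: L r.+1 by rewrite LST //; zmod_eq.
  rewrite !mulrBl mul1r -scalerAl -mulrA; apply: lspanB; last exact/lspanZ/LW.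
  by apply: lspanB; first exact: LT.
have [E | n2] := eqVneq j r.+1.
  subst j; rewrite TLS // !mulrDl mul1r -scalerAl -mulrA; apply: lspanD W.
  by apply: lspanD; [apply/lspanZ/LW | apply/LT/ltnW].
by rewrite TLC //; [rewrite -mulrA; apply: LT | apply/eqP | apply/eqP].
Qed.

(** If k is a cut, L_k is a combination of 1 and the factor that moves this cut to k+1; the last
    such cut is taken to keep a monotone. Otherwise T_{k-1} commutes with [ua a], so [LS] lowers k,
    and at k = 0 all cuts are positive and [ua_zero] applies. *)
Lemma ua_L a k : (0 < ell)%N -> adm a -> (k < n)%N -> lspan gen1 (ua a * L k).
Proof.
move=> ell0 Ha; move: k; have ua_gen b : adm b -> lspan gen1 (ua b).
  by move=> Hb; apply: lspan_gen; exists 1%g, 1%g, b; rewrite Tw1 mulr1 mul1r.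
elim/ltn_ind => k IHk lt_k.
have [[l [lt_l El max_l]] | nstart] := pselect (exists l, [/\ (l.+1 < ell)%N, a l = k &
    forall l', (l < l')%N -> (l'.+1 < ell)%N -> a l' <> k]).
  have Ha' : adm (fun l' => if l' == l then (a l).+1 else a l').
    case: Ha => mono le_a; split=> [l1 l2 le12 lt2 | l1 lt1]; last by case: eqP => _; [rewrite El | apply: le_a].
    case: eqP => [E1|n1]; case: eqP => [E2|n2].
    - by [].
    - subst l1; rewrite El; have lt12 : (l < l2)%N by rewrite ltn_neqAle le12 andbT eq_sym; apply/eqP.
      have := max_l _ lt12 lt2; have := mono _ _ le12 lt2; rewrite El; lia.
    - by subst l2; have := mono _ _ le12 lt2; lia.
    - exact: mono.
  have := ua_incr Ha lt_l; rewrite El => /(_ lt_k) E.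
  have -> : ua a * L k = tz (kap kappa l.+1) *: (ua a * uf (kap kappa l.+1) k) +
      qint (kap kappa l.+1) *: ua a.
    rewrite /uf mulr_algl -scalerAr scalerA mulrC tzN scale1r mulrBr mulr_algr.
    by rewrite subrK.
  apply: lspanD; apply: lspanZ; last exact: ua_gen.
  by rewrite -E; apply: ua_gen; rewrite -El.
have nst l : (l.+1 < ell)%N -> a l <> k.
  move=> lt_l El; apply: nstart.
  pose P m := (m.+1 < ell)%N && (a m == k).
  have exP : exists m, P m by exists l; rewrite /P lt_l El eqxx.
  have ubP m : P m -> (m <= ell)%N by case/andP => /ltnW/ltnW.
  case: (ex_maxnP exP ubP) => m /andP[lt_m /eqP Em] maxm.
  exists m; split=> // l' lt' lt_l' E'; have := maxm l'; rewrite /P lt_l' E' eqxx => /(_ isT).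
  by rewrite leqNgt lt'.
case: k lt_k nst {nstart} IHk => [|k] lt_k nst IHk.
  rewrite ua_zero //; first by apply/lspanZ/ua_gen.
  by move=> l /nst; lia.
rewrite -[L k.+1]tK LS // -scalerAr; apply: lspanZ; rewrite mulrDr.
have cT : GRing.comm (T k) (ua a) by apply: ua_comm_T.
apply: lspanD; last by apply/gen1_T/ua_gen.
rewrite !mulrA -cT -(mulrA (T k)); apply: gen1_T => //; apply: gen1_Tl => //.
exact: IHk _ (ltnSn k) (ltnW lt_k).
Qed.

Lemma gen1_L g k : (0 < ell)%N -> (k < n)%N -> lspan gen1 g -> lspan gen1 (g * L k).
Proof.
move=> ell0 lt_k; apply: lspan_mulr => _ [x [y [a [Ha ->]]]].
have -> : Tw x * ua a * Tw y * L k = Tw x * ua a * (Tw y * L k) by rewrite mulrA.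
apply: (lspan_mull _ (Tw_L y lt_k)) => _ [w [->|[j lt_j ->]]].
  by apply: lspan_gen; exists x, w, a.
rewrite -mulrA (mulrA (ua a)) mulrA; apply: gen1_Tw.
apply: lspan_mull (ua_L ell0 Ha lt_j) => h Hh.
suff : lspan gen1 (Tw x * h) by [].
elim/perm_ind: x {y} => [|r x lt_r asc IH]; first by rewrite Tw1 mul1r; apply: lspan_gen.
by rewrite -(Tw_asc HT) // -mulrA; apply: gen1_Tl.
Qed.

Lemma gen1_1 : lspan gen1 1.
Proof.
apply: lspan_gen; exists 1%g, 1%g, (fun _ => 0%N); split; first by split.
by rewrite Tw1 mul1r mulr1 /ua big1 // => l _; rewrite big_ord0.
Qed.

(** Colours the positions by the block between cuts in which they lie. Its Young subgroup is the one
    whose T_w commute with [ua a]. *)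
Definition blkcol a i : nat := #|[pred l : 'I_ell | (l.+1 < ell)%N && (a l <= i)%N]|.

Lemma blkcol_mono a : colmono n (blkcol a).
Proof.
move=> i j /andP[le _]; apply/subset_leq_card/subsetP => l.
by rewrite !inE => /andP[-> ?] /=; apply: leq_trans le.
Qed.

Lemma blkcol_lt a i : (0 < ell)%N -> (blkcol a i < ell)%N.
Proof.
move=> ell0; rewrite -[X in (_ < X)%N](card_ord ell); apply/proper_card/properP; split.
  exact/subsetP.
have lt : (ell.-1 < ell)%N by rewrite prednK.
by exists (Ordinal lt); rewrite // !inE /= prednK // ltnn.
Qed.

Lemma blkcol_le a i l : adm a -> (l.+1 < ell)%N -> (blkcol a i <= l)%N = (i < a l)%N.
Proof.
move=> [mono _] lt_l; have lt_l' : (l < ell)%N by apply: ltnW.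
have [le | lt] := leqP (a l) i; last first.
  rewrite -[X in (_ <= X)%N](card_below (ltnW lt_l')).
  apply/subset_leq_card/subsetP => k; rewrite !inE => /andP[lt_k le] /=.
  rewrite ltnNge; apply/negP => le_lk; have := mono l k le_lk lt_k.
  by rewrite leqNgt (leq_ltn_trans le lt).
apply/negbTE; rewrite -ltnNge.
rewrite -[X in (X <= _)%N](card_below lt_l').
apply/subset_leq_card/subsetP => k; rewrite !inE /= => le_k.
rewrite (leq_ltn_trans _ lt_l) //=; apply: leq_trans le; exact: mono.
Qed.

Lemma ua_comm_Tw a w : adm a -> w \in Spar n (blkcol a) -> Tw w * ua a = ua a * Tw w.
Proof.
move=> Ha; move: w; apply: Spar_ind => [||r p lt_r E asc Hp IH]; first exact: blkcol_mono.
  by rewrite Tw1 mul1r mulr1.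
rewrite -(Tw_asc HT) // -mulrA IH !mulrA; congr (_ * _); apply: ua_comm_T => // l lt_l El.
have := blkcol_le r Ha lt_l; have := blkcol_le r.+1 Ha lt_l.
by rewrite El E ltnn ltnSn => ->.
Qed.

(** If the end of component l differed from the cut, the position at the smaller of the two values
    would lie in different components for [lam] and for the block colouring. *)
Lemma compat_sum a (lam : mpart ell) l : is_mpart n lam -> adm a -> compat (blkcol a) lam ->
  (l.+1 < ell)%N -> (\sum_(k < ell | (k <= l)%N) sumn (lam k))%N = a l.
Proof.
move=> Hlam Ha Hcmp lt_l; pose l0 := Ordinal (ltnW lt_l).
have E : (\sum_(k < ell | (k <= l)%N) sumn (lam k) = pre lam l0 + sumn (lam l0))%N.
  rewrite (bigD1 l0) //= addnC; congr addn; apply: eq_bigl => k.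
  by rewrite -val_eqE /= ltn_neqAle andbC.
have le_n : (pre lam l0 + sumn (lam l0) <= n)%N by rewrite -(sum_mp Hlam) sum_mp_pre.
rewrite E; case: (ltngtP (pre lam l0 + sumn (lam l0)) (a l)) => // lt.
  have lt_n : (pre lam l0 + sumn (lam l0) < n)%N.
    by apply: leq_trans lt _; case: Ha => _; apply.
  have [l' [r [c [Hin E']]]] := node_ex Hlam lt_n.
  move: lt; rewrite -(blkcol_le _ Ha lt_l) -E' Hcmp // => le.
  have := inmp_sumn Hin; have : (pre lam l' + sumn (lam l') <= pre lam l0 + sumn (lam l0))%N.
    move: le; rewrite leq_eqVlt => /orP[/eqP El|lt]; first by have -> : l' = l0 by apply: val_inj.
    by have := @preS _ lam l' l0 lt; lia.
  by move: E'; rewrite tlamE; lia.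
have lt_n : (a l < n)%N by apply: leq_trans lt le_n.
have [l' [r [c [Hin E']]]] := node_ex Hlam lt_n.
have := blkcol_le (a l) Ha lt_l; rewrite ltnn -E' Hcmp // => /negbT; rewrite -ltnNge => lt'.
by have := @preS _ lam l0 l' lt'; move: E' lt; rewrite tlamE; lia.
Qed.

Lemma ua_compat a (lam : mpart ell) : is_mpart n lam -> adm a -> compat (blkcol a) lam ->
  u_mp kappa L lam = ua a.
Proof.
by move=> Hlam Ha Hcmp; apply: eq_bigr => l lt_l; rewrite (compat_sum Hlam Ha Hcmp lt_l).
Qed.

(** Rows and columns stay within one component, that is within one block, and there c preserves the
    order. *)
Lemma Std_mulr blk (lam : mpart ell) u c : is_mpart n lam -> colmono n blk ->
  compat blk lam -> u \in Std n lam -> u \in Spar n blk -> incr blk c ->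
  (u * c)%g \in Std n lam.
Proof.
move=> Hlam mono Hcmp /(StdP Hlam) Hu /SparP Hub Hc; apply/StdP => // l r k Hin.
have [H1 H2] := Hu _ _ _ Hin.
by split=> Hin'; rewrite !pnatM; apply: (incr_lt mono Hc);
  rewrite ?H1 ?H2 ?pnat_lt ?Hub ?(tlam_lt_n Hlam) ?Hcmp.
Qed.

Definition murphy_set (g : A) : Prop := exists (lam : mpart ell) u v,
  [/\ is_mpart n lam, u \in Std n lam, v \in Std n lam & g = murphy kappa L T lam u v].

Lemma x_mpE (lam : mpart ell) : is_mpart n lam -> x_mp n T lam = xpar n T (rowcol n lam).
Proof. by move=> Hlam; rewrite /x_mp rowstabE. Qed.

Lemma xpar_id : xpar n T id = 1.
Proof.
rewrite /xpar (eq_bigl (pred1 1%g)) ?big_pred1_eq ?Tw1 // => w.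
apply/SparP/eqP => [H | ->] => [|i _]; last by rewrite pnat1.
by apply: pnat_ext => i li; rewrite pnat1 H.
Qed.

(** Both x^-1 and y factor into a block permutation and an element increasing on blocks. The block
    parts pass through u_a and are expanded in Murphy elements, with 1 = [xpar n T id] in the
    middle; the increasing parts are multiplied on at the end. *)
Lemma gen1_murphy g : (0 < ell)%N -> gen1 g -> lspan murphy_set g.
Proof.
move=> ell0 [x [y [a [Ha ->]]]]; set blk := blkcol a.
have mono : colmono n blk := blkcol_mono a.
have [p [c [Hp Hc Ey]]] := par_decomp y mono.
have [q [d [Hq Hd Ex]]] := par_decomp x^-1%g mono.
have Ex' : x = (d^-1 * q^-1)%g by rewrite -invMg -Ex invgK.
have E : Tw x * ua a * Tw y =
    Tw d^-1%g * (ua a * (Tw q^-1%g * xpar n T id * Tw p)) * Tw c.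
  rewrite Ex' Ey (TwM_par HT mono) // (TwM_parr HT mono) ?SparV // xpar_id mulr1.
  rewrite -!mulrA; congr (_ * _); rewrite !mulrA; congr (_ * _ * _).
  exact: ua_comm_Tw (SparV Hq).
have blk_ell i : (i < n)%N -> (blk i < ell)%N by move=> _; apply: blkcol_lt.
have sp := murphy_par_span mono blk_ell HT (col := id) _ _ (SparV Hq) Hp.
rewrite E; apply: (lspan_mulr (P := fun h => exists2 g, murphy_par ell n blk T g &
   h = Tw d^-1%g * (ua a * g))); last first.
  apply: (lspan_mull (P := fun h => exists2 g, murphy_par ell n blk T g & h = ua a * g)).
    by move=> _ [g' Hg ->]; apply: lspan_gen; exists g'.
  apply: (lspan_mull _ (sp _ _)) => [g' Hg|i j|r lt_r /=]; last by lia.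
    by apply: lspan_gen; exists g'.
  by case/andP.
move=> _ [_ [lam [u [v [Hlam Hcmp [Hu Hub] [Hv Hvb] ->]]]] ->].
apply: lspan_gen; exists lam, (u * d)%g, (v * c)%g.
split=> //; [exact: Std_mulr Hcmp Hu Hub Hd | exact: Std_mulr Hcmp Hv Hvb Hc |].
rewrite /murphy invMg (TwM_parr HT mono) ?SparV // (TwM_par HT mono) //.
rewrite /m_mp (ua_compat Hlam Ha Hcmp) x_mpE // !mulrA; congr (_ * _ * _ * _).
by rewrite -!mulrA (ua_comm_Tw Ha (SparV Hub)).
Qed.

Definition rstable (y : A) := forall g, lspan gen1 g -> lspan gen1 (g * y).

Lemma rstableM (x y : A) : rstable x -> rstable y -> rstable (x * y).
Proof. by move=> Hx Hy g Hg; rewrite mulrA; apply/Hy/Hx. Qed.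

Lemma rstable_Tw w : rstable (Tw w).
Proof. by move=> g; apply: gen1_Tw. Qed.

Lemma rstable_ua a : (0 < ell)%N -> adm a -> rstable (ua a).
Proof.
move=> ell0 [_ le_a]; have st1 : rstable 1 by move=> g; rewrite mulr1.
apply: (big_ind rstable) => //; first exact: rstableM.
move=> l lt_l; apply: (big_ind rstable) => //; first exact: rstableM.
move=> r _; rewrite /uf mulr_algl => g Hg.
rewrite -scalerAr mulrBr mulr_algr; apply/lspanZ/lspanB; last exact: lspanZ.
by apply: gen1_L => //; have := le_a l lt_l; have := ltn_ord r; lia.
Qed.

Lemma adm_mp (lam : mpart ell) : is_mpart n lam ->
  adm (fun l => \sum_(k < ell | (k <= l)%N) sumn (lam k))%N.
Proof.
move=> Hlam; split=> [l l' le lt | l lt].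
  rewrite [X in (_ <= X)%N](bigID (fun k : 'I_ell => (k <= l)%N)) /=.
  apply: leq_trans (leq_addr _ _); apply/eq_leq/eq_bigl => k.
  by case: (leqP k l) => // le_k; rewrite ?andbF ?andbT // (leq_trans le_k le).
rewrite -[X in (_ <= X)%N](sum_mp Hlam) [X in (_ <= X)%N](bigID (fun k : 'I_ell => (k <= l)%N)) /=.
exact: leq_addr.
Qed.

Lemma rstable_m (lam : mpart ell) : (0 < ell)%N -> is_mpart n lam -> rstable (m_mp n kappa L T lam).
Proof.
move=> ell0 Hlam; apply: rstableM; first by rewrite u_mpE; apply/rstable_ua/adm_mp.
by move=> g Hg; rewrite /x_mp mulr_sumr; apply: lspan_sum => w _; apply: rstable_Tw.
Qed.

Lemma murphy_span (lam : mpart ell) (u v u' v' : 'S_n) : (0 < ell)%N -> is_mpart n lam ->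
  lspan murphy_set (murphy kappa L T lam u v * murphy kappa L T lam u' v').
Proof.
move=> ell0 Hlam; apply: (@lspan_sub _ gen1) => [g Hg|]; first exact: gen1_murphy.
rewrite -[X in lspan _ X]mul1r.
have st (x y : 'S_n) : rstable (murphy kappa L T lam x y).
  by do 2 (apply: rstableM; last exact: rstable_Tw || exact: rstable_m); apply: rstable_Tw.
exact: rstableM gen1_1.
Qed.
End HeckeSpan.

(* 'M[F]_m.+1 viewed as an algebra over the Laurent polynomials O *)
Definition MF (m : nat) : Type := 'M[F]_m.+1.
HB.instance Definition _ m := GRing.NzRing.copy (MF m) 'M[F]_m.+1.

Section MFAlgebra.
Variable m : nat.
Definition mfscale (c : O) (M : MF m) : MF m := (Oval c *: (M : 'M[F]_m.+1))%R.

Lemma mfscaleA a b v : mfscale a (mfscale b v) = mfscale (a * b) v.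
Proof. by rewrite /mfscale scalerA OvalM. Qed.

Lemma mfscale1 : left_id 1 mfscale.
Proof. by move=> v; rewrite /mfscale Oval1 scale1r. Qed.

Lemma mfscaleDr : right_distributive mfscale +%R.
Proof. by move=> a u v; rewrite /mfscale scalerDr. Qed.

Lemma mfscaleDl v : {morph mfscale^~ v : a b / a + b}.
Proof. by move=> a b; rewrite /mfscale OvalD scalerDl. Qed.

HB.instance Definition _ := GRing.Zmodule_isLmodule.Build O (MF m)
  mfscaleA mfscale1 mfscaleDr mfscaleDl.

Lemma mfscaleAl (a : O) (u v : MF m) : a *: (u * v) = (a *: u) * v.
Proof. exact: (scalemxAl (Oval a) (u : 'M[F]_m.+1) (v : 'M[F]_m.+1)). Qed.

HB.instance Definition _ := GRing.Lmodule_isLalgebra.Build O (MF m) mfscaleAl.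

Lemma mfscaleAr (a : O) (u v : MF m) : a *: (u * v) = u * (a *: v).
Proof. exact: (scalemxAr (Oval a) (u : 'M[F]_m.+1) (v : 'M[F]_m.+1)). Qed.

HB.instance Definition _ := GRing.Lalgebra_isAlgebra.Build O (MF m) mfscaleAr.

Lemma mfscaleE (a : O) (u : MF m) : a *: u = (Oval a *: (u : 'M[F]_m.+1))%R :> 'M[F]_m.+1.
Proof. by []. Qed.
End MFAlgebra.

(** * Contents *)

(* the quantum integer [k], evaluated in F *)
Definition qn (k : int) : F := (tF ^ k - 1) / (tF - 1).

Lemma tFX_inj (i j : int) : tF ^ i = tF ^ j -> i = j.
Proof.
have tFn (m : nat) : tF ^+ m = 1 -> m = 0%N.
  rewrite /tF -tofracXn -tofrac1 => /eqP; rewrite tofrac_eq => /eqP E.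
  have := congr1 (fun p : {poly int} => size p) E; rewrite size_polyXn size_poly1.
  by case: m {E}.
have tFz (k : int) : tF ^ k = 1 -> k = 0.
  case: k => [m|m]; first by move=> /tFn ->.
  by rewrite NegzE -exprnN => /(congr1 GRing.inv); rewrite invrK invr1 => /tFn.
move=> E; apply/eqP; rewrite -subr_eq0; apply/eqP/tFz.
by rewrite expfzDr ?tF_neq0 // E -expfzDr ?tF_neq0 // subrr.
Qed.

Lemma tF_neq1 : tF - 1 != 0.
Proof.
by rewrite subr_eq0; apply/eqP => E; have := @tFX_inj 1 0; rewrite expr1z expr0z => /(_ E).
Qed.

Lemma qn_eq0 k : (qn k == 0) = (k == 0).
Proof.
rewrite /qn mulf_eq0 invr_eq0 (negbTE tF_neq1) orbF subr_eq0.
by apply/eqP/eqP => [E | ->]; [apply: tFX_inj; rewrite E | rewrite expr0z].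
Qed.

Lemma Oval_sum (I : finType) (f : I -> O) : Oval (\sum_i f i) = \sum_i Oval (f i).
Proof. exact: (raddf_sum (val : O -> F)). Qed.

Lemma OvalX (x : O) m : Oval (x ^+ m) = Oval x ^+ m.
Proof. exact: (rmorphXn (val : O -> F)). Qed.

Lemma Oval_tz k : Oval (tz k) = tF ^ k.
Proof.
case: k => m /=; rewrite OvalX ?Oval_t ?Oval_tinv // NegzE -exprnN.
by rewrite exprVn.
Qed.

Lemma qn_nat (m : nat) : qn m = \sum_(i < m) tF ^+ i.
Proof. by rewrite /qn -exprnP subrX1 mulrAC mulfV ?tF_neq1 ?mul1r. Qed.

Lemma Oval_qint k : Oval (qint k) = qn k.
Proof.
case: k => m /=.
  by rewrite Oval_sum qn_nat; apply: eq_bigr => i _; rewrite OvalX Oval_t.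
rewrite Oval_sum; have -> : \sum_(i < m.+1) Oval (tinv ^+ i.+1) =
    tF ^- m.+1 * \sum_(i < m.+1) tF ^+ i.
  rewrite mulr_sumr (reindex_inj rev_ord_inj) /=; apply: eq_bigr => i _.
  rewrite OvalX Oval_tinv subSS exprVn.
  have lt : (i < m.+1)%N by [].
  have -> : tF ^+ m.+1 = tF ^+ (m - i).+1 * tF ^+ i by rewrite -exprD; congr (_ ^+ _); lia.
  by rewrite invfM -mulrA mulVf ?mulr1 ?expf_neq0 ?tF_neq0.
rewrite -qn_nat /qn NegzE -exprnN -exprnP mulrA -mulNr; congr (_ / _).
by rewrite mulrBr mulVf ?expf_neq0 ?tF_neq0 // mulr1 opprB.
Qed.

Lemma qn_sub i j : qn i - qn j = tF ^ j * qn (i - j).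
Proof.
rewrite /qn -mulrBl mulrA; congr (_ / _); rewrite mulrBr mulr1 -expfzDr ?tF_neq0 //.
have -> : j + (i - j) = i by lia.
by ring.
Qed.

Section Contents.
Variables (ell n : nat) (kappa : 'I_ell -> int).
Hypothesis Hkappa : forall l : 'I_ell, (l.+1 < ell)%N -> n%:Z < kappa l - kap kappa l.+1.

Lemma kapE (l : 'I_ell) : kap kappa l = kappa l.
Proof. by rewrite /kap valK. Qed.

Lemma kap_gap (l l' : nat) : (l < l' < ell)%N -> n%:Z < kap kappa l - kap kappa l'.
Proof.
elim: l' => [|l' IH] /andP[lt lt']; first by [].
have Hk := Hkappa (l := Ordinal (ltnW lt')) lt'; rewrite -kapE /= in Hk.
have [E | neq] := eqVneq l l'; first by rewrite E.
have := IH; rewrite (ltnW lt') ltn_neqAle neq -ltnS lt => /(_ isT); lia.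
Qed.

Variable lam : mpart ell.
Hypothesis Hlam : is_mpart n lam.
Implicit Types (l : 'I_ell) (r c i j : nat) (u v w : 'S_n).

(** Contents are indexed by positions of t^lam, so the entry k of t^lam u has content
    [pcont (pnat u^-1 k)]. *)
Definition pcont i : int :=
  if [pick x : node ell n | innode (inmp lam) x &&
       (let: (l, r, c) := x in tlam lam l r c == i)] is Some x
  then content kappa x else 0.

Lemma pick_node (tab : 'I_ell -> nat -> nat -> nat) l r c : inmp lam l r c ->
  (forall l' r' c', inmp lam l' r' c' -> tab l' r' c' = tab l r c -> [/\ l' = l, r' = r & c' = c]) ->
  [pick x : node ell n | innode (inmp lam) x &&
     (let: (l', r', c') := x in tab l' r' c' == tab l r c)] = Some (l, inord r, inord c).
Proof.
move=> Hin uni; have lr := inmp_row_lt Hlam Hin; have lc := inmp_col_lt Hlam Hin.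
case: pickP => [[[l' r'] c'] /andP[/= Hin' /eqP E] | none].
  have [-> Er Ec] := uni _ _ _ Hin' E; congr (Some (_, _, _));
  by apply: val_inj; rewrite /= inordK //; lia.
have := none (l, inord r, inord c); rewrite /= !inordK ?Hin ?eqxx //; lia.
Qed.

Lemma pcontE l r c : inmp lam l r c -> pcont (tlam lam l r c) = kappa l + c%:Z - r%:Z.
Proof.
move=> Hin; have lr := inmp_row_lt Hlam Hin; have lc := inmp_col_lt Hlam Hin.
rewrite /pcont pick_node //=; first by rewrite !inordK //; lia.
by move=> l' r' c' Hin' /(tlam_inj Hin' Hin).
Qed.

(** Both nodes satisfy r + c < |lam^(l)| and two components have at most n nodes together. The bound
    2 also excludes contents that differ by one. *)
Lemma pcont_gap l r c l' r' c' : inmp lam l r c -> inmp lam l' r' c' -> (l < l')%N ->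
  2 <= pcont (tlam lam l r c) - pcont (tlam lam l' r' c').
Proof.
move=> Hin Hin' lt; rewrite !pcontE //.
have := @kap_gap l l'; rewrite lt ltn_ord !kapE => /(_ isT).
have := inmp_hook Hlam Hin; have := inmp_hook Hlam Hin'.
have neq : l != l' by rewrite -val_eqE /= neq_ltn lt.
have := sumn2_le_n Hlam neq; lia.
Qed.

Lemma Std_le u l r c k m : u \in Std n lam -> inmp lam l (r + k) (c + m) ->
  (pnat u (tlam lam l r c) + k + m <= pnat u (tlam lam l (r + k) (c + m)))%N.
Proof.
move=> /(StdP Hlam) Hu; elim: k => [|k IHk].
  elim: m => [|m IHm]; rewrite ?addn0 // addnS => Hin.
  have Hin2 := inmp_left Hlam (leqnSn _) Hin; have [H1 _] := Hu _ _ _ Hin2.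
  by have := H1 Hin; have := IHm; rewrite !addn0 in Hin2 * => /(_ Hin2); lia.
rewrite addnS => Hin; have Hin2 := inmp_up Hlam (leqnSn _) Hin.
by have [_ /(_ Hin)] := Hu _ _ _ Hin2; have := IHk Hin2; lia.
Qed.

(** Between two nodes of one diagonal lie the right and lower neighbours of the first, with two
    different intermediate entries. *)
Lemma Std_diag u l r c k : u \in Std n lam -> inmp lam l (r + k.+1) (c + k.+1) ->
  (pnat u (tlam lam l r c) + 3 <= pnat u (tlam lam l (r + k.+1) (c + k.+1)))%N.
Proof.
move=> Hu Hin.
have H1 : inmp lam l r.+1 c.+1.
  have H0 : inmp lam l (r + k.+1) c.+1 by apply: (inmp_left Hlam _ Hin); lia.
  by apply: (inmp_up Hlam _ H0); lia.
have Hr : inmp lam l r c.+1 by apply: (inmp_up Hlam _ H1); lia.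
have Hd : inmp lam l r.+1 c by apply: (inmp_left Hlam _ H1); lia.
have := @Std_le u l r c 0 1 Hu; rewrite !addn0 !addn1 => /(_ Hr) e1.
have := @Std_le u l r c 1 0 Hu; rewrite !addn0 !addn1 => /(_ Hd) e2.
have := @Std_le u l r c.+1 1 0 Hu; rewrite !addn0 !addn1 => /(_ H1) e3.
have := @Std_le u l r.+1 c 0 1 Hu; rewrite !addn0 !addn1 => /(_ H1) e4.
have := @Std_le u l r.+1 c.+1 k k Hu; rewrite !addSnnS => /(_ Hin) e5.
have neq : pnat u (tlam lam l r c.+1) <> pnat u (tlam lam l r.+1 c).
  by move=> /pnat_inj /(tlam_inj Hr Hd) [_]; lia.
lia.
Qed.

(** Distance one serves the denominators of T_r, distance two those of the braid identities. Equal
    contents force the same component and diagonal, where entries differ by at least three. *)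
Lemma pcont_neq u i j : u \in Std n lam -> (i < j < n)%N -> (j <= i + 2)%N ->
  pcont (pnat u^-1%g i) <> pcont (pnat u^-1%g j).
Proof.
move=> Hu /andP[lt lj] le; have li := ltn_trans lt lj.
have [l [r [c [Hin Ei]]]] := node_ex Hlam (pnat_lt u^-1%g li).
have [l' [r' [c' [Hin' Ej]]]] := node_ex Hlam (pnat_lt u^-1%g lj).
rewrite -Ei -Ej => E.
have ui : pnat u (tlam lam l r c) = i by rewrite Ei pnatKV.
have uj : pnat u (tlam lam l' r' c') = j by rewrite Ej pnatKV.
case: (ltngtP l l') => [ltl|ltl|/val_inj El].
- by have := pcont_gap Hin Hin' ltl; rewrite E subrr.
- by have := pcont_gap Hin' Hin ltl; rewrite E subrr.
subst l'; move: E; rewrite !pcontE // => E.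
case: (ltngtP r r') => [ltr|ltr|Er].
- have [k Ek] : exists k, (r' = r + k.+1)%N by exists (r' - r).-1; lia.
  have Ec : (c' = c + k.+1)%N by lia.
  by subst r' c'; have := Std_diag Hu Hin'; lia.
- have [k Ek] : exists k, (r = r' + k.+1)%N by exists (r - r').-1; lia.
  have Ec : (c = c' + k.+1)%N by lia.
  by subst r c; have := Std_diag Hu Hin; lia.
subst r'; have Ec : c = c' by lia.
by subst c'; lia.
Qed.

Lemma nStd_swap u r : u \in Std n lam -> (r.+1 < n)%N -> (u * sr n r)%g \notin Std n lam ->
  exists l i c i' c', [/\ inmp lam l i c, inmp lam l i' c',
    pnat u^-1%g r = tlam lam l i c, pnat u^-1%g r.+1 = tlam lam l i' c' &
    (i' = i /\ c' = c.+1) \/ (i' = i.+1 /\ c' = c)].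
Proof.
move=> /(StdP Hlam) Hu lt_r nstd; apply: contrapT => none; case/negP: nstd.
have key l i c i' c' : inmp lam l i c -> inmp lam l i' c' ->
    (i' = i /\ c' = c.+1) \/ (i' = i.+1 /\ c' = c) ->
    (pnat u (tlam lam l i c) < pnat u (tlam lam l i' c'))%N ->
    (pnat (u * sr n r)%g (tlam lam l i c) < pnat (u * sr n r)%g (tlam lam l i' c'))%N.
  move=> Hin Hin' adj lt; rewrite !pnatM !pnat_sr //; rewrite ltnNge; apply/negP => le.
  apply: none; exists l, i, c, i', c'.
  have [E1 E2] : pnat u (tlam lam l i c) = r /\ pnat u (tlam lam l i' c') = r.+1.
    move: lt le; move: (pnat u _) (pnat u _) => x y.
    by case: (swpP r x) => [?|?|? ?]; case: (swpP r y) => [?|?|? ?]; lia.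
  by split=> //; [rewrite -[X in pnat _ X]E1 pnatK | rewrite -[X in pnat _ X]E2 pnatK].
apply/(StdP Hlam) => l i c Hin; have [H1 H2] := Hu _ _ _ Hin.
split=> Hin'; [have := H1 Hin' | have := H2 Hin'] => lt; apply: key => //.
  by left.
by right.
Qed.

(** A swap destroys standardness only for horizontal or vertical neighbours, whose order is the same
    in all standard tableaux. This shows that the tableaux between two standard ones are
    standard. *)
Lemma nStd_order u v r : u \in Std n lam -> (r.+1 < n)%N -> (u * sr n r)%g \notin Std n lam ->
  v \in Std n lam -> (pnat v (pnat u^-1%g r) < pnat v (pnat u^-1%g r.+1))%N.
Proof.
move=> Hu lt_r nstd /(StdP Hlam) Hv.
have [l [i [c [i' [c' [Hin Hin' -> -> adj]]]]]] := nStd_swap Hu lt_r nstd.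
have [H1 H2] := Hv _ _ _ Hin.
by case: adj => [[? ?]|[? ?]]; subst; [apply: H1 | apply: H2].
Qed.

Lemma nStd_pos u r : u \in Std n lam -> (r.+1 < n)%N -> (u * sr n r)%g \notin Std n lam ->
  (pnat u^-1%g r < pnat u^-1%g r.+1)%N.
Proof.
by move=> Hu lt_r nstd; have := nStd_order Hu lt_r nstd (Std1 Hlam); rewrite !pnat1.
Qed.

Lemma nStd_content u r : u \in Std n lam -> (r.+1 < n)%N -> (u * sr n r)%g \notin Std n lam ->
  pcont (pnat u^-1%g r.+1) = pcont (pnat u^-1%g r) + 1 \/
  pcont (pnat u^-1%g r.+1) = pcont (pnat u^-1%g r) - 1.
Proof.
move=> Hu lt_r nstd.
have [l [i [c [i' [c' [Hin Hin' -> -> adj]]]]]] := nStd_swap Hu lt_r nstd.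
by rewrite !pcontE //; case: adj => [[? ?]|[? ?]]; subst; [left | right]; lia.
Qed.

Lemma Std_first u : (0 < n)%N -> u \in Std n lam -> exists l, pcont (pnat u^-1%g 0) = kappa l.
Proof.
move=> n0 Hu; have [l [r [c [Hin E]]]] := node_ex Hlam (pnat_lt u^-1%g n0).
have H0 : pnat u (tlam lam l r c) = 0%N by rewrite E pnatKV.
have := @Std_le u l 0 0 r c Hu; rewrite !add0n H0 => /(_ Hin) le.
have [Er Ec] : r = 0%N /\ c = 0%N by lia.
by subst r c; exists l; rewrite -E pcontE // addr0 subr0.
Qed.
End Contents.

(** * The seminormal representations *)

Section SeminormalCoefficients.
Variables (K : fieldType) (q : K).
Implicit Types x y z : K.

(* With X = t^c(r) and Y = t^c(r+1), the exponentials of the contents of the entries r and r+1,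
   Young's seminormal form has diagonal coefficient sna X Y, and snf X Y is the product
   of the two off-diagonal ones. *)
Definition sna x y : K := (q - 1) * y / (y - x).
Definition snf x y : K := (q * y - x) * (y - q * x) / (y - x) ^+ 2.

Lemma snfC x y : snf x y = snf y x.
Proof. by rewrite /snf -[in RHS](opprB y x) sqrrN; congr (_ / _); ring. Qed.

Lemma snf_quad x y : y - x != 0 -> sna x y ^+ 2 + snf x y = (q - 1) * sna x y + q.
Proof. by move=> neq; rewrite /sna /snf; field. Qed.

Lemma sna_trace x y : y - x != 0 -> sna x y + sna y x = q - 1.
Proof.
move=> neq; have neq' : x - y != 0 by rewrite -opprB oppr_eq0.
by rewrite /sna; field; rewrite neq neq'.
Qed.

Lemma sna_succ x : x != 0 -> q - 1 != 0 -> sna x (x * q) = q.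
Proof.
move=> nx nq; have -> : sna x (x * q) = ((q - 1) * x) * q / ((q - 1) * x).
  by rewrite /sna; congr (_ / _); ring.
by rewrite mulrAC mulfV ?mul1r ?mulf_neq0.
Qed.

Lemma snf_succ x : snf x (x * q) = 0.
Proof. by rewrite /snf [x * q]mulrC subrr mulr0 mul0r. Qed.

Lemma snf_pred x : snf (x * q) x = 0.
Proof. by rewrite snfC snf_succ. Qed.

Lemma sna_LT x y : y - x != 0 -> q - 1 != 0 ->
  (y - 1) / (q - 1) * (sna x y - q + 1) = sna x y * ((x - 1) / (q - 1)) + 1.
Proof. by move=> neq nq; rewrite /sna; field; rewrite neq nq. Qed.

Lemma braid0 x y z : y - x != 0 -> z - y != 0 -> z - x != 0 ->
  sna x y ^+ 2 * sna y z + snf x y * sna x z = sna y z ^+ 2 * sna x y + snf y z * sna x z.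
Proof. by move=> n1 n2 n3; rewrite /sna /snf; field; rewrite n1 n2 n3. Qed.

Lemma braid1 x y z : y - x != 0 -> z - y != 0 -> z - x != 0 ->
  sna x y * sna y z + sna x z * sna y x = sna y z * sna x z.
Proof.
move=> n1 n2 n3; have n1' : x - y != 0 by rewrite -opprB oppr_eq0.
by rewrite /sna; field; rewrite n1 n1' n2 n3.
Qed.

Lemma braid2 x y z : y - x != 0 -> z - y != 0 -> z - x != 0 ->
  sna x y * sna x z = sna y z * sna x y + sna x z * sna z y.
Proof.
move=> n1 n2 n3; have n2' : y - z != 0 by rewrite -opprB oppr_eq0.
by rewrite /sna; field; rewrite n1 n2' n2 n3.
Qed.

Lemma quad_vec (a a' b b' v0 v1 : K) :
  a ^+ 2 + b * b' = (q - 1) * a + q -> b * (a + a') = (q - 1) * b ->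
  a * (a * v0 + b * v1) + b * (a' * v1 + b' * v0) + (a * v0 + b * v1) -
    q * (a * v0 + b * v1 + v0) = 0.
Proof.
move=> e1 e2.
transitivity ((a ^+ 2 + b * b' - ((q - 1) * a + q)) * v0 + (b * (a + a') - (q - 1) * b) * v1).
  by ring.
by rewrite e1 e2 !subrr !mul0r addr0.
Qed.

Lemma comm_vec (a1 a2 b1 b2 c1 c2 d1 d2 v0 v1 v2 v3 : K) :
  b1 * c1 = b1 * a2 -> b2 * c2 = b2 * a1 -> b1 * d1 = b2 * d2 ->
  a1 * (a2 * v0 + b2 * v2) + b1 * (c1 * v1 + d1 * v3) =
  a2 * (a1 * v0 + b1 * v1) + b2 * (c2 * v2 + d2 * v3).
Proof.
move=> e1 e2 e3; apply/eqP; rewrite -subr_eq0; apply/eqP.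
transitivity ((b1 * c1 - b1 * a2) * v1 - (b2 * c2 - b2 * a1) * v2 + (b1 * d1 - b2 * d2) * v3).
  by ring.
by rewrite e1 e2 e3 !subrr !mul0r subr0 addr0.
Qed.

(** The v_i are coordinates of the six basis vectors in an orbit of s_r and s_{r+1}. The assumptions
    on diagonal coefficients carry an off-diagonal factor, so they remain true when a neighbouring
    tableau is not standard and that factor is 0. *)
Lemma braid_vec (a c b d s g k f1 f2 p1 p2 p3 p4 p5 p6 m1 m2 m3 m4 m5 m6
    v0 v1 v2 v3 v4 v5 : K) :
  a ^+ 2 * c + f1 * s = c ^+ 2 * a + f2 * s ->
  a * c + s * g = c * s -> a * s = c * a + s * k ->
  b * p1 = b * s -> b * p2 = b * g -> d * p3 = d * s -> d * p4 = d * k ->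
  b * m2 * p5 = b * m2 * c -> d * m3 * p6 = d * m3 * a ->
  b * m1 = f1 -> d * m4 = f2 -> b * m2 * m5 = d * m3 * m6 ->
  a * (c * (a * v0 + b * v1) + d * (p3 * v2 + m3 * v4)) +
    b * (p1 * (p2 * v1 + m1 * v0) + m2 * (p5 * v3 + m5 * v5)) =
  c * (a * (c * v0 + d * v2) + b * (p1 * v1 + m2 * v3)) +
    d * (p3 * (p4 * v2 + m4 * v0) + m3 * (p6 * v4 + m6 * v5)).
Proof.
move=> C0 C1 C2 A1 A2 A3 A4 A5 A6 B1 B2 B3; apply/eqP; rewrite -subr_eq0; apply/eqP.
transitivity (
  ((a ^+ 2 * c + f1 * s - (c ^+ 2 * a + f2 * s)) + (b * p1 - b * s) * m1 + s * (b * m1 - f1)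
    - (d * p3 - d * s) * m4 - s * (d * m4 - f2)) * v0 +
  (p2 * (b * p1 - b * s) + s * (b * p2 - b * g) - c * (b * p1 - b * s)
    + b * (a * c + s * g - c * s)) * v1 +
  (a * (d * p3 - d * s) - p4 * (d * p3 - d * s) - s * (d * p4 - d * k)
    + d * (a * s - (c * a + s * k))) * v2 +
  (b * m2 * p5 - b * m2 * c) * v3 - (d * m3 * p6 - d * m3 * a) * v4 +
  (b * m2 * m5 - d * m3 * m6) * v5); first by ring.
by rewrite C0 C1 C2 A1 A2 A3 A4 A5 A6 B1 B2 B3 !subrr; ring.
Qed.

Lemma comm_row m (a1 a2 b1 b2 c1 c2 d1 d2 : K) (v0 v1 v2 v3 : 'rV[K]_m) :
  b1 * c1 = b1 * a2 -> b2 * c2 = b2 * a1 -> b1 * d1 = b2 * d2 ->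
  a1 *: (a2 *: v0 + b2 *: v2) + b1 *: (c1 *: v1 + d1 *: v3) =
  a2 *: (a1 *: v0 + b1 *: v1) + b2 *: (c2 *: v2 + d2 *: v3).
Proof. by move=> e1 e2 e3; apply/rowP => j; rewrite !mxE; apply: comm_vec. Qed.

Lemma braid_row m (a c b d s g k f1 f2 p1 p2 p3 p4 p5 p6 m1 m2 m3 m4 m5 m6 : K)
    (v0 v1 v2 v3 v4 v5 : 'rV[K]_m) :
  a ^+ 2 * c + f1 * s = c ^+ 2 * a + f2 * s ->
  a * c + s * g = c * s -> a * s = c * a + s * k ->
  b * p1 = b * s -> b * p2 = b * g -> d * p3 = d * s -> d * p4 = d * k ->
  b * m2 * p5 = b * m2 * c -> d * m3 * p6 = d * m3 * a ->
  b * m1 = f1 -> d * m4 = f2 -> b * m2 * m5 = d * m3 * m6 ->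
  a *: (c *: (a *: v0 + b *: v1) + d *: (p3 *: v2 + m3 *: v4)) +
    b *: (p1 *: (p2 *: v1 + m1 *: v0) + m2 *: (p5 *: v3 + m5 *: v5)) =
  c *: (a *: (c *: v0 + d *: v2) + b *: (p1 *: v1 + m2 *: v3)) +
    d *: (p3 *: (p4 *: v2 + m4 *: v0) + m3 *: (p6 *: v4 + m6 *: v5)).
Proof.
move=> C0 C1 C2 A1 A2 A3 A4 A5 A6 B1 B2 B3; apply/rowP => j; rewrite !mxE.
exact: (braid_vec _ _ _ _ _ _ C0 C1 C2 A1 A2 A3 A4 A5 A6 B1 B2 B3).
Qed.
End SeminormalCoefficients.

(* The basis and the generators are locked: conversion of concrete matrices over F explodes. *)
Fact bv_key : unit. Proof. exact: tt. Qed.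

Section PermBasis.
Variable n : nat.
Implicit Types (u v w : 'S_n).

(** Indexing by all permutations gives every shape the same matrix algebra; the predecessor matches
    the successor in the type [MF]. *)
Definition pdim := #|{: 'S_n}|.-1.

Lemma pdimE : #|{: 'S_n}| = pdim.+1.
Proof. by rewrite prednK //; apply/card_gt0P; exists 1%g. Qed.

Definition pix u : 'I_pdim.+1 := cast_ord pdimE (enum_rank u).
Definition unpix (i : 'I_pdim.+1) : 'S_n := enum_val (cast_ord (esym pdimE) i).

Lemma pixK : cancel pix unpix.
Proof. by move=> u; rewrite /pix /unpix cast_ordK enum_rankK. Qed.

Lemma unpixK : cancel unpix pix.
Proof. by move=> i; rewrite /pix /unpix enum_valK cast_ordKV. Qed.

Definition bv u : 'rV[F]_pdim.+1 := locked_with bv_key (delta_mx 0 (pix u)).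

Lemma bvE u v : bv u 0 (pix v) = (v == u)%:R.
Proof. by rewrite /bv unlock mxE eqxx /= (can_eq pixK). Qed.

Lemma eq_rows (A B : 'M[F]_pdim.+1) : (forall u, bv u *m A = bv u *m B) -> A = B.
Proof.
move=> E; apply/row_matrixP => i.
by have := E (unpix i); rewrite /bv unlock -!matrix.rowE unpixK.
Qed.

Lemma rv_sum (x : 'rV[F]_pdim.+1) : x = \sum_u x 0 (pix u) *: bv u.
Proof.
rewrite {1}[x]row_sum_delta (reindex pix) //.
  by apply: eq_bigr => u _; rewrite /bv unlock.
by exists unpix => i _; [apply: pixK | apply: unpixK].
Qed.

Definition mk (g : 'S_n -> 'rV[F]_pdim.+1) : 'M[F]_pdim.+1 := \matrix_(i < pdim.+1) g (unpix i).

Lemma bv_mk u g : bv u *m mk g = g u.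
Proof. by rewrite /bv unlock -matrix.rowE rowK pixK. Qed.

Implicit Types (x : 'rV[F]_pdim.+1) (A B : MF pdim).

Lemma rowM x A B : x *m (A * B : MF pdim) = x *m A *m B.
Proof. exact: mulmxA. Qed.

Lemma rowD x A B : x *m (A + B : MF pdim) = x *m A + x *m B.
Proof. exact: mulmxDr. Qed.

Lemma rowN x A : x *m (- A : MF pdim) = - (x *m A).
Proof. exact: mulmxN. Qed.

Lemma row1 x : x *m (1 : MF pdim) = x.
Proof. exact: mulmx1. Qed.

Lemma row0 x : x *m (0 : MF pdim) = 0.
Proof. exact: mulmx0. Qed.

Lemma rowZ x c A : x *m (c *: A : MF pdim) = Oval c *: (x *m A).
Proof. by rewrite mfscaleE -scalemxAr. Qed.

Definition rowE := (rowM, rowD, rowN, row1, row0, rowZ).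

Lemma rowZl (a : F) x A : (a *: x) *m A = a *: (x *m A).
Proof. by rewrite -scalemxAl. Qed.

Lemma rowDl x y A : (x + y) *m A = x *m A + y *m A.
Proof. exact: mulmxDl. Qed.
End PermBasis.

Lemma swp_rSS (r : nat) : swp r r.+2 = r.+2.
Proof. by case_swp. Qed.

Lemma swp_Sr (r : nat) : swp r.+1 r = r.
Proof. by case_swp. Qed.

Section Seminormal.
Variables (ell n : nat) (kappa : 'I_ell -> int).
Hypothesis Hkappa : forall l : 'I_ell, (l.+1 < ell)%N -> n%:Z < kappa l - kap kappa l.+1.
Variable lam : mpart ell.
Hypothesis Hlam : is_mpart n lam.
Implicit Types (l : 'I_ell) (r c i j k : nat) (u v w : 'S_n).

Local Notation pc := (pcont n kappa lam).
Local Notation Std := (Std n lam).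
Local Notation q := tF.

(* All of 'S_n is used as a basis: on a nonstandard u, T_r acts by t and L_k by [kappa_0 + k],
   which is a copy of a one-dimensional representation. *)
Definition econt u k : int := if u \in Std then pc (pnat u^-1%g k) else kap kappa 0 + k%:Z.
Definition X u k : F := q ^ econt u k.
Definition sdiag u r : F := sna q (X u r) (X u r.+1).
(* the asymmetric normalisation, 1 when the tableau moves away from t^lam, makes the transition
   to the Murphy basis unitriangular *)
Definition hp (i j : nat) : F := if (i < j)%N then 1 else
  snf q (q ^ pc i) (q ^ pc j).
Definition soff u r : F := if (u \in Std) && ((u * sr n r)%g \in Std)
  then hp (pnat u^-1%g r) (pnat u^-1%g r.+1) else 0.

Definition Tm r : MF (pdim n) :=
  locked_with bv_key (mk (fun u => sdiag u r *: bv u + soff u r *: bv (u * sr n r)%g)).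
Definition Lm k : MF (pdim n) := locked_with bv_key (mk (fun u => qn (econt u k) *: bv u)).

Lemma bvT u r : bv u *m Tm r = sdiag u r *: bv u + soff u r *: bv (u * sr n r)%g.
Proof. by rewrite /Tm unlock bv_mk. Qed.

Lemma bvL u k : bv u *m Lm k = qn (econt u k) *: bv u.
Proof. by rewrite /Lm unlock bv_mk. Qed.

Lemma qX_inj (i j : int) : i <> j -> q ^ j - q ^ i != 0.
Proof. by move=> neq; rewrite subr_eq0; apply/eqP => /tFX_inj E; apply: neq. Qed.

Lemma X_neqS u r : (r.+1 < n)%N -> X u r.+1 - X u r != 0.
Proof.
move=> lt_r; apply: qX_inj; rewrite /econt; case: ifP => Hu; last by lia.
by apply: (pcont_neq Hkappa Hlam Hu); lia.
Qed.

Lemma X_neqSS u r : (r.+2 < n)%N -> X u r.+2 - X u r != 0.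
Proof.
move=> lt_r; apply: qX_inj; rewrite /econt; case: ifP => Hu; last by lia.
by apply: (pcont_neq Hkappa Hlam Hu); lia.
Qed.

Lemma ct_sr u r k : (r.+1 < n)%N -> u \in Std -> (u * sr n r)%g \in Std ->
  econt (u * sr n r)%g k = econt u (swp r k).
Proof. by move=> lt_r Hu Hu'; rewrite /econt Hu Hu' invMg srV // pnat_srl. Qed.

Lemma X_sr u r k : (r.+1 < n)%N -> u \in Std -> (u * sr n r)%g \in Std ->
  X (u * sr n r)%g k = X u (swp r k).
Proof. by move=> *; rewrite /X ct_sr. Qed.

Lemma sb_Std u r : soff u r != 0 -> u \in Std /\ (u * sr n r)%g \in Std.
Proof. by rewrite /soff; case: ifP; rewrite ?eqxx // => /andP[]. Qed.

Lemma hpC i j : i != j -> hp i j * hp j i = snf q (q ^ pc i) (q ^ pc j).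
Proof. by rewrite /hp; case: ltngtP => // _ _; rewrite ?mul1r ?mulr1 // snfC. Qed.

(** If the swapped tableau is not standard the left side is 0, and so is [snf], because the two
    contents then differ by one. *)
Lemma sbb u r : (r.+1 < n)%N -> u \in Std ->
  soff u r * soff (u * sr n r)%g r = snf q (X u r) (X u r.+1).
Proof.
move=> lt_r Hu; rewrite /soff srKr // Hu /X /econt Hu.
have [Hu' | nHu'] := boolP (_ \in Std); rewrite /=.
  rewrite invMg srV // !pnat_srl // swpl swpr hpC //.
  by apply/eqP => /pnat_inj; lia.
rewrite mul0r; have [->|->] := nStd_content kappa Hlam Hu lt_r nHu'.
  by rewrite expfzDr ?tF_neq0 // expr1z snf_succ.
set k := pc _; have -> : q ^ k = q ^ (k - 1) * q.
  by rewrite -[X in _ * X]expr1z -expfzDr ?tF_neq0 // subrK.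
by rewrite snf_pred.
Qed.

Lemma nStd_sb u r : u \notin Std -> soff u r = 0.
Proof. by rewrite /soff => /negbTE ->. Qed.

Lemma nStd_sb2 u r : (u * sr n r)%g \notin Std -> soff u r = 0.
Proof. by rewrite /soff => /negbTE ->; rewrite andbF. Qed.

Lemma nStd_sa u r : u \notin Std -> sdiag u r = q.
Proof.
move=> nHu; rewrite /sdiag /X /econt (negbTE nHu).
have -> : kap kappa 0 + r.+1%:Z = kap kappa 0 + r%:Z + 1 by lia.
rewrite [q ^ (_ + 1)]expfzDr ?tF_neq0 // expr1z.
exact: (sna_succ (expfz_neq0 _ tF_neq0) tF_neq1).
Qed.

Lemma sab1 u r : (r.+1 < n)%N ->
  sdiag u r ^+ 2 + soff u r * soff (u * sr n r)%g r = (q - 1) * sdiag u r + q.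
Proof.
move=> lt_r; have [Hu | nHu] := boolP (u \in Std).
  by rewrite sbb // snf_quad // X_neqS.
by rewrite nStd_sb // nStd_sa // mul0r addr0; ring.
Qed.

Lemma sab2 u r : (r.+1 < n)%N ->
  soff u r * (sdiag u r + sdiag (u * sr n r)%g r) = (q - 1) * soff u r.
Proof.
move=> lt_r; have [-> | nz] := eqVneq (soff u r) 0; first by rewrite mul0r mulr0.
have [Hu Hu'] := sb_Std nz; have neq := X_neqS u lt_r.
by rewrite /sdiag !X_sr // swpl swpr sna_trace // mulrC.
Qed.

Lemma Tm_quad r : (r.+1 < n)%N -> (Tm r + 1) * (Tm r - t%:A) = 0.
Proof.
move=> lt_r; apply: eq_rows => u; rewrite !rowE Oval_t bvT !rowDl !rowZl !bvT srKr //.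
move: (bv u) (bv (u * sr n r)%g) => v0 v1; apply/rowP => j; rewrite !mxE.
exact: quad_vec (sab1 u lt_r) (sab2 u lt_r).
Qed.

Lemma LmC r s : Lm r * Lm s = Lm s * Lm r.
Proof.
by apply: eq_rows => u; rewrite !rowE !bvL !rowZl !bvL !scalerA mulrC.
Qed.

Lemma TmLm r s : (r.+1 < n)%N -> s <> r -> s <> r.+1 -> Tm r * Lm s = Lm s * Tm r.
Proof.
move=> lt_r n1 n2; apply: eq_rows => u; rewrite !rowE bvL bvT.
rewrite rowDl !rowZl !bvL bvT scalerDr !scalerA; congr (_ + _); first by rewrite mulrC.
have [-> | nz] := eqVneq (soff u r) 0; first by rewrite mul0r mulr0 !scale0r.
have [Hu Hu'] := sb_Std nz; rewrite ct_sr // mulrC; congr (_ *: _); congr (qn (econt _ _) * _).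
by rewrite /swp; move/eqP/negbTE: n1 => ->; move/eqP/negbTE: n2 => ->.
Qed.

Lemma LmTm r : (r.+1 < n)%N -> Lm r.+1 * (Tm r - t%:A + 1) = Tm r * Lm r + 1.
Proof.
move=> lt_r; apply: eq_rows => u; rewrite !rowE Oval_t bvL bvT !rowDl !rowZl !bvL bvT.
have e : soff u r * qn (econt (u * sr n r)%g r) = soff u r * qn (econt u r.+1).
  have [-> | nz] := eqVneq (soff u r) 0; first by rewrite !mul0r.
  by have [Hu Hu'] := sb_Std nz; rewrite ct_sr // swpl.
have neq := X_neqS u lt_r; have nq := tF_neq1.
have e' : qn (econt u r.+1) * (sdiag u r - q + 1) = sdiag u r * qn (econt u r) + 1.
  exact: (sna_LT neq nq).
move: e e'; move: (sdiag u r) (soff u r) (qn (econt u r)) (qn (econt u r.+1)) => a b Q Y.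
move: (qn (econt _ r)) (bv u) (bv (u * sr n r)%g) => Y' v0 v1 e e'.
apply/rowP => j; rewrite !mxE; move: (v0 0 j) (v1 0 j) => x z.
apply/eqP; rewrite -subr_eq0; apply/eqP.
transitivity ((Y * (a - q + 1) - (a * Q + 1)) * x - (b * Y' - b * Y) * z); first by ring.
by rewrite e e' !subrr !mul0r subr0.
Qed.

Lemma Lm_cyc : (0 < ell)%N -> (0 < n)%N -> \prod_(l < ell) (Lm 0 - (qint (kappa l))%:A) = 0.
Proof.
move=> ell0 n0; apply: eq_rows => u.
have [l0 E] : exists l0, econt u 0 = kappa l0.
  rewrite /econt; case: ifP => [Hu | _]; first exact: (Std_first kappa Hlam n0 Hu).
  by exists (Ordinal ell0); rewrite addr0 (kapE kappa (Ordinal ell0)).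
have main (s : seq 'I_ell) : bv u *m (\prod_(l <- s) (Lm 0 - (qint (kappa l))%:A) : MF _) =
    (\prod_(l <- s) (qn (econt u 0) - qn (kappa l))) *: bv u.
  elim: s => [|l s IHs]; first by rewrite !big_nil row1 scale1r.
  rewrite !big_cons !rowE bvL Oval_qint -scalerBl rowZl IHs scalerA //.
rewrite row0 main (bigD1_seq l0) ?mem_index_enum ?index_enum_uniq //= E subrr mul0r scale0r //.
Qed.

Lemma TmC r s : (r.+1 < n)%N -> (s.+1 < n)%N -> (r.+1 < s)%N -> Tm r * Tm s = Tm s * Tm r.
Proof.
move=> lr ls far; apply: eq_rows => u; rewrite !rowE !bvT !rowDl !rowZl !bvT.
have scom := sr_comm lr ls (or_introl far).
have swpi i : (i = r \/ i = r.+1) -> swp s i = i.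
  by move=> H; case: (swpP s i); lia.
have swpj i : (i = s \/ i = s.+1) -> swp r i = i.
  by move=> H; case: (swpP r i); lia.
have sa1 : soff u r * sdiag (u * sr n r)%g s = soff u r * sdiag u s.
  have [-> | nz] := eqVneq (soff u r) 0; first by rewrite !mul0r.
  by have [Hu Hu'] := sb_Std nz; rewrite /sdiag !X_sr // !swpj; auto.
have sa2 : soff u s * sdiag (u * sr n s)%g r = soff u s * sdiag u r.
  have [-> | nz] := eqVneq (soff u s) 0; first by rewrite !mul0r.
  by have [Hu Hu'] := sb_Std nz; rewrite /sdiag !X_sr // !swpi; auto.
have sbb' : soff u r * soff (u * sr n r)%g s = soff u s * soff (u * sr n s)%g r.
  set w := (u * (sr n s * sr n r))%g.
  have Ew1 : (u * sr n r * sr n s)%g = w by rewrite -mulgA scom.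
  have Ew2 : (u * sr n s * sr n r)%g = w by rewrite -mulgA.
  have [Hu | nHu] := boolP (u \in Std); last by rewrite !(nStd_sb _ nHu) !mul0r.
  have [Hw | nHw] := boolP (w \in Std); last first.
    by rewrite (@nStd_sb2 (u * sr n r)%g s) ?(@nStd_sb2 (u * sr n s)%g r) ?mulr0 ?Ew1 ?Ew2.
  (* If the first swap failed to be standard, its two nodes would have the same order in u and in w,
     whereas w reverses them. *)
  have Hr : (u * sr n r)%g \in Std.
    apply/negPn/negP => nstd; have := nStd_order Hlam Hu lr nstd Hw.
    by rewrite -Ew2 !pnatM !pnatKV !pnat_sr // !swpi ?swpl ?swpr; auto; lia.
  have Hs : (u * sr n s)%g \in Std.
    apply/negPn/negP => nstd; have := nStd_order Hlam Hu ls nstd Hw.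
    by rewrite -Ew1 !pnatM !pnatKV !pnat_sr // !swpj ?swpl ?swpr; auto; lia.
  rewrite /soff Ew1 Ew2 Hu Hw Hr Hs /= !invMg !srV // !pnat_srl // !swpi ?swpj; auto.
  by rewrite mulrC.
rewrite -!mulgA scom; move: sa1 sa2 sbb'.
move: (bv u) (bv (u * sr n r)%g) (bv (u * sr n s)%g) (bv _) => v0 v1 v2 v3.
move=> e1 e2 e3; exact: comm_row.
Qed.

(* Both triple products move the entries of the three nodes through the same inversions,
   so the off-diagonal coefficients agree by [hp] depending on the two nodes only. *)
Lemma Tm_braid r : (r.+2 < n)%N -> Tm r * Tm r.+1 * Tm r = Tm r.+1 * Tm r * Tm r.+1.
Proof.
move=> lr2; have lr := ltnW lr2; apply: eq_rows => u; rewrite !rowM.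
rewrite !bvT !rowDl !rowZl !bvT !rowDl !rowZl !bvT (srKr u lr) (srKr u lr2).
have sbr : (u * sr n r.+1 * sr n r * sr n r.+1)%g = (u * sr n r * sr n r.+1 * sr n r)%g.
  by rewrite -!mulgA ![(sr n _ * (sr n _ * _))%g]mulgA sr_braid.
rewrite sbr; set u1 := (u * sr n r)%g; set u2 := (u * sr n r.+1)%g.
set u12 := (u1 * _)%g; set u21 := (u2 * _)%g; set w := (u12 * _)%g.
have Ew : (u21 * sr n r.+1)%g = w by [].
have [Hu | nHu] := boolP (u \in Std); last first.
  rewrite !(nStd_sb _ nHu) !(nStd_sa _ nHu) !scale0r !addr0; congr (_ *: _).
set x := X u r; set y := X u r.+1; set z := X u r.+2.
have n1 : y - x != 0 by apply: X_neqS.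
have n2 : z - y != 0 by apply: X_neqS.
have n3 : z - x != 0 by apply: X_neqSS.
have Hu1 : soff u r != 0 -> u1 \in Std by move=> /sb_Std[].
have Hu2 : soff u r.+1 != 0 -> u2 \in Std by move=> /sb_Std[].
have nzE (b c d : F) : (b != 0 -> c = d) -> b * c = b * d.
  by have [-> | nz H] := eqVneq b 0; [rewrite !mul0r | rewrite H].
have sw1 := swp_rSS r; have sw2 := swp_Sr r.
have A1 : soff u r * sdiag u1 r.+1 = soff u r * sna q x z.
  by apply: (nzE _ _ _) => /Hu1 H; rewrite /sdiag !X_sr // swpr sw1.
have A2 : soff u r * sdiag u1 r = soff u r * sna q y x.
  by apply: (nzE _ _ _) => /Hu1 H; rewrite /sdiag !X_sr // swpl swpr.
have A3 : soff u r.+1 * sdiag u2 r = soff u r.+1 * sna q x z.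
  by apply: (nzE _ _ _) => /Hu2 H; rewrite /sdiag !X_sr // swpl sw2.
have A4 : soff u r.+1 * sdiag u2 r.+1 = soff u r.+1 * sna q z y.
  by apply: (nzE _ _ _) => /Hu2 H; rewrite /sdiag !X_sr // swpl swpr.
have A5 : soff u r * soff u1 r.+1 * sdiag u12 r = soff u r * soff u1 r.+1 * sna q y z.
  rewrite -!mulrA; apply: (nzE _ _ _) => /Hu1 H; apply: (nzE _ _ _) => /sb_Std[_ H12].
  by rewrite /sdiag !X_sr // sw2 !swpl sw1.
have A6 : soff u r.+1 * soff u2 r * sdiag u21 r.+1 = soff u r.+1 * soff u2 r * sna q x y.
  rewrite -!mulrA; apply: (nzE _ _ _) => /Hu2 H; apply: (nzE _ _ _) => /sb_Std[_ H21].
  by rewrite /sdiag !X_sr // sw1 !swpr sw2.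
have B1 : soff u r * soff u1 r = snf q x y by apply: sbb.
have B2 : soff u r.+1 * soff u2 r.+1 = snf q y z by apply: sbb.
have B3 : soff u r * soff u1 r.+1 * soff u12 r = soff u r.+1 * soff u2 r * soff u21 r.+1.
  have [Hw | nHw] := boolP (w \in Std); last by rewrite [soff u12 r]nStd_sb2 ?[soff u21 _]nStd_sb2 ?mulr0 ?Ew.
  have H1 : u1 \in Std.
    apply/negPn/negP => nstd; have := nStd_order Hlam Hu lr nstd Hw.
    by rewrite !pnatM !pnatKV !pnat_sr // !(swpl, swpr, sw1, sw2) ltnNge leqnSn.
  have H2 : u2 \in Std.
    apply/negPn/negP => nstd; have := nStd_order Hlam Hu lr2 nstd Hw.
    by rewrite -Ew !pnatM !pnatKV !pnat_sr // !(swpl, swpr, sw1, sw2) ltnNge leqnSn.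
  have H12 : u12 \in Std.
    apply/negPn/negP => nstd; have := nStd_order Hlam H1 lr2 nstd Hw.
    by rewrite !(pnatM u12) !(pnatM u1) !pnatKV !pnat_sr // !(swpl, swpr, sw1, sw2) ltnNge (leqW (leqnSn r)).
  have H21 : u21 \in Std.
    apply/negPn/negP => nstd; have := nStd_order Hlam H2 lr nstd Hw.
    by rewrite -Ew !(pnatM u21) !(pnatM u2) !pnatKV !pnat_sr // !(swpl, swpr, sw1, sw2) ltnNge (leqW (leqnSn r)).
  rewrite /soff H1 H2 H12 H21 Ew Hw Hu /= !invMg !srV // !pnat_srl //.
  rewrite !(swpl, swpr, sw1, sw2).
  by rewrite mulrC -[RHS]mulrA; congr (_ * _); apply: mulrC.
exact: (braid_row _ _ _ _ _ _ (braid0 q n1 n2 n3) (braid1 q n1 n2 n3) (braid2 q n1 n2 n3)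
  A1 A2 A3 A4 A5 A6 B1 B2 B3).
Qed.

Lemma seminormal_rel : (0 < ell)%N -> hecke_rel n kappa Lm Tm.
Proof.
move=> ell0; split; first exact: Lm_cyc.
split; first exact: Tm_quad.
split; first by move=> *; apply: LmC.
split; first by move=> r s lr ls [far|far]; [apply: TmC | apply/esym/TmC].
split; first exact: Tm_braid.
split; first by move=> r s lr ls n1 n2; apply: TmLm.
exact: LmTm.
Qed.
End Seminormal.

(** * Vanishing of m_mu outside the dominance order *)

Section Coordinates.
Variable n : nat.
Implicit Types (x y : 'rV[F]_(pdim n).+1) (u v : 'S_n).

Definition co x u : F := x 0 (pix u).

Lemma co_bv u v : co (bv u) v = (v == u)%:R.
Proof. exact: bvE. Qed.

Lemma coD x y u : co (x + y) u = co x u + co y u.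
Proof. by rewrite /co mxE. Qed.

Lemma coZ a x u : co (a *: x) u = a * co x u.
Proof. by rewrite /co mxE. Qed.

Lemma co_sum (I : Type) (s : seq I) (P : pred I) (f : I -> 'rV[F]_(pdim n).+1) u :
  co (\sum_(i <- s | P i) f i) u = \sum_(i <- s | P i) co (f i) u.
Proof. by rewrite /co summxE. Qed.

Lemma co_exp x : x = \sum_u co x u *: bv u.
Proof. exact: rv_sum. Qed.

Lemma co_ext x y : (forall u, co x u = co y u) -> x = y.
Proof. by move=> E; rewrite [x]co_exp [y]co_exp; apply: eq_bigr => u _; rewrite E. Qed.

Lemma co_neq0 x : x != 0 -> exists u, co x u != 0.
Proof.
move=> nz; apply: contrapT => none; case/eqP: nz; apply: co_ext => u.
rewrite [RHS]mxE; apply/eqP/negPn/negP => nzu; apply: none; by exists u.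
Qed.
End Coordinates.

Section Support.
Variables (ell n : nat) (kappa : 'I_ell -> int).
Hypothesis Hkappa : forall l : 'I_ell, (l.+1 < ell)%N -> n%:Z < kappa l - kap kappa l.+1.
Variable lam : mpart ell.
Hypothesis Hlam : is_mpart n lam.
Implicit Types (l : 'I_ell) (r c i j k : nat) (u v w s : 'S_n) (x y : 'rV[F]_(pdim n).+1).

Local Notation pc := (pcont n kappa lam).
Local Notation Std := (Std n lam).
Local Notation q := tF.
Local Notation ct := (econt kappa lam).
Local Notation sa := (sdiag kappa lam).
Local Notation sb := (soff kappa lam).
Local Notation Tm := (Tm n kappa lam).
Local Notation Lm := (Lm n kappa lam).

(* comparable nodes are ordered in the same way by all standard tableaux *)
Lemma Std_swap_content u r : u \in Std -> (r.+1 < n)%N -> (u * sr n r)%g \in Std ->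
  pc (pnat u^-1%g r.+1) <> pc (pnat u^-1%g r) + 1 /\
  pc (pnat u^-1%g r.+1) <> pc (pnat u^-1%g r) - 1.
Proof.
move=> Hu lr Hu'; have lr' := ltnW lr.
have [l [i [c [Hin Ei]]]] := node_ex Hlam (pnat_lt u^-1%g lr').
have [l' [i' [c' [Hin' Ej]]]] := node_ex Hlam (pnat_lt u^-1%g lr).
rewrite -Ei -Ej.
have u1 : pnat u (tlam lam l i c) = r by rewrite Ei pnatKV.
have u2 : pnat u (tlam lam l' i' c') = r.+1 by rewrite Ej pnatKV.
have v1 : pnat (u * sr n r)%g (tlam lam l i c) = r.+1 by rewrite pnatM u1 pnat_sr // swpl.
have v2 : pnat (u * sr n r)%g (tlam lam l' i' c') = r by rewrite pnatM u2 pnat_sr // swpr.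
case: (ltngtP l l') => [ltl|ltl|/val_inj El].
- by have := pcont_gap Hkappa Hlam Hin Hin' ltl; lia.
- by have := pcont_gap Hkappa Hlam Hin' Hin ltl; lia.
subst l'; rewrite !pcontE //.
have nle : ~ (i <= i' /\ c <= c')%N.
  move=> [le1 le2]; have := @Std_le _ _ _ Hlam _ l i c (i' - i) (c' - c) Hu'.
  by rewrite !subnKC // v1 v2 => /(_ Hin'); lia.
have nge : ~ (i' <= i /\ c' <= c)%N.
  move=> [le1 le2]; have := @Std_le _ _ _ Hlam _ l i' c' (i - i') (c - c') Hu.
  by rewrite !subnKC // u1 u2 => /(_ Hin); lia.
split=> E; lia.
Qed.

Lemma sna_eq_q (x y : F) : y - x != 0 -> sna q x y = q -> y = x * q.
Proof.
move=> neq; rewrite /sna => /(canRL (mulfVK neq)) E.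
apply/eqP; rewrite -subr_eq0; apply/eqP.
transitivity (- ((q - 1) * y - q * (y - x))); first by ring.
by rewrite E subrr oppr0.
Qed.

Lemma sa_neq_q u r : u \in Std -> (r.+1 < n)%N -> (u * sr n r)%g \in Std -> sa u r != q.
Proof.
move=> Hu lr Hu'; apply/eqP => /(sna_eq_q (X_neqS Hkappa Hlam u lr)).
rewrite /X /econt Hu -[X in _ * X]expr1z -expfzDr ?tF_neq0 // => /tFX_inj.
by case: (Std_swap_content Hu lr Hu').
Qed.

Lemma co_T x r v : (r.+1 < n)%N ->
  co (x *m Tm r) v = co x v * sa v r + co x (v * sr n r)%g * sb (v * sr n r)%g r.
Proof.
move=> lr; rewrite {1}[x]co_exp mulmx_suml co_sum.
rewrite (eq_bigr (fun u => co x u * (sa u r * (v == u)%:R + sb u r * (v == u * sr n r)%g%:R))) => [|u _].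
  under eq_bigr do rewrite mulrDr; rewrite big_split /=; congr (_ + _).
    rewrite (bigD1 v) //= eqxx mulr1 big1 ?addr0 // => u neq.
    by rewrite eq_sym (negbTE neq) !mulr0.
  rewrite (bigD1 (v * sr n r)%g) //= srKr // eqxx mulr1 big1 ?addr0 // => u neq.
  case: eqP => [E|_]; last by rewrite !mulr0.
  by rewrite E srKr // eqxx in neq.
by rewrite rowZl bvT coZ coD !coZ !co_bv.
Qed.

(* Let y be an eigenvector for the T_r in the row stabiliser of t^mu whose support avoids the
   contents excluded by u_mu, and s a longest tableau in this support.  Consecutive entries
   of a row of t^mu then move, in t^lam s, strictly to the right or to an earlier component,
   and no entry of component l of t^mu lies in a later component of t^lam s; this forces
   lam to dominate mu. *)
Section Dominance.
Variables (mu : mpart ell) (y : 'rV[F]_(pdim n).+1).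
Hypothesis Hmu : is_mpart n mu.
Hypothesis Hsup : forall u, co y u != 0 -> u \in Std.
Hypothesis HyT : forall r, (r.+1 < n)%N -> rowcol n mu r = rowcol n mu r.+1 ->
  y *m Tm r = q *: y.
Hypothesis HyL : forall u (l r : nat), co y u != 0 -> (l.+1 < ell)%N ->
  (r < \sum_(k < ell | (k <= l)%N) sumn (mu k))%N -> ct u r <> kap kappa l.+1.
Variable s : 'S_n.
Hypothesis Hs : co y s != 0.
Hypothesis max_s : forall u, co y u != 0 -> (ninv u <= ninv s)%N.

Let Hstd : s \in Std := Hsup Hs.

Lemma supp_step r : (r.+1 < n)%N -> rowcol n mu r = rowcol n mu r.+1 ->
  exists l i c l' i' c', [/\ inmp lam l i c, inmp lam l' i' c',
    tlam lam l i c = pnat s^-1%g r, tlam lam l' i' c' = pnat s^-1%g r.+1 &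
    (l' < l)%N \/ [/\ l' = l, (i' <= i)%N & (c < c')%N]].
Proof.
move=> lr E; have lr' := ltnW lr.
have [l [i [c [Hin Ei]]]] := node_ex Hlam (pnat_lt s^-1%g lr').
have [l' [i' [c' [Hin' Ej]]]] := node_ex Hlam (pnat_lt s^-1%g lr).
exists l, i, c, l', i', c'; split=> //.
have u1 : pnat s (tlam lam l i c) = r by rewrite Ei pnatKV.
have u2 : pnat s (tlam lam l' i' c') = r.+1 by rewrite Ej pnatKV.
have eigen : co y s * sa s r + co y (s * sr n r)%g * sb (s * sr n r)%g r = q * co y s.
  by rewrite -co_T // HyT // coZ.
case: (ltngtP (pnat s^-1%g r) (pnat s^-1%g r.+1)) => [lt|lt|/pnat_inj]; last by lia.
  (* Here s s_r is longer than s. If it is standard, maximality of s removes its coordinate and the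
     diagonal coefficient must be t, which [sa_neq_q] excludes; if not, the entries are neighbours,
     and t as diagonal coefficient means that the content rises, so they share a row. *)
  have [Hs' | nHs'] := boolP ((s * sr n r)%g \in Std).
    have z : co y (s * sr n r)%g = 0.
      apply/eqP/negPn/negP => /max_s; rewrite ninv_ascr //; lia.
    move: eigen; rewrite z mul0r addr0 mulrC => /(mulIf Hs) E'.
    by have := sa_neq_q Hstd lr Hs'; rewrite E' eqxx.
  have [l1 [i1 [c1 [i2 [c2 [H1 H2 E1 E2 adj]]]]]] := nStd_swap Hlam Hstd lr nHs'.
  have [El Er Ec] : [/\ l = l1, i = i1 & c = c1] by apply: (tlam_inj Hin H1); rewrite Ei.
  have [El' Er' Ec'] : [/\ l' = l1, i' = i2 & c' = c2] by apply: (tlam_inj Hin' H2); rewrite Ej.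
  subst; right; case: adj => [[-> ->]//|[E3 E4]]; exfalso.
  move: eigen; rewrite [sb _ _]nStd_sb // mulr0 addr0 mulrC => /(mulIf Hs).
  have neq := X_neqS Hkappa Hlam s lr.
  rewrite /sdiag; move=> /(sna_eq_q neq); rewrite /X /econt Hstd E1 E2 !pcontE //.
  by rewrite -[X in _ * X]expr1z -expfzDr ?tF_neq0 // => /tFX_inj; rewrite E3 E4; lia.
case: (ltngtP l' l) => [ltl|ltl|/val_inj El]; first by left.
  have := @tlam_lt_row _ _ l i c l' i' c' Hin; rewrite ltl /= => /(_ isT).
  by rewrite Ei Ej ltnNge (ltnW lt).
subst l'; right; split=> //.
  rewrite leqNgt; apply/negP => lti.
  have := @tlam_lt_row _ _ l i c l i' c' Hin; rewrite eqxx lti orbT => /(_ isT).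
  by rewrite Ei Ej ltnNge (ltnW lt).
(* Otherwise the node of r+1 would be weakly above and to the left of that of r, against
   standardness. *)
rewrite ltnNge; apply/negP => le_c.
have le_i : (i' <= i)%N.
  rewrite leqNgt; apply/negP => lti.
  have := @tlam_lt_row _ _ l i c l i' c' Hin; rewrite eqxx lti orbT => /(_ isT).
  by rewrite Ei Ej ltnNge (ltnW lt).
have := @Std_le _ _ _ Hlam _ l i' c' (i - i') (c - c') Hstd.
by rewrite !subnKC // u1 u2 => /(_ Hin); clear; lia.
Qed.

Lemma supp_row a b : (a < b < n)%N -> rowcol n mu a = rowcol n mu b ->
  forall l i c l' i' c', inmp lam l i c -> inmp lam l' i' c' ->
    tlam lam l i c = pnat s^-1%g a -> tlam lam l' i' c' = pnat s^-1%g b ->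
    (l' < l)%N \/ [/\ l' = l, (i' <= i)%N & (c < c')%N].
Proof.
elim: b => // b IHb /andP[lt lb] E l i c l' i' c' Hin Hin' Ea Eb.
have mono := colmono_rowcol Hmu.
have m1 : (rowcol n mu a <= rowcol n mu b)%N by apply: mono; lia.
have m2 : (rowcol n mu b <= rowcol n mu b.+1)%N by apply: mono; lia.
have Eb' : rowcol n mu b = rowcol n mu b.+1 by lia.
have [l1 [i1 [c1 [l2 [i2 [c2 [H1 H2 E1 E2 step]]]]]]] := supp_step lb Eb'.
have [El' Er' Ec'] : [/\ l' = l2, i' = i2 & c' = c2] by apply: (tlam_inj Hin' H2); rewrite Eb.
subst l2 i2 c2.
have [Eab | neq] := eqVneq a b.
  subst b; have [El Er Ec] : [/\ l = l1, i = i1 & c = c1] by apply: (tlam_inj Hin H1); rewrite Ea.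
  by subst.
have := IHb ltac:(lia) ltac:(lia) l i c l1 i1 c1 Hin H1 Ea E1.
case: step => [lt1|[El1 le1 lt1]] [lt2|[El2 le2 lt2]].
- by left; apply: ltn_trans lt1 lt2.
- by left; rewrite -El2.
- by left; rewrite El1.
- by right; rewrite El1 El2; split=> //; lia.
Qed.

(** If the entry were in a later component l', the first node of l' would hold an entry at most as
    large, with content kappa_{l'}: exactly what the factor of u_mu belonging to kappa_{l'}
    excludes. *)
Lemma supp_comp l i c l' i' c' : inmp mu l i c -> inmp lam l' i' c' ->
  tlam lam l' i' c' = pnat s^-1%g (tlam mu l i c) -> (l' <= l)%N.
Proof.
move=> Hin Hin' E; rewrite leqNgt; apply/negP => lt.
have lt_l' : (l'.-1.+1 < ell)%N by rewrite prednK // (leq_ltn_trans _ lt).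
have H0 : inmp lam l' 0 0 by apply: (inmp_up Hlam _ (inmp_left Hlam _ Hin')).
have sE : pnat s (tlam lam l' i' c') = tlam mu l i c by rewrite E pnatKV.
have le0 : (pnat s (tlam lam l' 0 0) <= tlam mu l i c)%N.
  have := @Std_le _ _ _ Hlam _ l' 0 0 i' c' Hstd; rewrite !add0n sE => /(_ Hin').
  by clear; lia.
have := @HyL s l'.-1 (pnat s (tlam lam l' 0 0)) Hs lt_l'.
rewrite prednK ?(leq_ltn_trans _ lt) //; apply.
  apply: leq_ltn_trans le0 _.
  have := inmp_sumn Hin; rewrite tlamE => lt1.
  have lt2 : (pre mu l + sumn (mu l) <= \sum_(k < ell | (k <= l'.-1)%N) sumn (mu k))%N.
    rewrite /pre [X in (_ <= X)%N](bigD1 l) /=; last by move: lt; clear; lia.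
    rewrite addnC leq_add2l [X in (_ <= X)%N](bigID (fun k : 'I_ell => (k < l)%N)) /=.
    rewrite [X in (X <= _)%N](eq_bigl (fun k : 'I_ell => ((k <= l'.-1)%N && (k != l)) && (k < l)%N)).
      exact: leq_addr.
    by move=> k; rewrite -val_eqE /=; case: ltngtP => //; lia.
  by move: lt1 lt2; clear; lia.
by rewrite /econt Hstd pnatK pcontE // kapE addr0 subr0.
Qed.

(** Moving up the column of [lam]: the entry above is smaller and still in component l of t^mu. It
    lies in a strictly higher row of t^mu, because by [supp_row] two entries of one row of t^mu
    cannot share a column. *)
Lemma supp_rowle i' l i c j c' : inmp mu l i c -> inmp lam l i' c' ->
  tlam lam l i' c' = pnat s^-1%g (tlam mu l i c) -> j = i -> (i' <= j)%N.
Proof.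
elim: i' l i c j c' => // i' IH l i c j c' Hin Hin' E Ej.
have Hup : inmp lam l i' c' by apply: (inmp_up Hlam (leqnSn _) Hin').
have lt_x : (pnat s (tlam lam l i' c') < n)%N by rewrite pnat_lt // (tlam_lt_n Hlam).
have [m [i2 [c2 [Hin2 E2]]]] := node_ex Hmu lt_x.
have E2' : tlam lam l i' c' = pnat s^-1%g (tlam mu m i2 c2) by rewrite E2 pnatK.
have lt_ent : (tlam mu m i2 c2 < tlam mu l i c)%N.
  have := @Std_le _ _ _ Hlam _ l i' c' 1 0 Hstd; rewrite !addn0 addn1 => /(_ Hin').
  by rewrite E E2 pnatKV; clear; lia.
have le_lm : (l <= m)%N := supp_comp Hin2 Hup E2'.
have le_ml : (m <= l)%N.
  rewrite leqNgt; apply/negP => lt; have := @tlam_lt_row _ _ l i c m i2 c2 Hin.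
  by rewrite lt => /(_ isT); rewrite ltnNge (ltnW lt_ent).
have Em : m = l by apply/val_inj/eqP; rewrite eqn_leq le_ml le_lm.
subst m.
have le_i2 : (i2 <= i)%N.
  rewrite leqNgt; apply/negP => lt; have := @tlam_lt_row _ _ l i c l i2 c2 Hin.
  by rewrite lt eqxx orbT => /(_ isT); rewrite ltnNge (ltnW lt_ent).
have := IH l i2 c2 i2 c' Hin2 Hup E2' erefl.
suff : i2 != i by move: le_i2 Ej; clear; lia.
apply/eqP => Ei; subst i2.
have Erow : rowcol n mu (tlam mu l i c2) = rowcol n mu (tlam mu l i c).
  by apply/eqP; rewrite rowcol_eq // !eqxx.
have := supp_row _ Erow Hup Hin' E2' E.
by rewrite lt_ent (tlam_lt_n Hmu) // => /(_ isT) [|[_ _]]; rewrite ltnn.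
Qed.

Lemma supp_pos l i (x : nat) : (x < domsum mu l i)%N -> (x < n)%N ->
  (pnat s^-1%g x < domsum lam l i)%N.
Proof.
move=> lt_x lx; have [m [i1 [c1 [Hin E1]]]] := node_ex Hmu lx.
have [l' [i' [c' [Hin' E']]]] := node_ex Hlam (pnat_lt s^-1%g lx).
have le_m : (m < l)%N || ((m == l) && (i1 <= i)%N).
  apply/negPn/negP => nle; have : (domsum mu l i <= x)%N.
    rewrite -E1 /domsum -/(pre mu l) tlamE; move: nle; rewrite -val_eqE /=.
    case: (ltngtP m l) => //= [lt | /val_inj Em]; last first.
      subst m; rewrite -ltnNge => le2; rewrite -addnA leq_add2l; exact: leq_trans (psum_mono _ le2) (leq_addr _ _).
    move=> _; apply: leq_trans (leq_add (leqnn _) (psum_le_sumn _ _)) _.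
    have le2 : (pre mu l + sumn (mu l) <= pre mu m)%N by apply: preS.
    by apply: (leq_trans le2); rewrite -addnA leq_addr.
  by rewrite leqNgt lt_x.
rewrite -E1 in E'.
have le_l' := supp_comp Hin Hin' E'.
rewrite -E1 -E' /domsum -/(pre lam l) tlamE.
have big1' : (l' < l)%N -> (pre lam l' + \sum_(j < i') nth 0 (lam l') j + c' <
     pre lam l + \sum_(j < i.+1) nth 0 (lam l) j)%N.
  by move=> lt; have := @preS _ lam l' l lt; have := inmp_sumn Hin'; clear; lia.
case/orP: le_m => [lt|/andP[/eqP Em le_i]]; first by apply: big1'; apply: leq_ltn_trans lt.
subst m; move: le_l'; rewrite leq_eqVlt => /orP[/eqP/val_inj El|]; last exact: big1'.
subst l'; have le1 := supp_rowle Hin Hin' E' erefl.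
have := psum_mono (lam l) (leq_trans (leq_ltn_trans le1 (ltnSn i1)) (le_i : (i1.+1 <= i.+1)%N)).
by rewrite psumS; move: Hin'; rewrite /inmp; clear; lia.
Qed.

(** By [supp_pos], s^-1 injects the first [domsum mu l i] positions into the first
    [domsum lam l i]. *)
Lemma supp_dom : dom lam mu.
Proof.
move=> l i; have le_n : (domsum mu l i <= n)%N.
  rewrite -(sum_mp Hmu) /domsum; apply: leq_trans (sum_mp_pre mu l).
  by rewrite leq_add2l psum_le_sumn.
have le_n' : (domsum lam l i <= n)%N.
  rewrite -(sum_mp Hlam) /domsum; apply: leq_trans (sum_mp_pre lam l).
  by rewrite leq_add2l psum_le_sumn.
rewrite -(card_below le_n) -(card_below le_n') -(card_image (@perm_inj _ s^-1%g)).
apply/subset_leq_card/subsetP => z /imageP[x]; rewrite !inE => lt ->.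
by rewrite -pnat_ord; apply: supp_pos.
Qed.
End Dominance.

(** For mu = lam no entry moves to a later row of t^lam. Since the row indices have the same total
    before and after, every row is preserved, so s is a standard element of the row stabiliser. *)
Lemma supp_one (y : 'rV[F]_(pdim n).+1) s : 
  (forall u, co y u != 0 -> u \in Std) ->
  (forall r, (r.+1 < n)%N -> rowcol n lam r = rowcol n lam r.+1 -> y *m Tm r = q *: y) ->
  (forall u (l r : nat), co y u != 0 -> (l.+1 < ell)%N ->
    (r < \sum_(k < ell | (k <= l)%N) sumn (lam k))%N -> ct u r <> kap kappa l.+1) ->
  co y s != 0 -> (forall u, co y u != 0 -> (ninv u <= ninv s)%N) -> s = 1%g.
Proof.
move=> Hsup HyT HyL Hs max_s; have mono := colmono_rowcol Hlam.
have le_row (x : nat) : (x < n)%N -> (rowcol n lam (pnat s^-1%g x) <= rowcol n lam x)%N.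
  move=> lx; have [l [i [c [Hin E]]]] := node_ex Hlam lx.
  have lt : (x < domsum lam l i)%N.
    by rewrite -E tlamE /domsum psumS addnA ltn_add2l.
  have := supp_pos Hlam Hsup HyT HyL Hs max_s lt lx.
  have [l' [i' [c' [Hin' <-]]]] := node_ex Hlam (pnat_lt s^-1%g lx) => lt'.
  rewrite -E; case: (boolP ((l' < l)%N || ((l' == l) && (i' < i)%N))) => [lt_row | nlt].
    by apply: ltnW; apply: rowcol_lt.
  have [/andP[El Ei]|neq] := boolP ((l' == l) && (i' == i)).
    have := rowcol_eq Hlam Hin' Hin.
    by rewrite El Ei => /eqP->.
  have := @tlam_wlex _ lam l i.+1 l' i'.
  suff -> : (l < l')%N || ((l == l') && (i < i')%N).
    move=> /(_ isT) le; move: lt'; rewrite ltnNge => /negP[]; apply: leq_trans (leq_trans _ le) _.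
      by rewrite tlamE addn0.
    by rewrite !tlamE addn0 leq_addr.
  move: nlt neq; rewrite -!val_eqE /=; clear; lia.
have sum_eq : (\sum_(x < n) rowcol n lam (pnat s^-1%g x) = \sum_(x < n) rowcol n lam x)%N.
  rewrite [RHS](reindex_inj (@perm_inj _ s^-1%g)); apply: eq_bigr => x _.
  by rewrite pnat_ord.
have eq_row (x : nat) : (x < n)%N -> rowcol n lam (pnat s^-1%g x) = rowcol n lam x.
  move=> lx; have le (x' : 'I_n) := le_row x' (ltn_ord _).
  have /leqif_sum : forall x' : 'I_n, true -> (rowcol n lam (pnat s^-1%g x') <= rowcol n lam x'
     ?= iff (rowcol n lam (pnat s^-1%g x') == rowcol n lam x'))%N.
    by move=> x' _; split; [exact: le | ].
  by move=> []; rewrite sum_eq eqxx => _ /esym/forallP/(_ (Ordinal lx))/eqP.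
have inS : s \in Spar n (rowcol n lam).
  by rewrite -[s]invgK; apply/SparV/SparP.
have [] // := @par_uniq n (rowcol n lam) s 1%g 1%g s mono inS (Spar1 _ _) _ _ _.
- by apply/incrP => r lr _; rewrite !pnat1.
- exact: (Std_incr Hlam (Hsup _ Hs)).
- by rewrite mulg1 mul1g.
Qed.
End Support.

(** * The action of m_mu on a seminormal representation *)

Section PartialSums.
Variables (ell n : nat) (mu : mpart ell).
Hypothesis Hmu : is_mpart n mu.

Definition asum (l : nat) : nat := (\sum_(k < ell | (k <= l)%N) sumn (mu k))%N.

Lemma asumS (l : 'I_ell) : asum l = (pre mu l + sumn (mu l))%N.
Proof.
rewrite /asum (bigD1 l) //= addnC; congr addn; apply: eq_bigl => k.
by rewrite -val_eqE /= ltn_neqAle andbC.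
Qed.

Lemma asum_le l : (asum l <= n)%N.
Proof.
rewrite -(sum_mp Hmu) /asum [X in (_ <= X)%N](bigID (fun k : 'I_ell => (k <= l)%N)) /=.
exact: leq_addr.
Qed.

Lemma asum_lt (l : 'I_ell) r c m : inmp mu l r c -> (tlam mu l r c < asum m)%N = (l <= m)%N.
Proof.
move=> Hin; apply/idP/idP => [lt | le].
  rewrite leqNgt; apply/negP => lt'; move: lt; rewrite ltnNge => /negP[].
  apply: leq_trans (leq_trans _ (leq_addr _ _)) (leq_addr _ _).
  rewrite /asum /pre [X in (_ <= X)%N](bigID (fun k : 'I_ell => (k <= m)%N)) /=.
  apply: leq_trans (leq_addr _ _); rewrite [X in (_ <= X)%N](eq_bigl (fun k : 'I_ell => (k <= m)%N)) //.
  by move=> k; move: lt'; clear; case: (ltnP m k); lia.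
have := inmp_sumn Hin; have le2 : (asum l <= asum m)%N.
  rewrite /asum [X in (_ <= X)%N](bigID (fun k : 'I_ell => (k <= l)%N)) /=.
  apply: leq_trans (leq_addr _ _); rewrite [X in (_ <= X)%N](eq_bigl (fun k : 'I_ell => (k <= l)%N)) //.
  by move=> k; move: le; clear; case: (leqP k l); lia.
by move: le2; rewrite asumS tlamE; clear; lia.
Qed.

Lemma compat_asum : (0 < ell)%N -> compat (blkcol ell asum) mu.
Proof.
move=> ell0 l r c Hin; have Ha := adm_mp Hmu; rewrite -/asum in Ha.
apply/eqP; rewrite eqn_leq; apply/andP; split.
  have [lt | ge] := ltnP l.+1 ell; first by rewrite (blkcol_le _ Ha) // asum_lt.
  by have := blkcol_lt asum (tlam mu l r c) ell0; move: ge (ltn_ord l); clear; lia.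
case El : (nat_of_ord l) => [//|m]; have lt : (m.+1 < ell)%N by rewrite -El.
by rewrite ltnNge (blkcol_le _ Ha lt) asum_lt // El ltnn.
Qed.

Variables (kappa : 'I_ell -> int) (A : algType O) (L T : nat -> A).
Hypothesis HR : hecke_rel n kappa L T.

Lemma m_mpE : m_mp n kappa L T mu = u_mp kappa L mu * xpar n T (rowcol n mu).
Proof. by rewrite /m_mp x_mpE. Qed.

Lemma u_comm_xpar : (0 < ell)%N ->
  xpar n T (rowcol n mu) * u_mp kappa L mu = u_mp kappa L mu * xpar n T (rowcol n mu).
Proof.
move=> ell0; rewrite u_mpE mulr_suml mulr_sumr; apply: eq_bigr => w Hw.
apply: (ua_comm_Tw HR); first exact: adm_mp.
apply: Spar_refines Hw; first exact: colmono_rowcol.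
by apply: (compat_refines Hmu); apply: compat_asum.
Qed.
End PartialSums.

Lemma ueig_aux (K : fieldType) (a b d e f g : K) : e * f = 1 -> a - b = f * d ->
  e * g * a + -1 * (b * (e * g)) = g * d.
Proof.
move=> e1 e2; transitivity (g * e * (a - b)); first by ring.
by rewrite e2; transitivity (g * d * (e * f)); [ring | rewrite e1 mulr1].
Qed.

Section Action.
Variables (ell n : nat) (kappa : 'I_ell -> int).
Hypothesis ell0 : (0 < ell)%N.
Hypothesis Hkappa : forall l : 'I_ell, (l.+1 < ell)%N -> n%:Z < kappa l - kap kappa l.+1.
Variable lam : mpart ell.
Hypothesis Hlam : is_mpart n lam.
Implicit Types (l : 'I_ell) (r c i j k : nat) (u v w s d : 'S_n) (x y : 'rV[F]_(pdim n).+1).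
Implicit Types (mu : mpart ell).

Local Notation pc := (pcont n kappa lam).
Local Notation Std := (Std n lam).
Local Notation q := tF.
Local Notation ct := (econt kappa lam).
Local Notation sa := (sdiag kappa lam).
Local Notation sb := (soff kappa lam).
Local Notation Tm := (Tm n kappa lam).
Local Notation Lm := (Lm n kappa lam).
Local Notation TT := (Tw Tm).
Local Notation MM := (m_mp n kappa Lm Tm).
Local Notation UU := (u_mp kappa Lm).
Local Notation XX mu := (xpar n Tm (rowcol n mu)).

Let HR : hecke_rel n kappa Lm Tm := seminormal_rel Hkappa Hlam ell0.
Let HT : typeA n Tm := hecke_typeA HR.

Definition std_supp x := forall u, co x u != 0 -> u \in Std.

Lemma sup_bv u : u \in Std -> std_supp (bv u).
Proof. by move=> Hu v; rewrite co_bv; case: (v =P u) => [->|_]; rewrite ?eqxx. Qed.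

Lemma sup0 : std_supp 0.
Proof. by move=> v; rewrite /co mxE eqxx. Qed.

Lemma supD x y : std_supp x -> std_supp y -> std_supp (x + y).
Proof.
move=> Hx Hy u; rewrite coD; have [->|nz _] := eqVneq (co x u) 0; last exact: Hx.
by rewrite add0r; apply: Hy.
Qed.

Lemma sup_T x r : (r.+1 < n)%N -> std_supp x -> std_supp (x *m Tm r).
Proof.
move=> lr Hx v; rewrite co_T //.
have [->|nz] := eqVneq (co x v) 0; last by move=> _; apply: Hx.
rewrite mul0r add0r mulf_eq0 negb_or => /andP[_ nz].
by have [_] := sb_Std nz; rewrite srKr.
Qed.

Lemma TT_ind (P : 'rV[F]_(pdim n).+1 -> Prop) :
  (forall x r, (r.+1 < n)%N -> P x -> P (x *m Tm r)) -> forall w x, P x -> P (x *m TT w).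
Proof.
move=> step; elim/perm_ind => [|r w lr asc IH] x Px; first by rewrite (Tw1 n Tm) row1.
by rewrite -(Tw_asc HT) // rowM; apply: IH; apply: step.
Qed.

Lemma sup_TT w x : std_supp x -> std_supp (x *m TT w).
Proof. by apply: TT_ind => *; apply: sup_T. Qed.

Lemma sup_sum (I : Type) (e : seq I) (P : pred I) (f : I -> 'rV[F]_(pdim n).+1) :
  (forall i : I, P i -> std_supp (f i)) -> std_supp (\sum_(i <- e | P i) f i).
Proof. move=> H; elim: e => [|i e IHe]; first by rewrite big_nil; apply: sup0.
rewrite big_cons; case: ifP => [Pi|_]; last exact: IHe.
exact: (supD (H i Pi) IHe). Qed.

Lemma row_sum (I : Type) (e : seq I) (P : pred I) (f : I -> MF (pdim n)) x :
  x *m (\sum_(i <- e | P i) f i : MF _) = \sum_(i <- e | P i) x *m f i.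
Proof. exact: mulmx_sumr. Qed.

Lemma sup_XX mu x : std_supp x -> std_supp (x *m XX mu).
Proof. by move=> Hx; rewrite row_sum; apply: sup_sum => w _; apply: sup_TT. Qed.

Lemma co_L x k u : co (x *m Lm k) u = co x u * qn (ct u k).
Proof.
rewrite {1}[x]co_exp mulmx_suml co_sum (bigD1 u) //= big1 => [|v neq].
  by rewrite addr0 rowZl bvL !coZ co_bv eqxx mulr1.
by rewrite rowZl bvL !coZ co_bv eq_sym (negbTE neq) !mulr0.
Qed.

Lemma co_prod (I : Type) (e : seq I) (P : pred I) (A : I -> MF (pdim n)) (f : I -> 'S_n -> F) :
  (forall (i : I) x u, co (x *m A i) u = co x u * f i u) ->
  forall x u, co (x *m (\prod_(i <- e | P i) A i : MF _)) u = co x u * \prod_(i <- e | P i) f i u.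
Proof.
move=> H; elim: e => [|i e IHs] x u; first by rewrite !big_nil row1 mulr1.
by rewrite !big_cons; case: ifP => // _; rewrite rowM IHs H mulrA.
Qed.

(** The eigenvalue of u_mu on the basis vector of u; the powers of t in u_mu turn [c] - [kappa] into
    [c - kappa]. *)
Definition ueig mu u : F := \prod_(l < ell | (l.+1 < ell)%N)
  \prod_(r < asum mu l) qn (ct u r - kap kappa l.+1).

Lemma co_U mu x u : co (x *m UU mu) u = co x u * ueig mu u.
Proof.
rewrite /u_mp; apply: (@co_prod _ _ _ _ (fun l u => \prod_(r < asum mu l) qn (ct u r - kap kappa l.+1))).
move=> l {}x {}u; apply: (@co_prod _ _ _ _ (fun (r : 'I_(asum mu l)) u => qn (ct u r - kap kappa l.+1))).
move=> r {}x {}u; rewrite rowM rowD rowN !rowZ !row1 coD -scaleN1r !coZ co_L !coZ Oval_qint Oval_tz.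
apply: (@ueig_aux _ _ _ _ _ (tF ^ kap kappa l.+1)); last exact: qn_sub.
by rewrite -expfzDr ?tF_neq0 // addNr expr0z.
Qed.

Lemma sup_U mu x : std_supp x -> std_supp (x *m UU mu).
Proof. by move=> Hx u; rewrite co_U mulf_eq0 negb_or => /andP[/Hx]. Qed.

Lemma sup_M mu x : is_mpart n mu -> std_supp x -> std_supp (x *m MM mu).
Proof. move=> Hmu Hx; rewrite (m_mpE Hmu) rowM; apply/sup_XX/sup_U; exact: Hx. Qed.

Section MuImage.
Variables (mu : mpart ell) (x : 'rV[F]_(pdim n).+1).
Hypothesis Hmu : is_mpart n mu.
Hypothesis Hx : std_supp x.
Local Notation y := (x *m MM mu).

Lemma image_T r : (r.+1 < n)%N -> rowcol n mu r = rowcol n mu r.+1 -> y *m Tm r = q *: y.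
Proof.
move=> lr E; rewrite m_mpE // rowM -[LHS]rowM (xpar_T HT) // rowZ Oval_t.
reflexivity.
Qed.

(** The two factors of m_mu commute, so its image lies in the image of the diagonal u_mu, and
    coordinates with eigenvalue 0 vanish. *)
Lemma image_L u (l r : nat) : co y u != 0 -> (l.+1 < ell)%N ->
  (r < \sum_(k < ell | (k <= l)%N) sumn (mu k))%N -> ct u r <> kap kappa l.+1.
Proof.
move=> nz ll lr E; move: nz; rewrite m_mpE // -u_comm_xpar // rowM co_U.
pose l' := Ordinal (ltnW ll); pose r' : 'I_(asum mu l') := Ordinal lr.
by rewrite /ueig (bigD1 l') //= (bigD1 r') //= E subrr (eqP (_ : qn 0 == 0)) ?qn_eq0 // !mul0r mulr0 eqxx.
Qed.

Lemma image_max : y != 0 -> exists2 s, co y s != 0 & forall u, co y u != 0 -> (ninv u <= ninv s)%N.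
Proof.
move=> /co_neq0[u0 nz].
case: (@arg_maxnP _ u0 (fun u => co y u != 0) (@ninv n) nz) => s nzs max_s.
by exists s.
Qed.

Lemma image_dom : y != 0 -> dom lam mu.
Proof.
move=> /image_max[s nz max_s]; apply: (supp_dom Hkappa Hlam Hmu (sup_M Hmu Hx) image_T _ nz max_s).
exact: image_L.
Qed.
End MuImage.

(** The longest element of the support is 1, so nothing else is in the support. *)
Lemma image_one x : std_supp x -> x *m MM lam = co (x *m MM lam) 1%g *: bv 1%g.
Proof.
move=> Hx; have Hy := sup_M Hlam Hx; have [E|nz] := eqVneq (x *m MM lam) 0.
  by rewrite E /co mxE scale0r.
have [s nzs max_s] := image_max nz.
have E : s = 1%g by apply: (supp_one Hkappa Hlam Hy (image_T _ Hlam) (image_L Hlam) nzs max_s).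
rewrite {1}[x *m _]co_exp (bigD1 1%g) //= big1 ?addr0 // => u neq.
have [->|nzu] := eqVneq (co (x *m MM lam) u) 0; first by rewrite scale0r.
by move: neq; rewrite (@ninv_eq0 _ u) ?eqxx //; have := max_s u nzu; rewrite E ninv1; lia.
Qed.

End Action.

(** * The orbit of the vector of the initial tableau *)

Section UnitVector.
Variables (ell n : nat) (kappa : 'I_ell -> int).
Hypothesis ell0 : (0 < ell)%N.
Hypothesis Hkappa : forall l : 'I_ell, (l.+1 < ell)%N -> n%:Z < kappa l - kap kappa l.+1.
Variable lam : mpart ell.
Hypothesis Hlam : is_mpart n lam.
Implicit Types (l : 'I_ell) (r c i j k : nat) (u v w s d : 'S_n) (x y : 'rV[F]_(pdim n).+1).
Implicit Types (mu : mpart ell).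

Local Notation pc := (pcont n kappa lam).
Local Notation Std := (Std n lam).
Local Notation q := tF.
Local Notation ct := (econt kappa lam).
Local Notation sa := (sdiag kappa lam).
Local Notation sb := (soff kappa lam).
Local Notation Tm := (Tm n kappa lam).
Local Notation Lm := (Lm n kappa lam).
Local Notation TT := (Tw Tm).
Local Notation MM := (m_mp n kappa Lm Tm).
Local Notation UU := (u_mp kappa Lm).
Local Notation XX mu := (xpar n Tm (rowcol n mu)).

Local Notation std_supp := (std_supp (n := n) lam).
Local Notation ueig := (ueig kappa lam).
Let HR : hecke_rel n kappa Lm Tm := seminormal_rel Hkappa Hlam ell0.
Let HT : typeA n Tm := hecke_typeA HR.

Lemma bv1_T r : (r.+1 < n)%N -> rowcol n lam r = rowcol n lam r.+1 ->
  bv 1%g *m Tm r = q *: bv (1%g : 'S_n).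
Proof.
move=> lr E; have [l [i [c [Hin Ei]]]] := node_ex Hlam (ltnW lr).
have [l' [i' [c' [Hin' Ej]]]] := node_ex Hlam lr.
have := rowcol_eq Hlam Hin Hin'; rewrite Ei Ej E eqxx => /esym/andP[/eqP El /eqP Er].
subst l' i'; have Ec : c' = c.+1 by move: Ei Ej; rewrite !tlamE; clear; lia.
rewrite bvT nStd_sb2 ?scale0r ?addr0 //; last first.
  rewrite mul1g; apply/negP => /(Std_incr Hlam)/incrP/(_ r lr E).
  by rewrite !pnat_sr // swpl swpr; lia.
congr (_ *: _); rewrite /sa /X /econt Std1 // invg1 !pnat1 -Ej -Ei !pcontE //.
have -> : kappa l + c'%:Z - i%:Z = kappa l + c%:Z - i%:Z + 1 by lia.
rewrite [X in sna _ _ X]expfzDr ?tF_neq0 // expr1z.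
exact: (sna_succ (expfz_neq0 _ tF_neq0) tF_neq1).
Qed.

Lemma bv1_Tw w : w \in Spar n (rowcol n lam) -> bv 1%g *m TT w = q ^+ ninv w *: bv (1%g : 'S_n).
Proof.
move: w; apply: Spar_ind => [||r p lr E asc Hp IH]; first exact: colmono_rowcol.
  by rewrite (Tw1 n Tm) row1 ninv1 expr0 scale1r.
rewrite -(Tw_asc HT) // rowM bv1_T // rowZl IH scalerA ninv_asc // exprS //.
Qed.

Definition gam1 : F := ueig lam (1%g : 'S_n) * \sum_(w in Spar n (rowcol n lam)) q ^+ ninv w.

Lemma bv1_M : bv 1%g *m MM lam = gam1 *: bv (1%g : 'S_n).
Proof.
rewrite m_mpE // rowM.
have -> : bv 1%g *m UU lam = ueig lam (1%g : 'S_n) *: bv (1%g : 'S_n).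
  apply: co_ext => u; rewrite co_U coZ co_bv.
  by case: eqP => [->|_]; rewrite ?mul0r ?mulr0 // mulrC.
rewrite rowZl row_sum /gam1 -scalerA; congr (_ *: _); rewrite scaler_suml.
by apply: eq_bigr => w Hw; rewrite bv1_Tw.
Qed.

Definition avec d : 'rV[F]_(pdim n).+1 := bv 1%g *m TT d.

Lemma sup_av d : std_supp (avec d).
Proof. by apply: (sup_TT ell0 Hkappa Hlam); apply/sup_bv/Std1. Qed.

(** Splitting off a right descent r of d keeps d s_r standard, by [nStd_pos]. The step back leads
    away from t^lam, where [hp] is 1, so the leading coefficient stays 1. *)
Lemma av_unitri d : d \in Std ->
  co (avec d) d = 1 /\ forall u, co (avec d) u != 0 -> u = d \/ (ninv u < ninv d)%N.
Proof.
have [m Em] := ubnP (ninv d); elim: m d Em => // m IH d Em Hd.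
have [-> | neq] := eqVneq d 1%g.
  rewrite /avec (Tw1 n Tm) row1 co_bv eqxx; split=> // u; rewrite co_bv.
  by case: (u =P 1%g) => [->|_]; [left | rewrite eqxx].
have [|r [lr desc]] := @ex_descent n d^-1%g; first by rewrite invg_eq1.
have Hd' : (d * sr n r)%g \in Std.
  by apply/negPn/negP => nstd; have := nStd_pos Hlam Hd lr nstd; move: desc; clear; lia.
have Ei := ninv_descr lr desc.
have [|c1 c2] := IH _ _ Hd'; first by lia.
have E : avec d = avec (d * sr n r)%g *m Tm r by rewrite /avec (Tw_descr HT lr desc) rowM.
have z : co (avec (d * sr n r)%g) d = 0.
  apply/eqP/negPn/negP => /c2[E'|]; last by lia.
  by move: Ei; rewrite -E'; clear; lia.
split.
  rewrite E co_T // z mul0r add0r c1 mul1r /sb Hd' srKr // Hd /=.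
  rewrite invMg srV // !pnat_srl // swpl swpr /hp desc //.
move=> v; rewrite E co_T //.
have [->|/c2[->|lt] _] := eqVneq (co (avec (d * sr n r)%g) v) 0; last 2 first.
- by right; lia.
- by right; lia.
rewrite mul0r add0r mulf_eq0 negb_or => /andP[/c2[Ev|lt] _].
  by left; rewrite -(srKr v lr) Ev srKr.
by right; have := ninv_srr_le (v * sr n r)%g lr; rewrite srKr //; lia.
Qed.
End UnitVector.

Lemma half_aux (K : comPzRingType) (a b c d e f : K) :
  a * ((b * c + d * e) * f) = a * c * (b * f) + a * e * (d * f).
Proof. by ring. Qed.

Lemma coef_aux (K : comPzRingType) (a b c d : K) : a * (b * c * d) = c * (a * b * d).
Proof. by ring. Qed.

(** The matrix is triangular for [key], not for the order of indices. A permutation with nonzero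
    product never raises the key; as the total is preserved, all keys are fixed and the permutation
    is 1. *)
Lemma det_unitri (K : fieldType) m (M : 'M[K]_m) (key : 'I_m -> nat) : (forall i, M i i = 1) ->
  (forall i j : 'I_m, M i j != 0 -> i = j \/ (key j < key i)%N) -> \det M = 1.
Proof.
move=> diag tri; rewrite /determinant (bigD1 1%g) //= [X in _ + X]big1 => [|s neq]; last first.
  have [//|nz] := eqVneq (\prod_i M i (s i)) 0; first by move=> ->; rewrite mulr0.
  have le i : (key (s i) <= key i)%N.
    by case: (tri i (s i)) => [|<-|/ltnW] //; apply: contra_neq nz => z; rewrite (bigD1 i) //= z mul0r.
  have sum_eq : (\sum_i key (s i) = \sum_i key i)%N by rewrite [RHS](reindex_inj (@perm_inj _ s)).
  have /leqif_sum : forall i : 'I_m, true -> (key (s i) <= key i ?= iff (key (s i) == key i))%N.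
    by move=> i _; split; [exact: le | ].
  rewrite sum_eq => -[_]; rewrite eqxx => /esym/forallP eqk.
  case/eqP: neq; apply/permP => i; rewrite perm1.
  case: (tri i (s i)) => [|//|]; last by rewrite (eqP (eqk i)) ltnn.
  by apply: contra_neq nz => z; rewrite (bigD1 i) //= z mul0r.
rewrite addr0 odd_perm1 expr0 mul1r big1 // => i _; by rewrite perm1 diag.
Qed.

(** * The invariant form *)

Section Form.
Variables (ell n : nat) (kappa : 'I_ell -> int).
Hypothesis ell0 : (0 < ell)%N.
Hypothesis Hkappa : forall l : 'I_ell, (l.+1 < ell)%N -> n%:Z < kappa l - kap kappa l.+1.
Variable lam : mpart ell.
Hypothesis Hlam : is_mpart n lam.
Implicit Types (l : 'I_ell) (r c i j k : nat) (u v w s d : 'S_n) (x y : 'rV[F]_(pdim n).+1).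
Implicit Types (mu : mpart ell).

Local Notation pc := (pcont n kappa lam).
Local Notation Std := (Std n lam).
Local Notation q := tF.
Local Notation ct := (econt kappa lam).
Local Notation sa := (sdiag kappa lam).
Local Notation sb := (soff kappa lam).
Local Notation Tm := (Tm n kappa lam).
Local Notation Lm := (Lm n kappa lam).
Local Notation TT := (Tw Tm).
Local Notation MM := (m_mp n kappa Lm Tm).
Local Notation UU := (u_mp kappa Lm).
Local Notation XX mu := (xpar n Tm (rowcol n mu)).

Local Notation std_supp := (std_supp (n := n) lam).
Local Notation ueig := (ueig kappa lam).
Local Notation av := (avec kappa lam).
Let HR : hecke_rel n kappa Lm Tm := seminormal_rel Hkappa Hlam ell0.
Let HT : typeA n Tm := hecke_typeA HR.

(** The form requires only the recursion, the value at 1 and nonvanishing; the closed formula [gamf]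
    is substituted in the end. *)
Variable gam : 'S_n -> F.
Hypothesis gam_step : forall u r, (r.+1 < n)%N -> u \in Std -> (u * sr n r)%g \in Std ->
  (pnat u^-1%g r < pnat u^-1%g r.+1)%N ->
  gam (u * sr n r)%g = snf q (X kappa lam u r) (X kappa lam u r.+1) * gam u.
Hypothesis gam_one : gam 1%g = gam1 n kappa lam.
Hypothesis gam_neq0 : forall u, u \in Std -> gam u != 0.

Lemma co0 u : co 0 u = 0.
Proof. exact: mxE. Qed.

Definition form x y : F := \sum_(u in Std) gam u * (co x u * co y u).

Lemma formC x y : form x y = form y x.
Proof. by apply: eq_bigr => u _; congr (_ * _); rewrite mulrC. Qed.

Lemma formZ a x y : form (a *: x) y = a * form x y.
Proof.
rewrite /form mulr_sumr; apply: eq_bigr => u _; rewrite coZ.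
by rewrite -[a * _ * _]mulrA mulrCA.
Qed.

Lemma form_suml (I : Type) (e : seq I) (P : pred I) (f : I -> 'rV[F]_(pdim n).+1) y :
  form (\sum_(i <- e | P i) f i) y = \sum_(i <- e | P i) form (f i) y.
Proof.
rewrite /form exchange_big; apply: eq_bigr => u _.
by rewrite co_sum mulr_suml mulr_sumr.
Qed.

Lemma form_bv u x : u \in Std -> form (bv u) x = gam u * co x u.
Proof.
move=> Hu; rewrite /form (bigD1 u) //= co_bv eqxx mul1r big1 ?addr0 // => v /andP[_ neq].
by rewrite co_bv (negbTE neq) mul0r mulr0.
Qed.

(** Self-adjointness of T_r in coordinates. Of the two off-diagonal coefficients one is 1 and the
    other [snf], which is the quotient of the two norms. *)
Lemma gam_sb v r : (r.+1 < n)%N ->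
  gam v * sb (v * sr n r)%g r = gam (v * sr n r)%g * sb v r.
Proof.
move=> lr; have [Hv | nHv] := boolP (v \in Std); last first.
  by rewrite (nStd_sb _ _ nHv) nStd_sb2 ?srKr // !mulr0.
have [Hv' | nHv] := boolP ((v * sr n r)%g \in Std); last first.
  by rewrite (nStd_sb _ _ nHv) nStd_sb2 // !mulr0.
rewrite /sb Hv Hv' srKr // Hv /= invMg srV // !pnat_srl // swpl swpr.
case: (ltngtP (pnat v^-1%g r) (pnat v^-1%g r.+1)) => [lt|lt|/pnat_inj]; last by lia.
  rewrite (gam_step lr Hv Hv' lt) /hp lt ltnNge (ltnW lt) /= mulr1 mulrC /X /econt Hv snfC //.
have lt' : (pnat (v * sr n r)^-1%g r < pnat (v * sr n r)^-1%g r.+1)%N.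
  by rewrite invMg srV // !pnat_srl // swpl swpr.
have := gam_step lr Hv'; rewrite srKr // => /(_ Hv lt') ->.
rewrite /hp lt ltnNge (ltnW lt) /= mulr1 mulrC !X_sr // swpl swpr /X /econt Hv snfC //.
Qed.

Lemma form_T x y r : (r.+1 < n)%N -> form (x *m Tm r) y = form x (y *m Tm r).
Proof.
move=> lr.
have half z1 z2 : form (z1 *m Tm r) z2 = \sum_(u in Std) gam u * sa u r * (co z1 u * co z2 u) +
    \sum_u gam u * sb (u * sr n r)%g r * (co z1 (u * sr n r)%g * co z2 u).
  rewrite [X in _ = _ + X](bigID (fun u => u \in Std)) /=.
  rewrite [X in _ = _ + (_ + X)]big1 => [|u nHu]; last first.
    by rewrite nStd_sb2 ?srKr // mulr0 mul0r.
  rewrite addr0 -big_split; apply: eq_bigr => u _ /=; rewrite co_T //.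
  move: (gam u) (co z1 u) (sa u r) (co z1 _) (sb _ _) (co z2 u) => a b c d e f; exact: half_aux.
rewrite half [RHS]formC half; congr (_ + _).
  by apply: eq_bigr => u _; congr (_ * _); rewrite mulrC.
rewrite [RHS](reindex_inj (mulIg (sr n r))) /=; apply: eq_bigr => u _.
by rewrite srKr // gam_sb // [X in _ * X]mulrC.
Qed.

Lemma form_TT x y w : form (x *m TT w) y = form x (y *m TT w^-1%g).
Proof.
elim/perm_ind: w x y => [|r w lr asc IH] x y; first by rewrite invg1 (Tw1 n Tm) !row1.
rewrite -(Tw_asc HT) // rowM IH form_T // -rowM (Tw_ascr HT) ?invgK //.
by rewrite invMg srV.
Qed.

Lemma form_M x y : form (x *m MM lam) y = form x (y *m MM lam).
Proof.
have formX z1 z2 : form (z1 *m XX lam) z2 = form z1 (z2 *m XX lam).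
  rewrite !row_sum form_suml formC form_suml sum_SparV.
  by apply: eq_bigr => w _; rewrite form_TT invgK formC.
have formU z1 z2 : form (z1 *m UU lam) z2 = form z1 (z2 *m UU lam).
  apply: eq_bigr => u _; rewrite !co_U; congr (_ * _).
  by rewrite mulrAC mulrA.
rewrite m_mpE // rowM formX formU -rowM (u_comm_xpar Hlam HR) //.
Qed.

(** The image is a multiple of e_1; pairing it with e_1 and moving m_lam to the other side gives
    gamma_1 <x, e_1>, and gamma_1 cancels. *)
Lemma M_act x : std_supp x -> x *m MM lam = form x (bv 1%g) *: bv (1%g : 'S_n).
Proof.
move=> Hx; rewrite (image_one ell0 Hkappa Hlam Hx); congr (_ *: _).
apply: (mulfI (gam_neq0 (Std1 Hlam))); rewrite -form_bv ?Std1 // formC form_M bv1_M //.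
by rewrite formC formZ gam_one formC.
Qed.

Lemma murphy_act x u v : std_supp x ->
  x *m murphy kappa Lm Tm lam u v = form x (av u) *: av v.
Proof.
move=> Hx; rewrite /murphy 2!rowM M_act; last exact: (sup_TT ell0 Hkappa Hlam).
by rewrite rowZl form_TT invgK.
Qed.

Lemma av1 : av (1%g : 'S_n) = bv 1%g.
Proof. by rewrite /avec (Tw1 n Tm) row1. Qed.

Definition amx : 'M[F]_#|Std| := \matrix_(i, j) co (av (enum_val i)) (enum_val j).
Definition gmx : 'M[F]_#|Std| := \matrix_(i, j) form (av (enum_val i)) (av (enum_val j)).

Lemma det_amx : \det amx = 1.
Proof.
apply: (@det_unitri F _ amx (fun i : 'I_#|Std| => ninv (enum_val i))) => [i|i j].
  by rewrite mxE; case: (av_unitri ell0 Hkappa Hlam (enum_valP i)).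
rewrite mxE => nz; case: (av_unitri ell0 Hkappa Hlam (enum_valP i)) => _ /(_ _ nz)[/enum_val_inj->|lt].
  by left.
by right.
Qed.

Lemma gmxE : gmx = amx *m diag_mx (\row_j gam (enum_val j)) *m amx^T.
Proof.
apply/matrixP => i j; rewrite !mxE /form big_enum_val /=.
apply: eq_bigr => k _; rewrite mul_mx_diag !mxE.
by rewrite -mulrA [RHS]mulrCA.
Qed.

Lemma det_gmx : \det gmx = \prod_(u in Std) gam u.
Proof.
rewrite gmxE !det_mulmx det_tr det_amx mul1r mulr1 det_diag [RHS]big_enum_val.
by apply: eq_bigr => j _; rewrite mxE.
Qed.

(* the matrices of the maps x |-> <x, a_u> a_v are linearly independent since A is unitriangular
   and the form is nondegenerate *)
Lemma coef_zero (D : 'S_n -> 'S_n -> F) :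
  (forall x, std_supp x -> \sum_(u in Std) \sum_(v in Std) D u v *: (form x (av u) *: av v) = 0) ->
  forall u v, u \in Std -> v \in Std -> D u v = 0.
Proof.
move=> H; pose Dm : 'M[F]_#|Std| := \matrix_(i, j) D (enum_val i) (enum_val j).
have unit_a : amx \in unitmx by rewrite unitmxE det_amx unitr1.
have unit_at : amx^T \in unitmx by rewrite unitmx_tr.
suff Dm0 : Dm = 0.
  move=> u v Hu Hv; have := congr1 (fun M : 'M[F]_#|Std| => M (enum_rank_in Hu u) (enum_rank_in Hv v)) Dm0.
  by rewrite !mxE !enum_rankK_in.
suff E : amx^T *m Dm *m amx = 0.
  by rewrite -[Dm](mulKmx unit_at) -[X in _ *m X](mulmxK unit_a) E mul0mx mulmx0.
apply/matrixP => i j; rewrite mxE.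
have := congr1 (fun y => co y (enum_val j)) (H (bv (enum_val i)) (sup_bv (enum_valP i))).
rewrite co_sum co0 => E0; rewrite [RHS]mxE.
apply: (mulfI (gam_neq0 (enum_valP i))); rewrite mulr0 -[RHS]E0.
transitivity (\sum_k \sum_k' gam (enum_val i) * (amx k i * Dm k k' * amx k' j)).
  rewrite exchange_big mulr_sumr; apply: eq_bigr => k' _ /=.
  rewrite [(_ *m _) _ _]mxE mulr_suml mulr_sumr; apply: eq_bigr => k _.
  by rewrite [amx^T _ _]mxE.
rewrite [RHS]big_enum_val; apply: eq_bigr => k _ /=.
rewrite co_sum [RHS]big_enum_val; apply: eq_bigr => k' _ /=.
rewrite !coZ (form_bv _ (enum_valP i)) !mxE; exact: coef_aux.
Qed.
End Form.

Lemma snf_ratio_aux (K : fieldType) (q a z : K) : q != 0 -> a != 0 -> q - 1 != 0 -> z - 1 != 0 ->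
  snf q (a * z) a = q * (((z * q^-1 - 1) / (q - 1)) * ((z * q - 1) / (q - 1)) / ((z - 1) / (q - 1)) ^+ 2).
Proof.
move=> nq na nq1 nz.
have nz' : a - a * z != 0.
  by rewrite -[X in X - _]mulr1 -mulrBr mulf_neq0 // -opprB oppr_eq0.
by rewrite /snf; field; rewrite nz nz' nq nq1.
Qed.

Lemma step_aux (K : fieldType) (q e f g y z : K) m : f != 0 -> g != 0 ->
  q ^+ m.+1 * (e / f * y * z) = q * (e * g / f ^+ 2) * (q ^+ m * (f / g * y * z)).
Proof. by move=> nf ng; rewrite exprS; field; rewrite nf ng. Qed.

(** With d = i - j the axial distance, this is the form t [d-1] [d+1] / [d]^2 that can be matched
    with products of quantum integers. *)
Lemma snf_ratio (i j : int) : i != j ->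
  snf tF (tF ^ i) (tF ^ j) = tF * (qn (i - j - 1) * qn (i - j + 1) / qn (i - j) ^+ 2).
Proof.
move=> neq; have -> : tF ^ i = tF ^ j * tF ^ (i - j) by rewrite -expfzDr ?tF_neq0 //; congr (_ ^ _); lia.
have nz : tF ^ (i - j) - 1 != 0.
  rewrite subr_eq0; apply/eqP => E; have := @tFX_inj (i - j) 0; rewrite E expr0z => /(_ erefl).
  by move/eqP; rewrite subr_eq0 (negbTE neq).
rewrite (snf_ratio_aux tF_neq0 (expfz_neq0 _ tF_neq0) tF_neq1 nz).
by rewrite /qn !expfzDr ?tF_neq0 // exprN1 expr1z.
Qed.

(** * The norms of the seminormal basis vectors *)

(* gamf u is t^len(u) times the product, over the entries k of the tableau, of
   [c - c_B] over the addable nodes B below the node of k, divided by the same product over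
   the removable nodes, c being the content of that node.  The products are written over all rows below,
   without testing addability: for a row s+1 as long as row s, the numerator of s+1 cancels the
   denominator of s. *)
Section GammaFormula.
Variables (ell n : nat) (kappa : 'I_ell -> int).
Hypothesis Hkappa : forall l : 'I_ell, (l.+1 < ell)%N -> n%:Z < kappa l - kap kappa l.+1.
Variable lam : mpart ell.
Hypothesis Hlam : is_mpart n lam.
Implicit Types (l : 'I_ell) (r c i j k p : nat) (u v w : 'S_n) (x : 'I_ell * 'I_n.+1).

Local Notation pc := (pcont n kappa lam).
Local Notation Std := (Std n lam).
Local Notation q := tF.

Definition inrow (x : 'I_ell * 'I_n.+1) p : bool :=
  (tlam lam x.1 x.2 0 <= p < tlam lam x.1 x.2 0 + nth 0%N (lam x.1) x.2)%N.
Definition below i (x : 'I_ell * 'I_n.+1) : bool := (i < tlam lam x.1 x.2 0)%N.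

Definition cn u i x : nat := #|[pred p : 'I_n | inrow x p && (pnat u p < pnat u i)%N]|.

(* the content of the first node of row x which, when the entry at position i
   is inserted, is not yet occupied *)
Definition xc u i x : int := kappa x.1 + (cn u i x)%:Z - (nat_of_ord x.2)%:Z.

(** If m is the content difference to the first free node of the row, m + 1 is the one to its last
    occupied node. The empty row n has no successor whose numerator could cancel a denominator,
    hence the default 1. *)
Definition gfac x (m : int) : F := qn m / (if (x.2 < n)%N then qn (m + 1) else 1).
Definition gp u i : F := \prod_(x | below i x) gfac x (pc i - xc u i x).
Definition gamf u : F := q ^+ ninv u * \prod_(i < n) gp u i.

Lemma belowE l r c x : inmp lam l r c ->
  below (tlam lam l r c) x = (l < x.1)%N || ((l == x.1) && (r < x.2)%N).
Proof.
move=> Hin; rewrite /below ltnNge (rowstart_le _ _ Hin).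
rewrite -!val_eqE /=; clear; lia.
Qed.

Lemma inrowP x p : reflect (exists2 c, inmp lam x.1 x.2 c & p = tlam lam x.1 x.2 c) (inrow x p).
Proof.
rewrite /inrow /inmp; apply: (iffP idP) => [/andP[le lt] | [c Hc ->]].
  by exists (p - tlam lam x.1 x.2 0)%N; move: le lt; rewrite !tlamE; clear; lia.
by move: Hc; rewrite !tlamE; clear; lia.
Qed.

Lemma cn_le u i x m : (forall p, inrow x p -> (pnat u p < pnat u i)%N -> (p < tlam lam x.1 x.2 0 + m)%N) ->
  (cn u i x <= m)%N.
Proof.
move=> H; pose s := tlam lam x.1 x.2 0.
apply: leq_trans (_ : #|[pred p : 'I_n | (s <= p < minn (s + m) n)%N]| <= _)%N; last first.
  by rewrite card_interval ?geq_minr //; clear; lia.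
apply/subset_leq_card/subsetP => p; rewrite !inE => /andP[Hx lt].
have := H p Hx lt; case/andP: Hx => le _; move: le (ltn_ord p); rewrite -/s; clear; lia.
Qed.

Lemma inrow_inj x y p : inrow x p -> inrow y p -> x = y.
Proof.
move=> /inrowP[c Hc ->] /inrowP[c' Hc'] /(tlam_inj Hc Hc')[].
by case: x y {Hc Hc'} => [l r] [l' r'] /= -> /val_inj ->.
Qed.

(** For a later component this is the gap in [kappa]. In the same component a lower row has at most
    c nodes filled when the node in column c is, by standardness. *)
Lemma xc_pos u i x : u \in Std -> (i < n)%N -> below i x -> 0 < pc i - xc u i x.
Proof.
move=> Hu /(node_ex Hlam)[l [r [c [Hin <-]]]]; rewrite (belowE _ Hin) pcontE // /xc.
case: x => l' r' /= /orP[lt | /andP[/eqP El lt]].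
  have le : (cn u (tlam lam l r c) (l', r') <= nth 0 (lam l') r')%N.
    by apply: cn_le => p /andP[].
  have := @kap_gap _ _ _ Hkappa l l'; rewrite lt ltn_ord !kapE => /(_ isT).
  have neq : l != l' by rewrite -val_eqE /= neq_ltn lt.
  have := sumn2_le_n Hlam neq; have := inmp_hook Hlam Hin.
  have := psum_le_sumn (lam l') r'.+1; rewrite psumS; move: le; clear; lia.
subst l'; have le : (cn u (tlam lam l r c) (l, r') <= c)%N.
  apply: cn_le => p /inrowP[/= c' Hin' ->] lt'; rewrite !tlamE addn0 ltn_add2l.
  rewrite ltnNge; apply/negP => le_c.
  have := @Std_le _ _ _ Hlam u l r c (r' - r) (c' - c) Hu.
  by rewrite !subnKC ?(ltnW lt) // => /(_ Hin'); move: lt'; clear; lia.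
by move: le lt; clear; lia.
Qed.

Lemma gfac_neq0 x (m : int) : 0 < m -> gfac x m != 0.
Proof.
move=> m0; rewrite /gfac mulf_neq0 ?qn_eq0 ?gt_eqF // invr_eq0.
by case: ifP; rewrite ?oner_eq0 // qn_eq0 => _; apply/eqP; lia.
Qed.

Lemma gamf_neq0 u : u \in Std -> gamf u != 0.
Proof.
move=> Hu; rewrite /gamf; apply: mulf_neq0; first exact: (expf_neq0 _ tF_neq0).
apply/prodf_neq0 => i _; apply/prodf_neq0 => x Hx; apply: gfac_neq0.
exact: xc_pos.
Qed.

Section Swap.
Variables (u : 'S_n) (r : nat).
Hypotheses (lr : (r.+1 < n)%N) (Hu : u \in Std) (Hv : (u * sr n r)%g \in Std).
Local Notation a := (pnat u^-1%g r).
Local Notation b := (pnat u^-1%g r.+1).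
Hypothesis lt_ab : (a < b)%N.
Local Notation v := (u * sr n r)%g.

Let ua : pnat u a = r. Proof. exact: pnatKV. Qed.
Let ub : pnat u b = r.+1. Proof. exact: pnatKV. Qed.
Let va : pnat v a = r.+1. Proof. by rewrite pnatM ua pnat_sr // swpl. Qed.
Let vb : pnat v b = r. Proof. by rewrite pnatM ub pnat_sr // swpr. Qed.

Lemma swap_lt i p : ~ (i = a /\ p = b) -> ~ (i = b /\ p = a) ->
  (pnat v p < pnat v i)%N = (pnat u p < pnat u i)%N.
Proof.
move=> n1 n2; rewrite !pnatM !pnat_sr //.
have m1 : ~ (pnat u i = r /\ pnat u p = r.+1).
  by move=> [E1 E2]; apply: n1; split; [rewrite -E1 pnatK | rewrite -E2 pnatK].
have m2 : ~ (pnat u i = r.+1 /\ pnat u p = r).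
  by move=> [E1 E2]; apply: n2; split; [rewrite -E1 pnatK | rewrite -E2 pnatK].
move: m1 m2; move: (pnat u i) (pnat u p) => e f; clear.
by case: (swpP r e) => *; case: (swpP r f) => *; lia.
Qed.

Lemma cn_swap i x : ~ (i = a /\ inrow x b) -> ~ (i = b /\ inrow x a) -> cn v i x = cn u i x.
Proof.
move=> n1 n2; apply: eq_card => p; rewrite !inE; case Hp : (inrow x p) => //=.
by apply: swap_lt => -[Ei Ep]; [apply: n1 | apply: n2]; rewrite -Ep.
Qed.

Lemma gp_swap i : i != a -> gp v i = gp u i.
Proof.
move=> neq; apply: eq_bigr => x Hx; rewrite /xc cn_swap // => -[Ei].
  by rewrite Ei eqxx in neq.
by move=> /andP[le _]; move: Hx lt_ab le; rewrite /below Ei; clear; lia.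
Qed.

(** When r is inserted at a, the first free node in the row of b is b itself; after the swap b is
    already filled. The row of b lies below a, since both tableaux increase along rows but order a
    and b differently. *)
Lemma row_swap : exists x, [/\ below a x, inrow x b, (x.2 < n)%N,
  xc u a x = pc b & xc v a x = pc b + 1].
Proof.
have [l [i [c [Hin Eb]]]] := node_ex Hlam (pnat_lt u^-1%g lr).
have li := inmp_row_lt Hlam Hin; pose x : 'I_ell * 'I_n.+1 := (l, inord i).
have x2 : x.2 = i :> nat by rewrite inordK //; lia.
have Hb : inrow x b by apply/inrowP; exists c; rewrite /= ?x2.
have la : (a < n)%N by apply: pnat_lt; lia.
have lb : (b < n)%N by apply: pnat_lt.
have Ha : below a x.
  rewrite /below ltnNge; apply/negP => le.
  have row : rowcol n lam a = rowcol n lam b.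
    apply/eqP; rewrite -Eb rowcol_row //; move: Hb le lt_ab.
    by rewrite /inrow /= x2 -Eb; clear; lia.
  have := incr_lt (colmono_rowcol Hlam) (Std_incr Hlam Hv) _ row.
  by rewrite lt_ab lb va vb => /(_ isT); lia.
have cu : cn u a x = c.
  transitivity #|[pred p : 'I_n | (tlam lam l i 0 <= p < tlam lam l i c)%N]|; last first.
    by rewrite card_interval ?(ltnW (tlam_lt_n Hlam Hin)) // !tlamE; clear; lia.
  apply: eq_card => p; rewrite !inE; apply/andP/andP => [[/inrowP[c' Hin' Ep]]|[le lt]].
    rewrite ua Ep /= x2 in Hin' * => lt; rewrite !tlamE !ltn_add2l !leq_add2l; split=> //.
    rewrite ltnNge; apply/negP => le_c.
    have := @Std_le _ _ _ Hlam u l i c 0 (c' - c) Hu; rewrite addn0 subnKC // => /(_ Hin').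
    by rewrite Eb ub; move: lt; clear; lia.
  have [c' Ep] : exists c', nat_of_ord p = tlam lam l i c'.
    by exists (p - tlam lam l i 0)%N; move: le; rewrite !tlamE; clear; lia.
  have lt_c : (c' < c)%N by move: lt; rewrite Ep tlam_row.
  have Hin' := inmp_left Hlam (ltnW lt_c) Hin.
  split; first by apply/inrowP; exists c'; rewrite /= x2.
  have := @Std_le _ _ _ Hlam u l i c' 0 (c - c') Hu; rewrite addn0 subnKC ?(ltnW lt_c) // => /(_ Hin).
  rewrite Eb ub ua -Ep => lt'; have : pnat u p <> r.
    move=> E; move: Ha; rewrite /below /= x2 -E pnatK => Ha.
    by move: Ha le; clear; lia.
  by move: lt' lt_c; clear; lia.
exists x; split=> //; first by rewrite x2; lia.
  by rewrite /xc cu x2 -Eb pcontE.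
rewrite /xc x2 -Eb pcontE //; suff -> : cn v a x = c.+1 by rewrite /x /=; clear; lia.
rewrite -cu /cn (cardD1 (Ordinal lb)) inE /= Hb va vb ltnSn add1n; congr _.+1.
apply: eq_card => p; rewrite !inE -val_eqE /=; case: (inrow x p); last by rewrite andbF.
have [Ep|neq] := eqVneq (nat_of_ord p) b; first by rewrite Ep ub ua; clear; lia.
rewrite -va swap_lt // => -[E]; last by move: lt_ab; rewrite E ltnn.
by move=> E'; rewrite E' eqxx in neq.
Qed.

(** Only one factor changes, from [d]/[d+1] to [d-1]/[d] with d the axial distance; the ratio is
    [d-1][d+1]/[d]^2, and the missing t comes from the length. *)
Lemma gamf_step : gamf v = snf q (X kappa lam u r) (X kappa lam u r.+1) * gamf u.
Proof.
have [y [Ha Hb ly Eu Ev]] := row_swap.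
have la : (a < n)%N by apply: pnat_lt; lia.
pose a' := Ordinal la.
have splitp w : \prod_(i < n) gp w i = gp w a * \prod_(i < n | i != a') gp w i.
  by rewrite (bigD1 a').
have rest : \prod_(i < n | i != a') gp v i = \prod_(i < n | i != a') gp u i.
  by apply: eq_bigr => i neq; apply: gp_swap; move: neq; rewrite -val_eqE.
rewrite /gamf (ninv_ascr lr lt_ab) !splitp rest.
have Epa : gp v a = gfac y (pc a - pc b - 1) * \prod_(x | below a x && (x != y)) gfac x (pc a - xc u a x).
  rewrite /gp (bigD1 y) //= Ev opprD addrA; congr (_ * _).
  apply: eq_bigr => x /andP[Hx neq]; rewrite /xc cn_swap // => -[E].
    by move=> Hx'; rewrite (inrow_inj Hx' Hb) eqxx in neq.
  by move: lt_ab; rewrite E ltnn.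
have -> : gp u a = gfac y (pc a - pc b) * \prod_(x | below a x && (x != y)) gfac x (pc a - xc u a x).
  by rewrite /gp (bigD1 y) //= Eu.
rewrite {}Epa.
have pos : 0 < pc a - pc b by rewrite -Eu; apply: xc_pos.
have pos' : 0 < pc a - pc b - 1.
  by have := xc_pos Hv la Ha; rewrite Ev opprD addrA.
have neq : pc a != pc b by apply/eqP; lia.
rewrite /X /econt Hu snf_ratio // /gfac ly subrK.
have n1 : qn (pc a - pc b) != 0 by rewrite qn_eq0 gt_eqF.
have n2 : qn (pc a - pc b + 1) != 0 by rewrite qn_eq0; apply/eqP; lia.
move: n1 n2 (\prod_(x | _) _) (\prod_(i < n | _) _) (ninv u).
move: (qn (pc a - pc b - 1)) (qn (pc a - pc b)) (qn (pc a - pc b + 1)) => e f g n1 n2 R S m.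
exact: (@step_aux F q e f g R S m n1 n2).
Qed.
End Swap.
End GammaFormula.

(** * The norm of the first basis vector *)

Section Poincare.
Variables (K : comNzRingType) (q : K) (n : nat) (col : nat -> nat).
Hypothesis mono : colmono n col.
Implicit Types (w : 'S_n) (i j k m : nat).

Definition csize m : nat := #|[pred j : 'I_n | (j <= m)%N && (col j == col m)]|.

Lemma csize_interval m : (m < n)%N -> exists2 a, (a <= m)%N &
  csize m = (m.+1 - a)%N /\ forall j, (j <= m)%N -> (col j == col m) = (a <= j)%N.
Proof.
move=> lt; have ex : exists j, col j == col m by exists m.
have Ha := ex_minnP ex; case: Ha => a /eqP Ea min_a; have le_a : (a <= m)%N by apply: min_a.
have H j : (j <= m)%N -> (col j == col m) = (a <= j)%N.
  move=> le; apply/idP/idP => [/min_a //|le'].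
  rewrite eqn_leq -{2}Ea !mono //; lia.
exists a => //; split=> //; rewrite -(@card_interval n) //; apply: eq_card => j; rewrite !inE.
have [le|gt] := leqP j m; first by rewrite H //= ltnS le andbT.
by rewrite [(j < m.+1)%N]ltnNge gt andbF.
Qed.

(** [W m] fixes all positions from m on. The Poincare polynomial of [W m.+1] is computed from that
    of [W m] by sorting its elements according to the image k of m, as in [S m k]. *)
Let W m := [set w in Spar n col | [forall i : 'I_n, (m <= i)%N ==> (w i == i)]].

Let WP m w : reflect (w \in Spar n col /\ forall i, (m <= i < n)%N -> pnat w i = i) (w \in W m).
Proof.
rewrite [w \in W m]inE; apply: (iffP andP) => [[H1 /forallP H2] | [H1 H2]]; split=> //.
  move=> i /andP[le lt]; have := H2 (Ordinal lt); rewrite /= le => /eqP E.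
  by rewrite (pnat_ord w (Ordinal lt)) E.
by apply/forallP => i; apply/implyP => le; apply/eqP/val_inj; rewrite /= -pnat_ord H2 // le ltn_ord.
Qed.

Let P m := \sum_(w in W m) q ^+ ninv w.
Let S m k := \sum_(w in W m.+1 | pnat w m == k) q ^+ ninv w.

Let W_le m w : w \in W m.+1 -> (m < n)%N -> (pnat w m <= m)%N.
Proof.
move=> /WP[_ H] lt; rewrite leqNgt; apply/negP => gt.
have := H _ (introT andP (conj gt (pnat_lt w lt))) => /pnat_inj E.
by move: gt; rewrite E ltnn.
Qed.

Let S_top m : (m < n)%N -> S m m = P m.
Proof.
move=> lt; apply: eq_bigl => w; apply/andP/WP => [[/WP[H1 H2] /eqP E] | [H1 H2]].
  split=> // i /andP[le li]; have [<-//|neq] := eqVneq m i.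
  by apply: H2; lia.
split; last by rewrite H2 // leqnn.
by apply/WP; split=> // i Hi; apply: H2; lia.
Qed.

(** Right multiplication by s_k moves the image of m from k+1 to k. The preimage of k lies before m,
    so this creates one inversion. *)
Let S_step m k : (k < m < n)%N -> col k = col k.+1 -> S m k = q * S m k.+1.
Proof.
move=> /andP[lt lm] E; have lk : (k.+1 < n)%N by apply: leq_ltn_trans lm.
rewrite /S (reindex_inj (mulIg (sr n k))) /= mulr_sumr; apply: eq_big => [w|w].
  congr (_ && _); last first.
    by rewrite pnatM pnat_sr // -[X in _ == X](swpr k) (inj_eq (can_inj (swpK k))).
  apply/WP/WP => -[H1 H2].
    split; first by rewrite -(Spar_mulr _ lk E).
    move=> i Hi; have := H2 i Hi; rewrite pnatM pnat_sr // => E'.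
    by apply: (can_inj (swpK k)); rewrite E'; case_swp.
  split; first by rewrite (Spar_mulr _ lk E).
  by move=> i Hi; rewrite pnatM H2 // pnat_sr //; case_swp.
move=> /andP[Hw /eqP Em].
have Em' : pnat w m = k.+1.
  by move: Em; rewrite pnatM pnat_sr // => /(congr1 (swp k)); rewrite swpK swpl.
have Hw' : w \in W m.+1.
  move/WP: Hw => [H1 H2]; apply/WP; split; first by rewrite -(Spar_mulr _ lk E).
  move=> i Hi; have := H2 i Hi; rewrite pnatM pnat_sr // => E'.
  by apply: (can_inj (swpK k)); rewrite E'; case_swp.
rewrite ninv_ascr ?exprS // -Em' pnatK.
have neq : pnat w^-1%g k != m.
  by apply/eqP => Ek; move: Em'; rewrite -Ek pnatKV; lia.
rewrite ltn_neqAle neq leqNgt; apply/negP => gt.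
have lt' : (pnat w^-1%g k < n)%N by apply: pnat_lt; lia.
move/WP: Hw' => [_ /(_ (pnat w^-1%g k))]; rewrite pnatKV gt lt' => /(_ isT) E'.
by move: gt; rewrite -E'; clear -lt; lia.
Qed.

Let P_step m : (m < n)%N -> P m.+1 = P m * \sum_(i < csize m) q ^+ i.
Proof.
move=> lt; have [a le_a [Ec Ha]] := csize_interval lt.
have S_down i : (i <= m - a)%N -> S m (m - i) = q ^+ i * P m.
  elim: i => [|i IHi] le; first by rewrite subn0 S_top // expr0 mul1r.
  rewrite S_step; last 2 first.
  - by move: le lt; lia.
  - apply/eqP; have -> : (m - i.+1).+1 = (m - i)%N by lia.
    have e1 : col (m - i.+1)%N == col m by rewrite Ha; lia.
    have e2 : col (m - i)%N == col m by rewrite Ha; lia.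
    by rewrite (eqP e1) (eqP e2).
  have -> : (m - i.+1).+1 = (m - i)%N by lia.
  by rewrite IHi ?exprS ?mulrA //; lia.
transitivity (\sum_(i < csize m) S m (m - i)); last first.
  rewrite mulr_sumr; apply: eq_bigr => i _; rewrite S_down; first exact: mulrC.
  have : (i < m.+1 - a)%N by rewrite -Ec.
  by clear; lia.
rewrite /S (exchange_big_dep (fun w => w \in W m.+1)) /=; last by move=> i w _ /andP[].
apply: eq_bigr => w Hw; have le_w := W_le Hw lt.
have ge_w : (a <= pnat w m)%N.
  rewrite -Ha //; move/WP: Hw => [/SparP H _]; by rewrite H.
have lt_i : (m - pnat w m < csize m)%N by rewrite Ec; lia.
rewrite (bigD1 (Ordinal lt_i)) /=; last by rewrite Hw /=; apply/eqP; lia.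
rewrite big1 ?addr0 // => i /andP[/andP[_ /eqP E] /eqP neq]; case: neq; apply: val_inj => /=.
have : (i < m.+1 - a)%N by rewrite -Ec.
by move: E le_w le_a ge_w; clear; lia.
Qed.

Lemma poincare : \sum_(w in Spar n col) q ^+ ninv w = \prod_(m < n) \sum_(i < csize m) q ^+ i.
Proof.
suff H m : (m <= n)%N -> P m = \prod_(i < m) \sum_(j < csize i) q ^+ j.
  rewrite -H //; apply: eq_bigl => w; apply/idP/WP => [Hw|[]//]; split=> // i; lia.
elim: m => [|m IH] le.
  rewrite big_ord0 /P (big_pred1 1%g) ?ninv1 ?expr0 // => w; apply/WP/eqP => [[_ H]|->].
    by apply: pnat_ext => i lt; rewrite pnat1 H.
  by split; [apply: Spar1 | move=> i _; rewrite pnat1].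
by rewrite P_step // IH 1?ltnW // big_ord_recr.
Qed.
End Poincare.

(** Because the last denominator is 1, only the first numerator is left. This is the product of
    [gfac] over consecutive empty rows. *)
Lemma prod_telescope (K : fieldType) (h : nat -> K) s n : (s <= n)%N ->
  (forall k, (s <= k <= n)%N -> h k != 0) ->
  \prod_(r < n.+1 | (s <= r)%N) (h r / (if (r < n)%N then h r.+1 else 1)) = h s.
Proof.
move=> le nz.
have H m : (s <= m <= n)%N -> \prod_(r < m | (s <= r)%N) (h r / h r.+1) = h s / h m.
  elim: m => [|m IH] Hm.
    have -> : s = 0%N by lia.
    by rewrite big_ord0 divff // nz; lia.
  rewrite big_mkcond big_ord_recr -big_mkcond /=.
  have [le_m | gt] := leqP s m; last first.
    have -> : s = m.+1 by lia.
    rewrite big1 ?mulr1 ?divff //; [by apply: nz; lia | move=> i; have := ltn_ord i; lia].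
  rewrite IH; last by lia.
  by rewrite mulrA divfK //; apply: nz; lia.
rewrite big_mkcond big_ord_recr -big_mkcond /= le ltnn divr1.
rewrite (eq_bigr (fun r : 'I_n => h r / h r.+1)) => [|r _]; last by rewrite ltn_ord.
by rewrite H ?le ?leqnn // divfK // nz ?le ?leqnn.
Qed.

Section GammaOne.
Variables (ell n : nat) (kappa : 'I_ell -> int).
Hypothesis ell0 : (0 < ell)%N.
Hypothesis Hkappa : forall l : 'I_ell, (l.+1 < ell)%N -> n%:Z < kappa l - kap kappa l.+1.
Variable lam : mpart ell.
Hypothesis Hlam : is_mpart n lam.
Implicit Types (l : 'I_ell) (r c i j k p : nat) (u v w : 'S_n) (x : 'I_ell * 'I_n.+1).

Local Notation pc := (pcont n kappa lam).
Local Notation Std := (Std n lam).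
Local Notation q := tF.

Lemma xc_one i x : below lam i x -> xc kappa lam (1%g : 'S_n) i x = kappa x.1 - x.2%:Z.
Proof.
move=> Hx; rewrite /xc /cn eq_card0 ?addr0 // => p; rewrite !inE !pnat1.
by apply/negP => /andP[/andP[le _]]; move: Hx; rewrite /below; lia.
Qed.

Lemma csize_rowcol l r c : inmp lam l r c -> csize n (rowcol n lam) (tlam lam l r c) = c.+1.
Proof.
move=> Hin; have -> : c.+1 = (tlam lam l r c.+1 - tlam lam l r 0)%N by rewrite !tlamE; lia.
have lt := tlam_lt_n Hlam Hin.
rewrite -(@card_interval n); last by move: lt; rewrite !tlamE addnS.
apply: eq_card => j; rewrite !inE rowcol_row //; move: Hin; rewrite /inmp !tlamE; clear; lia.
Qed.

(** In t^lam all rows below an entry are empty when it is inserted. The rows of its own component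
    telescope to [c+1], giving the Poincare polynomial, and those of each later component k to
    [content - kappa_k], giving the eigenvalue of u_lam. *)
Lemma gp_one l r c : inmp lam l r c -> gp kappa lam (1%g : 'S_n) (tlam lam l r c) =
  qn c.+1 * \prod_(k < ell | (l < k)%N) qn (pc (tlam lam l r c) - kap kappa k).
Proof.
move=> Hin; have lr := inmp_row_lt Hlam Hin.
rewrite /gp (eq_bigr (fun x => gfac x (pc (tlam lam l r c) - kap kappa x.1 + x.2%:Z))) => [|x Hx]; last first.
  by rewrite xc_one // kapE opprB addrA; congr (gfac _ _); lia.
rewrite (eq_bigl (fun x : 'I_ell * 'I_n.+1 => true && ((l < x.1)%N || ((l == x.1) && (r < x.2)%N)))) => [|x]; last first.
  by rewrite (belowE _ Hin).
rewrite -(pair_big_dep (fun k : 'I_ell => true) (fun (k : 'I_ell) (m : 'I_n.+1) => (l < k)%N || ((l == k) && (r < m)%N))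
   (fun (k : 'I_ell) (m : 'I_n.+1) => gfac (k, m) (pc (tlam lam l r c) - kap kappa k + m%:Z))) /=.
rewrite (bigID (fun k : 'I_ell => (l <= k)%N)) /= [X in _ * X]big1 => [|k gt]; last first.
  by apply: big_pred0 => m; rewrite -val_eqE /=; move: gt; clear; lia.
rewrite mulr1 (bigD1 l) //=; congr (_ * _).
  rewrite (eq_bigl (fun m : 'I_n.+1 => (r.+1 <= m)%N)) => [|m]; last by rewrite ltnn eqxx.
  rewrite pcontE // kapE /gfac /=.
  rewrite (eq_bigr (fun m : 'I_n.+1 => qn (c%:Z - r%:Z + (nat_of_ord m)%:Z) /
     (if (m < n)%N then qn (c%:Z - r%:Z + m.+1%:Z) else 1))) => [|m _]; last first.
    by congr (qn _ / _); [lia | case: ifP => // _; congr qn; lia].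
  rewrite (prod_telescope (h := fun m : nat => qn (c%:Z - r%:Z + m%:Z))) //; last first.
    by move=> k Hk; rewrite qn_eq0; apply/eqP; lia.
  by congr qn; lia.
apply: eq_big => [k|k /andP[le neq]]; first by rewrite -val_eqE /=; clear; lia.
have lt : (l < k)%N by move: neq le; rewrite -val_eqE /=; clear; lia.
rewrite (eq_bigl (fun m : 'I_n.+1 => (0 <= m)%N)) => [|m]; last by rewrite lt.
have gap : 0 < pc (tlam lam l r c) - kap kappa k.
  have := @kap_gap _ _ _ Hkappa l k; rewrite lt ltn_ord pcontE // kapE => /(_ isT).
  have := inmp_row_lt Hlam Hin; rewrite kapE; clear; lia.
rewrite /gfac /=.
rewrite (eq_bigr (fun m : 'I_n.+1 => qn (pc (tlam lam l r c) - kap kappa k + (nat_of_ord m)%:Z) /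
     (if (m < n)%N then qn (pc (tlam lam l r c) - kap kappa k + m.+1%:Z) else 1))) => [|m _]; last first.
  by congr (_ / _); case: ifP => // _; congr qn; lia.
rewrite (prod_telescope (h := fun m : nat => qn (pc (tlam lam l r c) - kap kappa k + m%:Z))) //; last first.
  by move=> m Hm; rewrite qn_eq0; apply/eqP; move: gap; clear; lia.
by congr qn; lia.
Qed.

Lemma ueig_one : ueig kappa lam lam (1%g : 'S_n) =
  \prod_(i < n) \prod_(l < ell | (l.+1 < ell)%N && (i < asum lam l)%N) qn (pc i - kap kappa l.+1).
Proof.
rewrite (exchange_big_dep (fun l : 'I_ell => (l.+1 < ell)%N)) /=; last by move=> i l _ /andP[].
apply: eq_bigr => l lt_l; rewrite (big_ord_widen n (fun r => qn (econt kappa lam (1%g : 'S_n) r - kap kappa l.+1))).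
  apply: eq_big => [i|i _]; first by rewrite lt_l.
  by rewrite /econt Std1 // invg1 pnat1.
exact: asum_le.
Qed.

Lemma gamf_one : gamf kappa lam (1%g : 'S_n) = gam1 n kappa lam.
Proof.
rewrite /gamf /gam1 ninv1 expr0 mul1r ueig_one poincare; last exact: colmono_rowcol.
rewrite -big_split; apply: eq_bigr => i _ /=.
have [l [r [c [Hin Ei]]]] := node_ex Hlam (ltn_ord i).
rewrite -Ei (csize_rowcol Hin) -qn_nat gp_one // mulrC; congr (_ * _).
rewrite (eq_bigl (fun k : 'I_ell => (k.+1 < ell)%N && (l <= k)%N)) => [|k]; last by rewrite (asum_lt _ Hin).
pose g k := if (l < k)%N then qn (pc (tlam lam l r c) - kap kappa k) else 1.
transitivity (\prod_(k < ell) g k).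
  by rewrite big_mkcond.
by rewrite (prod_ord_split g ell0) mul1r big_mkcondr.
Qed.
End GammaOne.

(** * Degrees *)

Section RowLengths.
Variables (ell n : nat) (kappa : 'I_ell -> int) (d : 'I_ell -> nat -> nat).
Hypothesis d_anti : forall l r, (d l r.+1 <= d l r)%N.
Hypothesis d_le : forall l r, (d l r <= n)%N.
Hypothesis d_out : forall l r, (n <= r)%N -> d l r = 0%N.
Implicit Types (l k : 'I_ell) (r c s e : nat).

Definition row_diag : diag ell := fun l r c => (c < d l r)%N.
Local Notation D := row_diag.

Definition addrow l r : bool := (r == 0)%N || (d l r < d l r.-1)%N.
Definition remrow l r : bool := (d l r.+1 < d l r)%N.

Lemma addD_row k r c (x : node ell n) :
  addD D x k r c = (c < d k r)%N || [&& k == x.1.1, r == x.1.2 & c == x.2].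
Proof. by rewrite /addD /= !xpair_eqE val_eqE andbA. Qed.

Lemma delD_row k r c (x : node ell n) :
  delD D x k r c = (c < d k r)%N && ~~ [&& k == x.1.1, r == x.1.2 & c == x.2].
Proof. by rewrite /delD /= !xpair_eqE val_eqE andbA. Qed.

Lemma addableP (x : 'I_ell * 'I_n.+1) (c : 'I_n.+1) :
  addable D (x, c) = (c == d x.1 x.2 :> nat) && addrow x.1 x.2.
Proof.
case: x => l r; apply/andP/andP => /= [[nin /forallP H] | [/eqP Ec add]].
  rewrite /D -leqNgt in nin.
  have := H (l, r, c); rewrite /= addD_row /= !eqxx orbT /= => /andP[H1 H2].
  have Ec : c = d l r :> nat.
    apply/eqP; rewrite eqn_leq nin andbT; case/orP: H2 => [/eqP->//|].
    rewrite addD_row /= !eqxx /=; case: (nat_of_ord c) => // m.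
    by rewrite /= (ltn_eqF (ltnSn m)) orbF.
  split; first by apply/eqP.
  case/orP: H1 => [E0|]; first by rewrite /addrow E0.
  rewrite addD_row /= /addrow -Ec; case: (nat_of_ord r) => // m /=.
  by rewrite (ltn_eqF (ltnSn m)) /= andbF orbF.
split; first by rewrite /D -leqNgt Ec.
apply/forallP => -[[k s] e]; apply/implyP; rewrite !addD_row /= => /orP[lt | /and3P[/eqP-> /eqP-> /eqP->]].
  rewrite (leq_ltn_trans (leq_pred _) lt) /= !orbT andbT.
  case: (nat_of_ord s) lt => //= m lt; by rewrite (leq_trans lt (d_anti _ _)) ?orbT.
case/orP: add => [->|lt] /=.
  by rewrite Ec; case: (d l r) => //= m; rewrite ltnSn ?orbT.
by rewrite Ec lt !orbT /=; case: (d l r) => //= m; rewrite ltnSn ?orbT.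
Qed.

Lemma removableP (x : 'I_ell * 'I_n.+1) (c : 'I_n.+1) :
  removable D (x, c) = (c.+1 == d x.1 x.2 :> nat) && remrow x.1 x.2.
Proof.
case: x => l r; apply/andP/andP => /= [[lt /forallP H] | [/eqP Ec rem]].
  rewrite /D in lt.
  have Ec : c.+1 = d l r.
    apply/eqP; rewrite eqn_leq lt leqNgt; apply/negP => lt'.
    have ln : (c.+1 < n.+1)%N by rewrite ltnS; apply: leq_trans (d_le l r); apply: ltnW.
    have := H (l, r, Ordinal ln); rewrite /= !delD_row /= lt' !eqxx /= andbF andbF.
    by rewrite eqn_leq ltnn.
  split; first by apply/eqP.
  rewrite /remrow -Ec ltnS leqNgt; apply/negP => lt'.
  have ln : (r.+1 < n.+1)%N.
    by rewrite ltnS ltnNge; apply/negP => ge; move: lt'; rewrite d_out // (leq_trans ge).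
  have := H (l, Ordinal ln, c); rewrite /= !delD_row /= lt' !eqxx /= andbF.
  by rewrite gtn_eqF.
split; first by rewrite /D -Ec.
apply/forallP => -[[k s] e]; apply/implyP; rewrite !delD_row /= => /andP[lt neq].
apply/andP; split.
  case: s lt neq => -[//|s] ls /= lt neq; rewrite (leq_trans lt (d_anti _ _)) /=.
  apply/negP => /and3P[/eqP Ek /eqP Es /eqP Ee]; move: lt rem Ec; rewrite Ek Ee Es /remrow; clear; lia.
case: e lt neq => -[//|e] le /= lt neq; rewrite (ltnW lt) /=.
apply/negP => /and3P[/eqP Ek /eqP Es /eqP Ee]; move: lt; rewrite Ek Es Ee -Ec; lia.
Qed.

Variables (l : 'I_ell) (r c : nat) (e : nat).
Hypothesis lr : (r < n)%N.
Hypothesis lc : (c < n)%N.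
Hypothesis dl : d l r = c.+1.
Hypothesis dlS : (d l r.+1 <= c)%N.
Hypothesis e2 : (1 < e)%N.
Let A : node ell n := (l, inord r, inord c).
Let cA : int := kappa l + c%:Z - r%:Z.

(** The content of the first free node of the row. The last occupied node has content one less,
    hence the + 1 in [res1]. *)
Definition rcont k s : int := kappa k + (d k s)%:Z - s%:Z.
Definition rbelow k s : bool := (l < k)%N || ((l == k) && (r < s)%N).

Definition res0 k s : bool := (e%:Z %| cA - rcont k s)%Z.
Definition res1 k s : bool := (e%:Z %| cA - rcont k s + 1)%Z.

Let Ar : nat_of_ord (inord r : 'I_n.+1) = r. Proof. by rewrite inordK //; lia. Qed.
Let Ac : nat_of_ord (inord c : 'I_n.+1) = c. Proof. by rewrite inordK //; lia. Qed.

Lemma ndvd1 : (e%:Z %| 1)%Z = false.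
Proof. by rewrite dvdz1 /= eqn_leq leqNgt e2. Qed.

(** A row has at most one addable and at most one removable node, so counting nodes reduces to
    counting rows. *)
Lemma card_node (P : pred (node ell n)) (Q : 'I_ell -> nat -> bool) :
  (forall x, exists f : 'I_n.+1, forall b, P (x, b) = (b == f) && Q x.1 x.2) ->
  #|P| = (\sum_k \sum_(s < n.+1) Q k s)%N.
Proof.
move=> H; rewrite -sum1_card (eq_bigl (fun y : node ell n => P (y.1, y.2))) => [|[x y] //].
rewrite -(pair_big_dep (fun x => true) (fun x b => P (x, b)) (fun _ _ => 1%N)) /=.
rewrite pair_big /=; apply: eq_bigr => x _; have [f Hf] := H x.
rewrite (eq_bigl _ _ (Hf)); case: (Q _ _); last by rewrite big_pred0 // => b; rewrite andbF.
by rewrite (big_pred1 f) // => b; rewrite andbT.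
Qed.

Lemma card_addable : #|[pred B : node ell n | nlt A B && same_res kappa e A B && addable D B]| =
  (\sum_k \sum_(s < n.+1) [&& rbelow k s, addrow k s & res0 k s])%N.
Proof.
rewrite (card_node (Q := fun (k : 'I_ell) (s : nat) => [&& rbelow k s, addrow k s & res0 k s])) //.
move=> x; have lt : (d x.1 x.2 < n.+1)%N by rewrite ltnS.
exists (Ordinal lt) => b; rewrite !inE addableP -[b == _]val_eqE /=.
case: eqP => [E|_]; last by rewrite andbF.
case: x lt E => k s /= lt E; rewrite /nlt /same_res /content /A Ar Ac E /rbelow /res0 /res1 /rcont -/cA /=.
case: (ltngtP l k) => [lk|lk|/val_inj El]; rewrite ?andbA //=.
- by rewrite andbC.
- by rewrite -val_eqE gtn_eqF.
subst k; rewrite eqxx /=; case: ltngtP => //= Es; first by rewrite andbC.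
(* The node to the right of A is below A lexicographically, but its content is larger by one, so its
   residue differs as e > 1. Thus only rows strictly below matter. *)
rewrite -Es dl ltnSn /=.
have -> : cA - (kappa l + c.+1%:Z - r%:Z) = - 1 by rewrite /cA; lia.
by have -> : (e%:Z %| -1)%Z = (e%:Z %| 1)%Z by []; rewrite ndvd1.
Qed.

Lemma card_removable : #|[pred B : node ell n | nlt A B && same_res kappa e A B && removable D B]| =
  (\sum_k \sum_(s < n.+1) [&& rbelow k s, remrow k s & res1 k s])%N.
Proof.
rewrite (card_node (Q := fun (k : 'I_ell) (s : nat) => [&& rbelow k s, remrow k s & res1 k s])) //.
move=> x; have lt : ((d x.1 x.2).-1 < n.+1)%N by rewrite ltnS (leq_trans (leq_pred _)).
exists (Ordinal lt) => b; rewrite !inE removableP -[b == _]val_eqE /=.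
case: x lt => k s /= lt; case: (boolP (remrow k s)) => [|_]; last by rewrite !andbF.
rewrite /remrow => rem; rewrite andbT.
have -> : (b.+1 == d k s) = (b == (d k s).-1 :> nat) by move: rem; case: (d k s).
have [E|_] := eqVneq (nat_of_ord b) (d k s).-1; last by rewrite andbF.
have Ed : d k s = b.+1 by rewrite E prednK //; lia.
rewrite /nlt /same_res /content /A Ar Ac E /rbelow /res0 /res1 /rcont -/cA /= Ed /=.
have -> : kappa k + b.+1%:Z - s%:Z = kappa k + b%:Z - s%:Z + 1 by lia.
have -> : cA - (kappa k + b%:Z - s%:Z + 1) + 1 = cA - (kappa k + b%:Z - s%:Z) by lia.
case: (ltngtP l k) => [lk|lk|/val_inj El]; rewrite ?andbT //=.
  by rewrite -val_eqE gtn_eqF.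
subst k; rewrite eqxx /=; case: ltngtP => //= Es; rewrite ?andbT //.
by move: Ed; rewrite -Es dl => -[->]; rewrite ltnn.
Qed.

(* A row s+1 is addable unless it is as long as row s, in which case row s is not removable
   and the two terms cancel. *)
Lemma dAE : dA kappa e D A = \sum_k \sum_(s < n.+1 | rbelow k s)
  ((res0 k s : nat)%:Z - ((s < n)%N && res1 k s : nat)%:Z).
Proof.
rewrite /dA card_addable card_removable.
apply/eqP; rewrite subr_eq; apply/eqP.
rewrite !(big_morph Posz PoszD (erefl _)) -big_split; apply: eq_bigr => k _ /=.
rewrite [X in _ = X + _]big_mkcond !(big_morph Posz PoszD (erefl _)) -big_split /=.
pose G s : nat := [&& rbelow k s, ~~ addrow k s & res0 k s].
pose H s : nat := [&& rbelow k s, (s < n)%N, ~~ remrow k s & res1 k s].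
have GH : \sum_(s < n.+1) (G s)%:Z = \sum_(s < n.+1) (H s)%:Z.
  rewrite big_ord_recl [RHS]big_ord_recr /= {1}/G /addrow eqxx andbF add0r.
  rewrite [X in _ = _ + X](_ : _ = 0) ?addr0; last by rewrite /H ltnn andbF.
  apply: eq_bigr => s _; congr (_%:Z); rewrite /G /H /bump /= add1n /addrow /remrow /= ltn_ord /=.
  have := d_anti k s; rewrite leq_eqVlt => /orP[/eqP E|->]; last by rewrite !andbF.
  rewrite E !ltnn /= ; congr (nat_of_bool (_ && _)); last first.
    by rewrite /res0 /res1 /rcont E; congr (_ %| _)%Z; lia.
  (* The shift from s to s+1 could enter the range below A only at s = r, but row r is strictly
     longer than row r+1. *)
  rewrite /rbelow; case: eqP => [Ek|_]; last by rewrite !andFb.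
  subst k; rewrite ltnn /= ltnS leq_eqVlt; case: eqP => [Es|//]; exfalso.
  by move: E dlS dl; rewrite -Es => -> /[swap] ->; rewrite ltnn.
apply/eqP; rewrite -subr_eq0 -sumrB; apply/eqP.
transitivity (\sum_(s < n.+1) ((H s)%:Z - (G s)%:Z)); last by rewrite sumrB GH subrr.
apply: eq_bigr => s _; rewrite /G /H.
have rem_n : remrow k s -> (s < n)%N.
  by move=> rem; rewrite ltnNge; apply/negP => /d_out E; move: rem; rewrite /remrow E.
move: rem_n; case: (rbelow k s); case: (addrow k s); case: (remrow k s) => //=;
case: (s < n)%N; case: (res0 k s); case: (res1 k s) => //= H0;
by have := H0 isT.
Qed.
End RowLengths.

Lemma down_closed_card n (P : nat -> bool) : (forall c, P c -> (c < n)%N) ->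
  (forall c, P c.+1 -> P c) -> exists m, (m <= n)%N /\ forall c, P c = (c < m)%N.
Proof.
move=> lt down; have ex : exists m, ~~ P m by exists n; apply/negP => /lt; rewrite ltnn.
case: (ex_minnP ex) => m nP min_m; exists m; split.
  by apply: min_m; apply/negP => /lt; rewrite ltnn.
have downs c k : P (c + k)%N -> P c by elim: k => [|k IH]; rewrite ?addn0 // addnS => /down/IH.
move=> c; apply/idP/idP => [Pc | lt_c].
  rewrite ltnNge; apply/negP => le; move/negP: nP; apply; apply: (downs _ (c - m)%N).
  by rewrite subnKC.
by apply/negPn/negP => /min_m; rewrite leqNgt lt_c.
Qed.

Section Degrees.
Variables (ell n : nat) (kappa : 'I_ell -> int).
Variable lam : mpart ell.
Hypothesis Hlam : is_mpart n lam.
Implicit Types (l k : 'I_ell) (r c i j p s m : nat) (u v w : 'S_n) (x : 'I_ell * 'I_n.+1).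

Local Notation pc := (pcont n kappa lam).
Local Notation Std := (Std n lam).

(** The exponent of Phi_e in [gp u i], in the same all-rows form, so that the comparison with [dA]
    reduces to [dAE]. *)
Definition degp e u i : int := \sum_(x | below lam i x)
  (((e%:Z %| pc i - xc kappa lam u i x)%Z : nat)%:Z -
   ((x.2 < n)%N && (e%:Z %| pc i - xc kappa lam u i x + 1)%Z : nat)%:Z).

Section Step.
Variables (u : 'S_n) (l : 'I_ell) (r c : nat).
Hypothesis Hu : u \in Std.
Hypothesis Hin : inmp lam l r c.
Local Notation i := (tlam lam l r c).

Let P k s c' := inmp lam k s c' && (pnat u (tlam lam k s c') <= pnat u i)%N.

Definition dn k s : nat := #|[pred p : 'I_n | (tlam lam k s 0 <= p < tlam lam k s 0 + nth 0%N (lam k) s)%N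
  && (pnat u p <= pnat u i)%N]|.

(** By standardness the nodes of a row filled so far form an initial segment, which puts the
    subtableau in the form [row_diag]. *)
Lemma dnE k s c' : P k s c' = (c' < dn k s)%N.
Proof.
have [m [le_m Hm]] : exists m, (m <= n)%N /\ forall c', P k s c' = (c' < m)%N.
  apply: down_closed_card => [e /andP[/(inmp_col_lt Hlam)]|e /andP[He le]] //.
  have He' := inmp_left Hlam (leqnSn _) He; rewrite /P He' (leq_trans _ le) //.
  by have /(StdP Hlam)/(_ _ _ _ He')[/(_ He)/ltnW] := Hu.
rewrite Hm; congr (_ < _)%N; have le_len : (m <= nth 0 (lam k) s)%N.
  case: m Hm {le_m} => // m /(_ m); rewrite ltnSn => /andP[]; by rewrite /inmp.
have le_n : (tlam lam k s 0 + m <= n)%N.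
  case: m Hm {le_m le_len} => [_|m Hm].
    rewrite tlamE; have := sum_mp_pre lam k; rewrite (sum_mp Hlam) => le.
    have := psum_le_sumn (lam k) s; move: le; clear; lia.
  have : P k s m by rewrite Hm.
  by case/andP => /(tlam_lt_n Hlam); rewrite !tlamE; clear; lia.
have -> : m = (tlam lam k s 0 + m - tlam lam k s 0)%N by clear; lia.
rewrite -(card_interval _ le_n); apply: eq_card => p; rewrite !inE.
apply/andP/andP => [[le lt]|[/andP[le lt] le_u]].
  rewrite le; have Ep : nat_of_ord p = tlam lam k s (p - tlam lam k s 0) by move: le; rewrite !tlamE; clear; lia.
  have : P k s (p - tlam lam k s 0) by rewrite Hm; move: lt le; clear; lia.
  by rewrite /P -Ep => /andP[_ ->]; split=> //; move: lt le_len; clear; lia.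
split=> //; have Ep : nat_of_ord p = tlam lam k s (p - tlam lam k s 0) by move: le; rewrite !tlamE; clear; lia.
have : P k s (p - tlam lam k s 0).
  by rewrite /P -Ep le_u andbT /inmp; move: le lt; clear; lia.
by rewrite Hm; move: le; clear; lia.
Qed.

Lemma dn_anti k s : (dn k s.+1 <= dn k s)%N.
Proof.
rewrite leqNgt; apply/negP => lt.
have : P k s.+1 (dn k s) by rewrite dnE.
case/andP => He le; have He' := inmp_up Hlam (leqnSn _) He.
have : P k s (dn k s).
  rewrite /P He' (leq_trans _ le) //.
  by have /(StdP Hlam)/(_ _ _ _ He')[_ /(_ He)/ltnW] := Hu.
by rewrite dnE ltnn.
Qed.

Lemma dn_le k s : (dn k s <= n)%N.
Proof. by apply: leq_trans (max_card _) _; rewrite card_ord. Qed.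

Lemma dn_out k s : (n <= s)%N -> dn k s = 0%N.
Proof.
move=> le; case E : (dn k s) => [//|m]; have : P k s 0 by rewrite dnE E.
by case/andP => /(inmp_row_lt Hlam); rewrite ltnNge le.
Qed.

Lemma dn_self : dn l r = c.+1.
Proof.
apply/eqP; rewrite eqn_leq -dnE /P Hin leqnn leqNgt -dnE /P !andbT.
apply/negP => /andP[Hin'].
have /(StdP Hlam)/(_ _ _ _ Hin)[/(_ Hin')] := Hu; clear; lia.
Qed.

Lemma dn_selfS : (dn l r.+1 <= c)%N.
Proof.
rewrite leqNgt -dnE /P; apply/negP => /andP[Hin'].
have /(StdP Hlam)/(_ _ _ _ Hin)[_ /(_ Hin')] := Hu; clear; lia.
Qed.

Lemma cn_dn x : below lam i x -> cn lam u i x = dn x.1 x.2.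
Proof.
move=> Hx; apply: eq_card => p; rewrite !inE -/(inrow lam x p).
case Hp : (inrow lam x p) => //=; rewrite [in RHS]leq_eqVlt; case: eqP => // /pnat_inj E.
by move: Hx Hp; rewrite /below /inrow E => lt /andP[le _]; move: lt le; clear; lia.
Qed.

Lemma dA_degp e : (1 < e)%N ->
  dA kappa e (fun k s c' => inmp lam k s c' && (tabw lam u k s c' <= pnat u i)%N)
    (l, inord r, inord c : 'I_n.+1) = degp e u i.
Proof.
move=> e2; have -> : (fun k s c' => inmp lam k s c' && (tabw lam u k s c' <= pnat u i)%N) = row_diag dn.
  by apply/funext => k; apply/funext => s; apply/funext => c'; apply: dnE.
rewrite (dAE kappa dn_anti dn_le dn_out) //; last 4 first.
- exact: (inmp_row_lt Hlam Hin).
- exact: (inmp_col_lt Hlam Hin).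
- exact: dn_self.
- exact: dn_selfS.
rewrite (pair_big_dep (fun k => true) (fun k (s : 'I_n.+1) => rbelow l r k s)) /=.
apply: eq_big => [x|x Hx]; first by rewrite (belowE _ Hin).
have Hx' : below lam i x by rewrite (belowE _ Hin).
by rewrite /res0 /res1 /rcont /xc cn_dn // pcontE.
Qed.
End Step.

Lemma deg_tabE e u : u \in Std -> (1 < e)%N ->
  deg_tab n kappa e lam (tabw lam u) n = \sum_(i < n) degp e u i.
Proof.
move=> Hu e2.
pose g m := match [pick x : node ell n | innode (inmp lam) x && (let: (l, r, c) := x in tabw lam u l r c == m)] with
    | Some A => dA kappa e (fun l r c => inmp lam l r c && (tabw lam u l r c <= m)%N) A
    | None => 0
    end.
have gE m : deg_tab n kappa e lam (tabw lam u) m = \sum_(i < m) g i.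
  by elim: m => [|m IH]; rewrite ?big_ord0 // big_ord_recr /= IH.
rewrite gE (reindex_inj (@perm_inj _ u)); apply: eq_bigr => i _.
have [l [r [c [Hin Ei]]]] := node_ex Hlam (ltn_ord i).
rewrite -pnat_ord -Ei /g (@pick_node _ _ _ Hlam (tabw lam u) l r c Hin).
  exact: dA_degp.
by move=> l' r' c' Hin' /pnat_inj /(tlam_inj Hin' Hin).
Qed.
End Degrees.

(** * Quantum integers as products of cyclotomic polynomials *)

Definition phiF (e : nat) : F := FracField.tofrac 'Phi_e.

Lemma phiF_neq0 e : phiF e != 0.
Proof. by rewrite /phiF tofrac_eq0 monic_neq0 // Cyclotomic_monic. Qed.

Lemma prod_phiF m N : (0 < m < N)%N -> tF ^+ m - 1 = \prod_(1 <= e < N | (e %| m)%N) phiF e.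
Proof.
move=> /andP[m0 lt]; rewrite /tF -tofracXn -tofrac1 -tofracB -prod_Cyclotomic // rmorph_prod.
rewrite -[RHS]big_filter; apply: perm_big; apply: uniq_perm.
- exact: divisors_uniq.
- by rewrite filter_uniq ?iota_uniq.
move=> d; rewrite -dvdn_divisors // mem_filter mem_index_iota.
by case: (boolP (d %| m)%N) => //= dv; have := dvdn_leq m0 dv; have := dvdn_gt0 m0 dv; lia.
Qed.

Lemma qn_phi (k : int) N : 0 < k < N%:Z ->
  qn k = \prod_(2 <= e < N) phiF e ^ ((e%:Z %| k)%Z : nat)%:Z.
Proof.
case: k => // m Hm; have lt : (0 < m < N)%N by lia.
have E1 : phiF 1 = tF - 1.
  have := @prod_phiF 1 2 isT; rewrite expr1 => ->.
  by rewrite big_mkcond big_nat1.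
rewrite /qn -exprnP (prod_phiF lt) -E1 big_mkcond big_ltn; last by lia.
rewrite dvd1n mulrAC divff ?mul1r ?phiF_neq0 //; apply: eq_big_nat => e _.
by rewrite dvdzE /=; case: (e %| m)%N; rewrite ?expr0z ?expr1z.
Qed.

Lemma expfz_sum (K : fieldType) (a : K) (I : Type) (s : seq I) (P : pred I) (f : I -> int) :
  a != 0 -> a ^ (\sum_(i <- s | P i) f i) = \prod_(i <- s | P i) a ^ f i.
Proof.
move=> nz; elim: s => [|i s IH]; first by rewrite !big_nil expr0z.
by rewrite !big_cons; case: (P i); rewrite ?IH // expfzDr ?IH.
Qed.

Lemma prod_nat_ext (K : comNzRingType) (f : nat -> K) N M : (N <= M)%N ->
  (forall e, (N <= e)%N -> f e = 1) -> \prod_(2 <= e < M) f e = \prod_(2 <= e < N) f e.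
Proof.
move=> le f1; rewrite (big_nat_widen _ _ _ _ _ le) [RHS]big_mkcond; apply: eq_bigr => e _.
by case: ltnP => //= ge; rewrite f1.
Qed.

Lemma gfac_phi n (ell : nat) (x : 'I_ell * 'I_n.+1) (k : int) N : 0 < k -> k + 1 < N%:Z ->
  gfac x k = \prod_(2 <= e < N) phiF e ^
    (((e%:Z %| k)%Z : nat)%:Z - ((x.2 < n)%N && (e%:Z %| k + 1)%Z : nat)%:Z).
Proof.
move=> k0 lt; rewrite /gfac (@qn_phi k N); last by rewrite k0; lia.
have -> : (if (x.2 < n)%N then qn (k + 1) else 1) =
    \prod_(2 <= e < N) phiF e ^ ((x.2 < n)%N && (e%:Z %| k + 1)%Z : nat)%:Z.
  case: ifP => _ /=; last by rewrite big1 // => e _; rewrite expr0z.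
  by rewrite (@qn_phi (k + 1) N) // lt andbT; lia.
rewrite -prodf_div; apply: eq_bigr => e _.
by rewrite expfzDr ?phiF_neq0 // -invr_expz.
Qed.

(** * Cyclotomic factorisation of the norms *)

Section DegreeFormula.
Variables (ell n : nat) (kappa : 'I_ell -> int).
Hypothesis Hkappa : forall l : 'I_ell, (l.+1 < ell)%N -> n%:Z < kappa l - kap kappa l.+1.
Variable lam : mpart ell.
Hypothesis Hlam : is_mpart n lam.
Implicit Types (l k : 'I_ell) (r c i j p s m : nat) (u v w : 'S_n) (x : 'I_ell * 'I_n.+1).

Local Notation pc := (pcont n kappa lam).
Local Notation Std := (Std n lam).
Local Notation gap u i x := (pc i - xc kappa lam u i x).

(** Larger than every gap plus one, so no e from here on divides such a number; being at least 3, it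
    also ensures e > 1. *)
Definition ebound : nat :=
  (\max_(u : 'S_n) \max_(i < n) \max_(x : 'I_ell * 'I_n.+1) `|gap u i x|%N).+3.

Lemma gap_bound u (i : 'I_n) x : gap u i x + 1 < ebound%:Z.
Proof.
have le : (`|gap u i x| <= \max_(u : 'S_n) \max_(i < n) \max_(x : 'I_ell * 'I_n.+1) `|gap u i x|)%N.
  rewrite (bigD1 u) //=; apply: leq_trans (leq_maxl _ _).
  rewrite (bigD1 i) //=; apply: leq_trans (leq_maxl _ _).
  by rewrite (bigD1 x) //= leq_maxl.
by move: le; rewrite /ebound; move: (\max_(u : _) _)%N (gap u i x) => m k; clear; lia.
Qed.

Lemma degp_zero e u (i : 'I_n) : u \in Std -> (ebound <= e)%N -> degp kappa lam e u i = 0.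
Proof.
move=> Hu le; rewrite /degp big1 // => x Hx.
have pos := xc_pos Hkappa Hlam Hu (ltn_ord i) Hx; have lt := gap_bound u i x.
have ndv (k : int) : 0 < k -> k < ebound%:Z -> (e%:Z %| k)%Z = false.
  case: k => // k k0 ltk; rewrite dvdzE /= gtnNdvd //; lia.
rewrite !ndv ?andbF ?subrr //; lia.
Qed.

Lemma gp_phi u (i : 'I_n) : u \in Std ->
  gp kappa lam u i = \prod_(2 <= e < ebound) phiF e ^ degp kappa lam e u i.
Proof.
move=> Hu; rewrite /gp (eq_bigr (fun x => \prod_(2 <= e < ebound) phiF e ^
    (((e%:Z %| gap u i x)%Z : nat)%:Z - ((x.2 < n)%N && (e%:Z %| gap u i x + 1)%Z : nat)%:Z))) => [|x Hx].
  by rewrite exchange_big; apply: eq_bigr => e _; rewrite /degp expfz_sum // phiF_neq0.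
apply: gfac_phi; first exact: (xc_pos Hkappa Hlam Hu (ltn_ord i) Hx).
exact: gap_bound.
Qed.

Lemma deg_mp_zero e : (ebound <= e)%N -> deg_mp n kappa e lam = 0.
Proof.
move=> le; rewrite /deg_mp big1 // => u Hu; rewrite deg_tabE //; last by move: le; rewrite /ebound; lia.
by rewrite big1 // => i _; apply: degp_zero.
Qed.

Lemma prod_gamf : \prod_(u in Std) gamf kappa lam u =
  tF ^+ len_mp n lam * \prod_(2 <= e < ebound) phiF e ^ deg_mp n kappa e lam.
Proof.
rewrite /gamf big_split /=; congr (_ * _).
  rewrite /len_mp; under [in RHS]eq_bigr do rewrite lenE.
  by rewrite (big_morph (fun m => tF ^+ m) (exprD tF) (expr0 tF)).
rewrite (eq_bigr (fun u => \prod_(2 <= e < ebound) phiF e ^ deg_tab n kappa e lam (tabw lam u) n)) => [|u Hu].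
  by rewrite exchange_big; apply: eq_bigr => e _; rewrite /deg_mp expfz_sum // phiF_neq0.
rewrite (eq_bigr (fun i : 'I_n => \prod_(2 <= e < ebound) phiF e ^ degp kappa lam e u i)) => [|i _].
  rewrite exchange_big; apply: eq_big_nat => e /andP[e2 _].
  by rewrite deg_tabE // expfz_sum // phiF_neq0.
exact: gp_phi.
Qed.

Lemma prod_gamf_any N : (forall e, (N <= e)%N -> deg_mp n kappa e lam = 0) ->
  \prod_(u in Std) gamf kappa lam u =
    tF ^+ len_mp n lam * \prod_(2 <= e < N) phiF e ^ deg_mp n kappa e lam.
Proof.
move=> HN; rewrite prod_gamf; congr (_ * _).
rewrite -(@prod_nat_ext _ _ ebound (maxn N ebound)) ?leq_maxr // => [|e le]; last first.
  by rewrite deg_mp_zero // expr0z.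
by apply: prod_nat_ext; rewrite ?leq_maxl // => e le; rewrite HN // expr0z.
Qed.
End DegreeFormula.

(** * Gram matrices *)

Section Multipartitions.
Variables (ell n : nat).
Implicit Types (lam mu nu : mpart ell) (l : 'I_ell).

Lemma partition_ext s s' : is_partition s -> is_partition s' ->
  (forall i, nth 0%N s i = nth 0%N s' i) -> s = s'.
Proof.
move=> Hs Hs' E; apply: (@eq_from_nth _ 0%N) => [|i _]; last exact: E.
have le a b : is_partition b -> (forall i, nth 0%N a i = nth 0%N b i) -> (size b <= size a)%N.
  move=> /andP[_ /allP pos] E'; rewrite leqNgt; apply/negP => lt.
  have := pos _ (mem_nth 0%N lt); rewrite -E' nth_default //.
by apply/eqP; rewrite eqn_leq !le // => i; rewrite E.
Qed.

Lemma mpart_ext lam mu : is_mpart n lam -> is_mpart n mu ->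
  (forall l i, nth 0%N (lam l) i = nth 0%N (mu l) i) -> lam = mu.
Proof.
move=> Hlam Hmu E; apply/funext => l.
exact: (partition_ext (mp_part Hlam l) (mp_part Hmu l) (E l)).
Qed.

Lemma dom_anti lam mu : is_mpart n lam -> is_mpart n mu -> dom lam mu -> dom mu lam -> lam = mu.
Proof.
move=> Hlam Hmu d1 d2; apply/funext => l.
have [m] := ubnP (nat_of_ord l); elim: m l => // m IH l lt_m.
have Epre : pre lam l = pre mu l by apply: eq_bigr => k lt; rewrite IH //; lia.
have psum_eq i : (\sum_(j < i) nth 0 (lam l) j = \sum_(j < i) nth 0 (mu l) j)%N.
  case: i => [|i]; first by rewrite !big_ord0.
  have := d1 l i; have := d2 l i; rewrite /domsum -!/(pre _ l) Epre !leq_add2l; lia.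
apply: (partition_ext (mp_part Hlam l) (mp_part Hmu l)) => i.
by have := psum_eq i.+1; rewrite !psumS psum_eq => /addnI.
Qed.

Lemma dom_trans lam mu nu : dom lam mu -> dom mu nu -> dom lam nu.
Proof. by move=> d1 d2 l i; apply: leq_trans (d2 l i) (d1 l i). Qed.

Lemma row_out lam l i : is_mpart n lam -> (n <= i)%N -> nth 0%N (lam l) i = 0%N.
Proof.
move=> Hlam le; case E : (nth 0%N (lam l) i) => [//|m].
have /(inmp_row_lt Hlam) : inmp lam l i 0 by rewrite /inmp E.
by rewrite ltnNge le.
Qed.

(** A rank function for dominance: by [domsize_dom] it strictly increases on multipartitions of n.
    It serves to choose a minimal shape in [coef_dom]. *)
Definition domsize lam : nat := (\sum_l \sum_(i < n.+1) domsum lam l i)%N.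

Lemma domsize_dom lam mu : is_mpart n lam -> is_mpart n mu -> dom lam mu ->
  (domsize lam <= domsize mu)%N -> dom mu lam.
Proof.
move=> Hlam Hmu d le.
have lei l (i : 'I_n.+1) : (domsum mu l i <= domsum lam l i)%N by apply: d.
have E l (i : 'I_n.+1) : domsum lam l i = domsum mu l i.
  apply/eqP; rewrite eqn_leq lei andbT leqNgt; apply/negP => lt.
  move: le; rewrite leqNgt => /negP[]; rewrite /domsize (bigD1 l) //= [X in (_ < X)%N](bigD1 l) //=.
  rewrite -addSn leq_add //; last by apply: leq_sum => k _; apply: leq_sum.
  rewrite (bigD1 i) //= [X in (_ < X)%N](bigD1 i) //= -addSn leq_add //.
  by apply: leq_sum => j _; apply: lei.
have stable nu l i : is_mpart n nu -> (n <= i)%N -> domsum nu l i = domsum nu l n.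
  move=> Hnu; elim: i => [|i IH] le_i; first by have -> : n = 0%N by lia.
  move: le_i; rewrite leq_eqVlt => /orP[/eqP->//|le_i].
  by rewrite -(IH le_i) /domsum psumS (row_out l Hnu (leqW le_i)) addn0.
move=> l i; have [lt|ge] := ltnP i n.+1; first by rewrite (E l (Ordinal lt)).
rewrite (stable _ _ _ Hlam (ltnW ge)) (stable _ _ _ Hmu (ltnW ge)).
by rewrite (E l ord_max).
Qed.

(* multipartitions of n, coded in a finite type *)
Definition mcode := {ffun 'I_ell * 'I_n -> 'I_n.+1}.
Definition code lam : mcode := [ffun x : 'I_ell * 'I_n => inord (nth 0%N (lam x.1) x.2)].

Lemma code_inj lam mu : is_mpart n lam -> is_mpart n mu -> code lam = code mu -> lam = mu.
Proof.
move=> Hlam Hmu E; apply: mpart_ext => // l i.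
have [lt|ge] := ltnP i n; last by rewrite !row_out.
have len nu : is_mpart n nu -> (nth 0%N (nu l) i < n.+1)%N.
  move=> Hnu; have := psum_le_sumn (nu l) i.+1; rewrite psumS.
  have := sumn_le_n Hnu l; clear; lia.
have := congr1 (fun f : mcode => nat_of_ord (f (l, Ordinal lt))) E.
by rewrite !ffunE /= !inordK ?len.
Qed.

Definition valid (k : mcode) : Prop := exists lam, is_mpart n lam /\ code lam = k.
Definition dec (k : mcode) : mpart ell :=
  if pselect (valid k) is left H then sval (cid H) else fun=> [::].

Lemma decP k : valid k -> is_mpart n (dec k) /\ code (dec k) = k.
Proof. by rewrite /dec; case: pselect => // H _; case: cid => lam /= []. Qed.

Lemma decK lam : is_mpart n lam -> dec (code lam) = lam.
Proof.
move=> Hlam; have [|Hd Ed] := @decP (code lam); first by exists lam.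
exact: code_inj.
Qed.
End Multipartitions.

Section AlgebraMorphism.
Variables (A B : algType O) (f : {lrmorphism A -> B}).

Lemma lrM x y : f (x * y) = f x * f y. Proof. exact: rmorphM. Qed.
Lemma lrB x y : f (x - y) = f x - f y. Proof. exact: rmorphB. Qed.
Lemma lr1 : f 1 = 1. Proof. exact: rmorph1. Qed.
Lemma lrZ c x : f (c *: x) = c *: f x. Proof. exact: linearZ. Qed.
Lemma lr_sum (I : Type) (e : seq I) (P : pred I) (g : I -> A) :
  f (\sum_(i <- e | P i) g i) = \sum_(i <- e | P i) f (g i).
Proof. exact: rmorph_sum. Qed.
Lemma lr_prod (I : Type) (e : seq I) (P : pred I) (g : I -> A) :
  f (\prod_(i <- e | P i) g i) = \prod_(i <- e | P i) f (g i).
Proof. exact: rmorph_prod. Qed.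
End AlgebraMorphism.

Section MorphismImage.
Variables (ell n : nat) (kappa : 'I_ell -> int) (A B : algType O).
Variables (L T : nat -> A) (L' T' : nat -> B) (f : {lrmorphism A -> B}).
Hypothesis HA : hecke_rel n kappa L T.
Hypothesis HB : hecke_rel n kappa L' T'.
Hypothesis fL : forall r, (r < n)%N -> f (L r) = L' r.
Hypothesis fT : forall r, (r.+1 < n)%N -> f (T r) = T' r.

Lemma morph_Tw w : f (Tw T w) = Tw T' (w : 'S_n).
Proof.
elim/perm_ind: w => [|r w lr asc IH]; first by rewrite !Tw1 lr1.
by rewrite -(Tw_asc (hecke_typeA HA)) // -(Tw_asc (hecke_typeA HB)) // lrM IH fT.
Qed.

Lemma morph_m lam : is_mpart n lam -> f (m_mp n kappa L T lam) = m_mp n kappa L' T' lam.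
Proof.
move=> Hlam; rewrite /m_mp lrM; congr (_ * _).
  rewrite /u_mp lr_prod; apply: eq_bigr => l _; rewrite lr_prod; apply: eq_bigr => r _.
  rewrite lrM lrB !lrZ !lr1 fL //.
  by apply: leq_trans (ltn_ord r) _; apply: asum_le.
by rewrite /x_mp lr_sum; apply: eq_bigr => w _; rewrite morph_Tw.
Qed.

Lemma morph_murphy lam u v : is_mpart n lam ->
  f (murphy kappa L T lam u v) = murphy kappa L' T' lam u (v : 'S_n).
Proof. by move=> Hlam; rewrite /murphy 2!lrM !morph_Tw morph_m. Qed.
End MorphismImage.

Lemma gram_aux (K : fieldType) (a g c : K) : a != 0 -> a * g * 1 + -1 * (c * (a * 1)) = 0 -> c = g.
Proof.
move=> nz E; apply: (mulfI nz); apply/eqP; rewrite eq_sym -subr_eq0; apply/eqP.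
by rewrite -E; ring.
Qed.

Section GramMatrix.
Variables (ell n : nat) (kappa : 'I_ell -> int).
Hypothesis ell0 : (0 < ell)%N.
Hypothesis Hkappa : forall l : 'I_ell, (l.+1 < ell)%N -> n%:Z < kappa l - kap kappa l.+1.
Variables (H : algType O) (L T : nat -> H).
Hypothesis HH : is_hecke n kappa L T.
Implicit Types (lam mu nu : mpart ell) (u v w s t : 'S_n).

Local Notation murphyH := (murphy kappa L T).
Local Notation gam mu := (gamf kappa mu).
Local Notation fm mu := (form mu (gam mu)).
Local Notation av mu := (avec kappa mu).

Definition rep_of mu (f : {lrmorphism H -> MF (pdim n)}) : Prop :=
  forall nu u v, is_mpart n nu ->
    f (murphyH nu u v) = murphy kappa (Lm n kappa mu) (Tm n kappa mu) nu u v.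

Lemma ex_rep mu : is_mpart n mu -> exists f, rep_of mu f.
Proof.
move=> Hmu; have HB := seminormal_rel Hkappa Hmu ell0.
case: HH => HA /(_ _ _ _ HB)[[f [fL fT]] _]; exists f => nu u v Hnu.
exact: morph_murphy.
Qed.

Section Rep.
Variables (mu : mpart ell) (f : {lrmorphism H -> MF (pdim n)}).
Hypothesis Hmu : is_mpart n mu.
Hypothesis Hf : rep_of mu f.
Implicit Types x : 'rV[F]_(pdim n).+1.

Lemma rep_zero nu u v x : is_mpart n nu -> std_supp mu x -> ~ dom mu nu ->
  x *m f (murphyH nu u v) = 0.
Proof.
move=> Hnu Hx ndom; rewrite Hf // /murphy 2!rowM.
have Hx' := @sup_TT _ _ _ ell0 Hkappa _ Hmu u^-1%g _ Hx.
have [->|nz] := eqVneq (x *m Tw (Tm n kappa mu) u^-1%g *m m_mp n kappa (Lm n kappa mu) (Tm n kappa mu) nu) 0.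
  by rewrite mul0mx.
by case: ndom; apply: (image_dom ell0 Hkappa Hmu Hnu Hx' nz).
Qed.

Lemma rep_act u v x : std_supp mu x -> x *m f (murphyH mu u v) = fm mu x (av mu u) *: av mu v.
Proof.
move=> Hx; rewrite Hf //; apply: (murphy_act ell0 Hkappa Hmu _ _ _ _ _ Hx).
- by move=> *; apply: (gamf_step Hkappa Hmu).
- exact: (gamf_one ell0 Hkappa Hmu).
- by move=> *; apply: (gamf_neq0 Hkappa Hmu).
Qed.

Lemma rep_mul s t x : std_supp mu x ->
  x *m f (murphyH mu 1%g s * murphyH mu t 1%g) =
  (fm mu x (av mu 1%g) * fm mu (av mu s) (av mu t)) *: av mu 1%g.
Proof.
move=> Hx; have Hs : std_supp mu (av mu s) by apply: (sup_av ell0 Hkappa Hmu).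
rewrite lrM rowM (rep_act _ _ Hx) rowZl (rep_act _ _ Hs); exact: scalerA.
Qed.

Lemma rep_above x y : in_Habove n kappa L T mu y -> std_supp mu x -> x *m f y = 0.
Proof.
move=> [k [nu [u [v [c [Hnu ->]]]]]] Hx; rewrite lr_sum row_sum big1 // => i _.
have [Hi [d [l neq]] _ _] := Hnu i.
rewrite lrZ rowZ rep_zero ?scaler0 // => d'.
by move/eqP: neq; apply; rewrite (dom_anti Hi Hmu d d').
Qed.
End Rep.

(** The defining congruence acts on e_1 in the representation of [lam], where all terms above [lam]
    vanish; the coordinate at e_1 determines the entry, since <e_1, e_1> is nonzero. *)
Lemma gram_unique lam (G : 'M[O]_#|Std n lam|) : is_mpart n lam -> is_gram kappa L T G ->
  map_mx (val : O -> F) G = gmx kappa lam (gam lam).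
Proof.
move=> Hlam HG; have [f Hf] := ex_rep Hlam; apply/matrixP => i j; rewrite !mxE.
have Hx := sup_bv (Std1 Hlam).
have := rep_above Hlam Hf (HG i j) Hx; rewrite lrB rowD rowN lrZ rowZ rep_mul // rep_act //.
have nz : fm lam (bv (1%g : 'S_n)) (av lam (1%g : 'S_n)) != 0.
  by rewrite (av1 n kappa lam) form_bv ?Std1 // co_bv eqxx mulr1 gamf_neq0 // Std1.
move/(congr1 (fun y => co y 1%g)); rewrite -scaleN1r coD !coZ (av1 n kappa lam) co_bv eqxx co0.
move: nz; rewrite (av1 n kappa lam); exact: gram_aux.
Qed.

Definition good (y : mcode ell n * 'S_n * 'S_n) : bool :=
  [&& `[< valid y.1.1 >], y.1.2 \in Std n (dec y.1.1) & y.2 \in Std n (dec y.1.1)].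

(** Rewrites membership in the span as one sum over a finite index type, so that each coefficient
    can be isolated by a representation. *)
Lemma span_code z : lspan (murphy_set n kappa L T) z ->
  exists C : mcode ell n * 'S_n * 'S_n -> O,
    z = \sum_(y | good y) C y *: murphyH (dec y.1.1) y.1.2 y.2.
Proof.
elim=> [|c g x [lam [u [v [Hlam Hu Hv ->]]]] _ [C ->]].
  by exists (fun=> 0); rewrite big1 // => y _; rewrite scale0r.
pose y0 := (code n lam, u, v).
have Ed : dec (code n lam) = lam by apply: decK.
have g0 : good y0.
  by rewrite /good /= Ed Hu Hv andbT andbT; apply/asboolP; exists lam.
exists (fun y => (if y == y0 then c else 0) + C y).
rewrite [RHS](eq_bigr (fun y => (if y == y0 then c else 0) *: murphyH (dec y.1.1) y.1.2 y.2 +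
   C y *: murphyH (dec y.1.1) y.1.2 y.2)) => [|y _]; last by rewrite scalerDl.
rewrite big_split /= [X in _ = X + _](bigD1 y0) //= eqxx Ed [X in _ + X + _]big1 ?addr0 // => y /andP[_ /negbTE->].
by rewrite scale0r.
Qed.

Section Straighten.
Variables (lam : mpart ell) (s t : 'S_n).
Hypothesis Hlam : is_mpart n lam.
Variable C : mcode ell n * 'S_n * 'S_n -> O.
Local Notation z := (murphyH lam 1%g s * murphyH lam t 1%g).
Hypothesis HC : z = \sum_(y | good y) C y *: murphyH (dec y.1.1) y.1.2 y.2.

(* in a representation which kills the other terms of the expansion,
   only those of shape mu remain *)
Lemma rep_expand mu f x : is_mpart n mu -> rep_of mu f -> std_supp mu x ->
  (forall y, good y -> C y != 0 -> dom mu (dec y.1.1) -> dec y.1.1 = mu) ->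
  x *m f z = \sum_(u in Std n mu) \sum_(v in Std n mu)
    Oval (C (code n mu, u, v)) *: (fm mu x (av mu u) *: av mu v).
Proof.
move=> Hmu Hf Hx only; rewrite HC lr_sum row_sum.
have Ed : dec (code n mu) = mu by apply: decK.
have gmu u v : good (code n mu, u, v) = (u \in Std n mu) && (v \in Std n mu).
  rewrite /good /= Ed; case: asboolP => // nv; exfalso; apply: nv; by exists mu.
rewrite pair_big_dep /= (bigID (fun y => y.1.1 == code n mu)) /= [X in _ + X]big1 ?addr0; last first.
  move=> [[k u] v] /andP[gy neq]; rewrite lrZ rowZ /=.
  have [vk _ _] := and3P gy; move/asboolP: vk => vk; have [Hk Ek] := decP vk.
  have [->|nz] := eqVneq (C (k, u, v)) 0; first by rewrite Oval0 scale0r.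
  rewrite (rep_zero Hmu Hf _ _ Hk Hx) ?scaler0 // => d.
  have := only _ gy nz d; rewrite /= => E; by move: neq; rewrite /= -[k]Ek E eqxx.
rewrite (reindex_onto (fun p : 'S_n * 'S_n => (code n mu, p.1, p.2)) (fun y => (y.1.2, y.2))) /=; last first.
  by move=> [[k u] v] /andP[_ /eqP /= ->].
apply: eq_big => [[u v]|[u v] _]; first by rewrite /= gmu !eqxx !andbT.
by rewrite lrZ rowZ /= Ed (rep_act Hmu Hf).
Qed.

(** Among the shapes with nonzero coefficient that do not dominate [lam], let mu be minimal. In the
    representation of mu all terms of other shapes vanish by minimality, and z acts as 0 because mu
    does not dominate [lam]; [coef_zero] contradicts the choice. *)
Lemma coef_dom y : good y -> C y != 0 -> dom (dec y.1.1) lam.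
Proof.
move=> gy nz; apply: contrapT => nd.
pose P y := [&& good y, C y != 0 & ~~ `[< dom (dec y.1.1) lam >]].
have Py : P y by rewrite /P gy nz; apply/asboolP.
case: (@arg_minnP _ y P (fun y => domsize n (dec y.1.1)) Py) => {y gy nz nd Py} [[[k u] v]].
move=> /and3P[gy nz /asboolP /= nd] min_y.
have /and3P[/asboolP vk /= Hu Hv] := gy; have [Hk Ek] := decP vk.
set mu := dec k in nd Hu Hv Hk Ek.
have [f Hf] := ex_rep Hk.
have only y : good y -> C y != 0 -> dom mu (dec y.1.1) -> dec y.1.1 = mu.
  move=> gy' nz' d; have /and3P[/asboolP vy _ _] := gy'; have [Hy _] := decP vy.
  apply: (dom_anti Hy Hk _ d); apply: (domsize_dom Hk Hy d).
  apply: min_y; rewrite /P gy' nz' /=; apply/asboolP => d'; apply: nd.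
  exact: dom_trans d d'.
have zero : forall x, std_supp mu x -> x *m f z = 0.
  by move=> x Hx; rewrite lrM rowM (rep_zero Hk Hf _ _ Hlam Hx nd) mul0mx.
have E0 : Oval (C (code n mu, u, v)) = 0.
  apply: (@coef_zero _ _ _ ell0 Hkappa _ Hk (gam mu) (fun w Hw => gamf_neq0 Hkappa Hk Hw)
    (fun u v => Oval (C (code n mu, u, v))) _ u v Hu Hv) => x Hx.
  by rewrite -(rep_expand Hk Hf Hx only) zero.
have {}Ek : code n mu = k by exact: Ek.
by case/eqP: nz; apply: Oval_inj; rewrite Oval0 -E0 Ek.
Qed.

(** By [coef_dom] only terms of shape [lam] act on its own representation, and there z is a multiple
    of the map belonging to u = v = 1. *)
Lemma coef_top u v : u \in Std n lam -> v \in Std n lam ->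
  Oval (C (code n lam, u, v)) =
  if (u == 1%g) && (v == 1%g) then fm lam (av lam s) (av lam t) else 0.
Proof.
move=> Hu Hv; have [f Hf] := ex_rep Hlam; apply/eqP; rewrite -subr_eq0; apply/eqP.
pose D u v := Oval (C (code n lam, u, v)) -
  (if (u == 1%g) && (v == 1%g) then fm lam (av lam s) (av lam t) else 0).
apply: (@coef_zero _ _ _ ell0 Hkappa _ Hlam (gam lam) (fun w Hw => gamf_neq0 Hkappa Hlam Hw) D _ u v Hu Hv) => x Hx.
have only y : good y -> C y != 0 -> dom lam (dec y.1.1) -> dec y.1.1 = lam.
  move=> gy' nz' d; have /and3P[/asboolP vy _ _] := gy'; have [Hy _] := decP vy.
  by apply: (dom_anti Hy Hlam _ d); apply: coef_dom.
have := rep_expand Hlam Hf Hx only; rewrite (rep_mul Hlam Hf) // => E.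
rewrite /D; under eq_bigr do under eq_bigr do rewrite scalerBl.
under eq_bigr do rewrite sumrB; rewrite sumrB -E.
apply/eqP; rewrite subr_eq0 eq_sym; apply/eqP.
rewrite (bigD1 1%g) ?Std1 //= (bigD1 1%g) ?Std1 //= eqxx /=.
rewrite [X in _ + X + _]big1 => [|w /andP[_ /negbTE->]]; last by rewrite scale0r.
rewrite addr0 big1 => [|w /andP[_ /negbTE->]]; last by rewrite big1 // => w' _; rewrite scale0r.
by rewrite addr0 scalerA mulrC.
Qed.

Lemma straightened : in_Habove n kappa L T lam (z - C (code n lam, 1%g, 1%g) *: murphyH lam (1%g : 'S_n) 1%g).
Proof.
have Ed : dec (code n lam) = lam by apply: decK.
pose y0 : mcode ell n * 'S_n * 'S_n := (code n lam, 1%g, 1%g).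
pose Q (y : mcode ell n * 'S_n * 'S_n) := good y && `[< sdom (dec y.1.1) lam >].
have g0 : good y0.
  by rewrite /good /= Ed Std1 // !andbT; apply/asboolP; exists lam.
have E : z - C y0 *: murphyH lam (1%g : 'S_n) 1%g = \sum_(y | Q y) C y *: murphyH (dec y.1.1) y.1.2 y.2.
  rewrite HC (bigD1 y0) //= Ed [X in X - _]addrC addrK /Q.
  rewrite [RHS]big_mkcond [LHS]big_mkcond; apply: eq_bigr => -[[k u] v] _ /=.
  have [gy|//] := boolP (good _); have /and3P[/asboolP vk /= Hu Hv] := gy.
  have [Hk Ek] := decP vk; rewrite /=.
  have [E0|nz] := eqVneq (C (k, u, v)) 0; first by rewrite E0 scale0r; do 2 case: ifP.
  have d := coef_dom gy nz; rewrite /= in d.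
  have [El|neq] := eqVneq k (code n lam).
    rewrite El Ed in Hu Hv *.
    have -> : `[< sdom lam lam >] = false by apply/asboolP => -[_ [l]]; rewrite eqxx.
    case: eqP => //= neq; suff -> : C (code n lam, u, v) = 0 by rewrite scale0r.
    apply: Oval_inj; rewrite Oval0 coef_top //; case: ifP => // /andP[/eqP Eu /eqP Ev].
    by case: neq; rewrite Eu Ev.
  have -> : `[< sdom (dec k) lam >].
    apply/asboolP; split=> //; apply: contrapT => none; case/eqP: neq; rewrite -[k]Ek; congr (code n).
    apply/funext => l; apply/eqP/negPn/negP => neq; apply: none; by exists l.
  by case: eqP => // -[E1]; rewrite E1 eqxx in neq.
rewrite -/y0 E.
exists #|Q|, (fun i => dec (enum_val i).1.1), (fun i => (enum_val i).1.2), (fun i => (enum_val i).2),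
  (fun i => C (enum_val i)); split; last first.
  exact: (big_enum_val (fun y => C y *: murphyH (dec y.1.1) y.1.2 y.2)).
move=> i; have /andP[/and3P[/asboolP vk Hu Hv] /asboolP d] := enum_valP i.
by have [Hk _] := decP vk; split.
Qed.
End Straighten.

Lemma gram_exists lam : is_mpart n lam -> exists G : 'M[O]_#|Std n lam|, is_gram kappa L T G.
Proof.
move=> Hlam; case: (HH) => HA _.
have ex (ij : 'I_#|Std n lam| * 'I_#|Std n lam|) : exists c : O, in_Habove n kappa L T lam
    (murphyH lam 1%g (enum_val ij.1) * murphyH lam (enum_val ij.2) 1%g - c *: murphyH lam (1%g : 'S_n) 1%g).
  have [C HC] := span_code (murphy_span HA 1%g (enum_val ij.1) (enum_val ij.2) 1%g ell0 Hlam).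
  by exists (C (code n lam, 1%g, 1%g)); apply: (straightened Hlam HC).
have [g Hg] := boolp.choice ex; exists (\matrix_(i, j) g (i, j)) => i j.
by rewrite mxE; apply: (Hg (i, j)).
Qed.
End GramMatrix.

Theorem theorem3p13 (ell n : nat) (lam : mpart ell) (kappa : 'I_ell -> int)
    (Hell : (0 < ell)%N)
    (Hlam : is_mpart n lam)
    (Hkappa : forall l : 'I_ell, (l.+1 < ell)%N -> n%:Z < kappa l - kap kappa l.+1)
    (H : algType O) (L T : nat -> H)
    (HH : is_hecke n kappa L T) :
  (exists G : 'M[O]_#|Std n lam|, is_gram kappa L T G) /\
  (exists N : nat, forall e : nat, (N <= e)%N -> deg_mp n kappa e lam = 0) /\
  (forall (G : 'M[O]_#|Std n lam|) (N : nat),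
     is_gram kappa L T G ->
     (forall e : nat, (N <= e)%N -> deg_mp n kappa e lam = 0) ->
     Oval (\det G) =
       tF ^+ len_mp n lam * \prod_(2 <= e < N) (FracField.tofrac 'Phi_e) ^ deg_mp n kappa e lam).
Proof.
split; first exact: (gram_exists Hell Hkappa HH Hlam).
split; first by exists (ebound n kappa lam); apply: deg_mp_zero.
move=> G N HG HN; rewrite -[LHS](det_map_mx (val : O -> F)).
rewrite (gram_unique Hell Hkappa HH Hlam HG) (det_gmx Hell Hkappa Hlam).
exact: (prod_gamf_any Hkappa Hlam HN).
Qed.
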